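(* Let $a>0$ and let $\mathcal{C}_a$ be the catenoid with parameter $a$ in the Heisenberg group $\mathrm{Nil}(3)$ with the left-invariant metric $\hat g$, parametrized by $\mathcal{F}(a,t,\theta)=(f(a,t)\cos\theta,f(a,t)\sin\theta,t)$. Let $e(a,t)=W(a,t)\,\frac{\partial f}{\partial a}(a,t)$, where $W=(1+f_t^2+\frac14 f^2f_t^2)^{-1/2}$. Then: (i) The upper half catenoid $\mathcal{C}_{a,+}=\mathcal{C}_a\cap\{z>0\}$ and the lower half catenoid $\mathcal{C}_{a,-}=\mathcal{C}_a\cap\{z<0\}$ are r-stable. (ii) The function $e(a,\cdot)$ is even and has exactly one zero $z(a)$ on $(0,\infty)$. The domain $\mathcal{F}(a,[-z(a),z(a)],[0,2\pi])$ is a stable-unstable domain in $\mathcal{C}_a$. (iii) Given any $t_1>0$, there exists some $t_2>0$ such that the domain $\mathcal{D}_a(-t_1,t_2)=\mathcal{F}(a,[-t_1,t_2],[0,2\pi])$ is stable-unstable. In particular, both $\mathcal{C}_{a,+}$ and $\mathcal{C}_{a,-}$ are maximal r-stable rotationally invariant domains of $\mathcal{C}_a$.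
   Context: $\mathrm{Nil}(3)$ is $\mathbb{R}^3$ with the group law $(x,y,z)\star(x',y',z')=(x+x',y+y',z+z'+\frac12(xy'-x'y))$, equipped with the left-invariant Riemannian metric $\hat g=dx^2+dy^2+\big(dz+\frac12(y\,dx-x\,dy)\big)^2$. For $a>0$, $f(a,\cdot):\mathbb{R}\to[a,\infty)$ denotes the unique global solution of the Cauchy problem $f(f^2+4)f_{tt}=4(1+f_t^2)$, $f(0)=a$, $f_t(0)=0$ (subscript $t$ denotes derivative in $t$). The catenoid $\mathcal{C}_a$ is the complete minimal surface given by the map $\mathcal{F}(a,t,\theta)=(f(a,t)\cos\theta,f(a,t)\sin\theta,t)$, $t\in\mathbb{R}$, $\theta\in[0,2\pi]$; it is invariant under the rotations $(x,y,z)\mapsto(x\cos\theta-y\sin\theta,x\sin\theta+y\cos\theta,z)$, which are isometries of $\hat g$. A domain in $\mathcal{C}_a$ is rotationally invariant if it is invariant under these rotations. For an orientable minimal surface $M$ immersed in an oriented Riemannian $3$-manifold, with unit normal $N_M$ and second fundamental form $A_M$, the Jacobi operator is $J_M=-\Delta_M-(|A_M|^2+\widehat{\mathrm{Ric}}(N_M))$, where $\Delta_M$ is the non-positive Laplacian of the induced metric and $\widehat{\mathrm{Ric}}(N_M)$ is the ambient Ricci curvature in the direction $N_M$. For a relatively compact regular domain $\Omega\subset M$, let $\lambda_1(\Omega)$ be the least eigenvalue of $J_M$ in $\Omega$ with Dirichlet boundary conditions. $\Omega$ is called stable if $\lambda_1(\Omega)>0$, unstable if $\lambda_1(\Omega)<0$,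 and stable-unstable if $\lambda_1(\Omega)=0$. A (not necessarily relatively compact) domain $\Omega$ is called r-stable if any relatively compact subdomain of $\Omega$ is stable. *)

(* Defs.v *)
From HB Require Import structures.
From mathcomp Require Import all_boot all_order all_algebra.
From mathcomp Require Import all_classical all_reals all_analysis.
Set Implicit Arguments.
Unset Strict Implicit.
Unset Printing Implicit Defensive.
Import Order.TTheory GRing.Theory Num.Theory.
Import numFieldNormedType.Exports.
Local Open Scope ring_scope.
Local Open Scope classical_set_scope.

Section Calculus.
Context {R : realType} {n : nat}.
Implicit Types (f : 'rV[R]_n -> R) (U : set 'rV[R]_n).

Definition partial (i : 'I_n) f (p : 'rV[R]_n) : R := 'D_(delta_mx 0 i) f p.

(* f is of class C^k on the open set U. *)
Fixpoint Ck (k : nat) U f : Prop :=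
  (forall p, U p -> {for p, continuous f}) /\
  if k is k'.+1 then
    forall i : 'I_n, (forall p, U p -> derivable f p (delta_mx 0 i)) /\
                     Ck k' U (partial i f)
  else True.

Definition smooth_on U f : Prop := forall k, Ck k U f.

End Calculus.

Definition vec2 {R : realType} (s t : R) : 'rV[R]_2 := \row_i [:: s; t]`_i.
Definition vec3 {R : realType} (x y z : R) : 'rV[R]_3 := \row_i [:: x; y; z]`_i.

(* A Riemannian metric on R^n is given by its Gram matrix in the standard
   coordinates; all tensors below are expressed in these coordinates. *)
Section Riemannian.
Context {R : realType} {n : nat}.
Variable g : 'rV[R]_n -> 'M[R]_n.

Definition inner (p u v : 'rV[R]_n) : R := (u *m g p *m v^T) 0 0.

(* christoffel k i j is the symbol with upper index k. *)
Definition christoffel (k i j : 'I_n) (p : 'rV[R]_n) : R :=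
  2^-1 * \sum_(l < n) invmx (g p) k l *
    (partial i (fun q => g q j l) p + partial j (fun q => g q i l) p
     - partial l (fun q => g q i j) p).

(* Sign convention: the Ricci curvature of a round sphere is positive. *)
Definition ricci (p : 'rV[R]_n) : 'M[R]_n :=
  \matrix_(i, j) \sum_(k < n)
    (partial k (christoffel k i j) p - partial j (christoffel k i k) p
     + \sum_(l < n) (christoffel k k l p * christoffel l i j p
                     - christoffel k j l p * christoffel l i k p)).

End Riemannian.

(* An immersed surface in (R^3, g) is given by a map X : R^2 -> R^3, whose
   domain need not be a fundamental domain: X may be a covering of its image. *)
Section ImmersedSurface.
Context {R : realType}.
Variable g : 'rV[R]_3 -> 'M[R]_3.
Variable X : 'rV[R]_2 -> 'rV[R]_3.

Definition tangent (al : 'I_2) (q : 'rV[R]_2) : 'rV[R]_3 :=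
  \row_k partial al (fun q' => X q' 0 k) q.

Definition first_form (q : 'rV[R]_2) : 'M[R]_2 :=
  \matrix_(al, be) inner g (X q) (tangent al q) (tangent be q).

Definition cross (u v : 'rV[R]_3) : 'rV[R]_3 :=
  vec3 (u 0 1 * v 0 2 - u 0 2 * v 0 1)
       (u 0 2 * v 0 0 - u 0 0 * v 0 2)
       (u 0 0 * v 0 1 - u 0 1 * v 0 0).

(* The Euclidean cross product of the tangent vectors is a covector that
   vanishes on the tangent plane; g^-1 turns it into a g-normal vector. *)
Definition normal_dir (q : 'rV[R]_2) : 'rV[R]_3 :=
  cross (tangent 0 q) (tangent 1 q) *m invmx (g (X q)).

Definition unit_normal (q : 'rV[R]_2) : 'rV[R]_3 :=
  (Num.sqrt (inner g (X q) (normal_dir q) (normal_dir q)))^-1 *: normal_dir q.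

(* The ambient covariant derivative of the tangent field [tangent be] in the
   direction [tangent al]. *)
Definition covariant (al be : 'I_2) (q : 'rV[R]_2) : 'rV[R]_3 :=
  \row_k (partial al (fun q' => tangent be q' 0 k) q
          + \sum_(i < 3) \sum_(j < 3)
              christoffel g k i j (X q) * tangent al q 0 i * tangent be q 0 j).

Definition second_form (q : 'rV[R]_2) : 'M[R]_2 :=
  \matrix_(al, be) inner g (X q) (covariant al be q) (unit_normal q).

Definition second_form_sqnorm (q : 'rV[R]_2) : R :=
  \tr (invmx (first_form q) *m second_form q
       *m invmx (first_form q) *m second_form q).

Definition ricci_normal (q : 'rV[R]_2) : R :=
  (unit_normal q *m ricci g (X q) *m (unit_normal q)^T) 0 0.

Definition laplacian (w : 'rV[R]_2 -> R) (q : 'rV[R]_2) : R :=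
  (Num.sqrt (\det (first_form q)))^-1 *
  \sum_(al < 2) partial al
    (fun q' => Num.sqrt (\det (first_form q')) *
               \sum_(be < 2) invmx (first_form q') al be * partial be w q') q.

Definition jacobi (w : 'rV[R]_2 -> R) (q : 'rV[R]_2) : R :=
  - laplacian w q - (second_form_sqnorm q + ricci_normal q) * w q.

(* From here on X is meant to be a smooth covering of an embedded surface,
   range X, carrying the topology induced by R^3. *)

Definition rel_interior (D : set 'rV[R]_3) : set 'rV[R]_3 :=
  [set p | D p /\ exists2 V, open_nbhs p V & V `&` range X `<=` D].

Definition rel_boundary (D : set 'rV[R]_3) : set 'rV[R]_3 :=
  closure D `\` rel_interior D.

Definition is_domain (D : set 'rV[R]_3) : Prop :=
  [/\ D `<=` range X, rel_interior D = D, D !=set0 & connected D].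

(* Relatively compact domains with smooth boundary; D may contain (part of) its
   boundary, so that compact regions such as images of closed bands are allowed.
   Near a boundary point, read in the chart X, the interior of D is the
   sublevel set of a smooth function phi with nonzero differential. *)
Definition regular_domain (D : set 'rV[R]_3) : Prop :=
  [/\ is_domain (rel_interior D),
      D `<=` closure (rel_interior D),
      compact (closure D),
      closure D `<=` range X
    & forall q, rel_boundary D (X q) ->
        exists V, exists phi : 'rV[R]_2 -> R,
          [/\ open_nbhs q V, smooth_on V phi,
              exists i, partial i phi q != 0
            & forall q', V q' -> (rel_interior D (X q') <-> phi q' < 0)]].

(* l is an eigenvalue of the Jacobi operator on D with Dirichlet conditions;
   functions on the surface are represented by their extensions to R^3, of which
   only the values on range X are used. *)
Definition dirichlet_eigenvalue (D : set 'rV[R]_3) (l : R) : Prop :=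
  exists u : 'rV[R]_3 -> R,
    [/\ exists2 p, rel_interior D p & u p != 0,
        Ck 2 (X @^-1` rel_interior D) (u \o X),
        {within closure D, continuous u},
        forall p, rel_boundary D p -> u p = 0
      & forall q, rel_interior D (X q) -> jacobi (u \o X) q = l * u (X q)].

(* The least eigenvalue, as an infimum in the extended reals (on a regular
   domain the infimum is attained, by elliptic theory). *)
Definition lambda1 (D : set 'rV[R]_3) : \bar R :=
  ereal_inf [set l%:E | l in dirichlet_eigenvalue D].

Definition stable (D : set 'rV[R]_3) : Prop := (0 < lambda1 D)%E.

Definition stable_unstable (D : set 'rV[R]_3) : Prop :=
  [/\ regular_domain D, dirichlet_eigenvalue D 0 & lambda1 D = 0%E].

Definition r_stable (D : set 'rV[R]_3) : Prop :=
  forall D', regular_domain D' -> D' `<=` D -> stable D'.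

End ImmersedSurface.

Section Catenoids.
Context {R : realType}.

(* dx^2 + dy^2 + eta^2 with eta = dz + (y dx - x dy)/2 *)
Definition nil_eta (p : 'rV[R]_3) : 'rV[R]_3 :=
  vec3 (p 0 1 / 2) (- (p 0 0 / 2)) 1.

Definition nil_metric (p : 'rV[R]_3) : 'M[R]_3 :=
  delta_mx 0 0 + delta_mx 1 1 + (nil_eta p)^T *m nil_eta p.

Definition rotation (phi : R) (p : 'rV[R]_3) : 'rV[R]_3 :=
  vec3 (p 0 0 * cos phi - p 0 1 * sin phi)
       (p 0 0 * sin phi + p 0 1 * cos phi)
       (p 0 2).

Definition rotationally_invariant (D : set 'rV[R]_3) : Prop :=
  forall phi p, D p -> D (rotation phi p).

Definition catenary_solution (a : R) (h : R -> R) : Prop :=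
  [/\ forall t : R, a <= h t,
      forall t : R, derivable h t 1 /\ derivable (derive1 h) t 1,
      forall t : R, h t * (h t ^+ 2 + 4) * derive1 (derive1 h) t = 4 * (1 + derive1 h t ^+ 2),
      h 0 = a
    & derive1 h 0 = 0].

Variable f : R -> R -> R.
Variable a : R.

(* Coordinates on R^2: q 0 0 is t and q 0 1 is theta. *)
Definition catenoid_map (q : 'rV[R]_2) : 'rV[R]_3 :=
  vec3 (f a (q 0 0) * cos (q 0 1)) (f a (q 0 0) * sin (q 0 1)) (q 0 0).

Definition catenoid : set 'rV[R]_3 := range catenoid_map.

Definition upper_half : set 'rV[R]_3 := catenoid `&` [set p : 'rV[R]_3 | 0 < p 0 2].
Definition lower_half : set 'rV[R]_3 := catenoid `&` [set p : 'rV[R]_3 | p 0 2 < 0].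

Definition catenoid_band (s t : R) : set 'rV[R]_3 :=
  catenoid_map @` [set q : 'rV[R]_2 | s <= q 0 0 <= t /\ 0 <= q 0 1 <= 2 * pi].

Definition catW (t : R) : R :=
  (Num.sqrt (1 + derive1 (f a) t ^+ 2 + 4^-1 * f a t ^+ 2 * derive1 (f a) t ^+ 2))^-1.

Definition cat_e (t : R) : R := catW t * derive1 (fun b => f b t) a.

Definition maximal_r_stable_rot_domain (D : set 'rV[R]_3) : Prop :=
  let P E := [/\ is_domain catenoid_map E, rotationally_invariant E
               & r_stable nil_metric catenoid_map E] in
  P D /\ forall E, P E -> D `<=` E -> E = D.

End Catenoids.

(* Main.v *)
(* The catenary equation has the first integral f_t^2 = 4 (f^2 - a^2) / (a^2 (f^2 + 4)),
   which gives W = a / f and makes the Jacobi operator explicit.  Vertical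
   translations and the variation of a yield the Jacobi functions v = W f_t and
   e = 1 - tau v, where tau is odd and increasing.  For t != 0 one has
   e + c v = v (c - kappa) with kappa = tau - 1 / v, and the Wronskian identity gives
   kappa' >= 1 / a on each half-line; this locates all the zeros of e + c v.

   No spectral theory is needed for the eigenvalues: by the maximum principle
   applied to u / w, a positive function w of t with J w >= l w on the closure of a
   domain forces every Dirichlet eigenvalue there to be at least l.  On domains of
   half catenoids a strict supersolution comes from a positive e + c v; on the bands
   between two zeros of e + c v small perturbations of it give l = - d for every
   d > 0, while e + c v itself is an eigenfunction for 0.  An invariant domain that
   properly contains a half catenoid contains such a band. *)
Require Import Defs.
From mathcomp Require Import all_boot all_order all_algebra.
From mathcomp Require Import all_classical all_reals all_analysis.
From mathcomp Require Import ring lra.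
Import Order.TTheory GRing.Theory Num.Theory.
Import numFieldNormedType.Exports.
Set Implicit Arguments.
Unset Strict Implicit.
Unset Printing Implicit Defensive.
Local Open Scope ring_scope.
Local Open Scope classical_set_scope.

(** * Directional derivatives and the geometry of Nil(3) *)

(** The hypotheses provide, for each b separately, a solution of the catenary equation, and say
    nothing on how it varies with b. The derivative in b that enters e has to be produced by hand,
    by trading the second-order equation for a primitive that depends explicitly on b. The function
    tau comes out of that computation: the derivative of f in a is f / a - f_t tau, and multiplying
    by W = a / f gives 1 - tau v.

    kappa is the quotient - e / v of two Jacobi functions. Its derivative is therefore their
    Wronskian divided by v^2, and solving e + c v = 0 amounts to inverting kappa.

    On a band, e + c v vanishes on the two boundary circles, so it cannot itself be the positive
    comparison function; hence the perturbation, and the loss of an arbitrary d.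

    Eigenfunctions are not assumed rotationally invariant and are not decomposed into Fourier modes.
    The comparison function depends on t alone, while the theta-derivatives and mixed derivatives of
    the eigenfunction are absorbed by the positivity of the inverse first fundamental form. *)

Lemma is_derive_line (R : realType) (V W : normedModType R) (g : V -> W)
  (p v : V) (dg : W) :
  is_derive p v g dg <-> is_derive (0 : R) 1 (fun s : R => g (s *: v + p)) dg.
Proof.
have E : 'D_v g p = 'D_1 (fun s : R => g (s *: v + p)) (0 : R).
  rewrite /derive.
  suff -> : (fun h : R => h^-1 *: ((g \o shift p) (h *: v) - g p)) =
    (fun h : R => h^-1 *: (((fun s : R => g (s *: v + p)) \o shift 0) (h *: 1)
                           - g (0 *: v + p))) by [].
  by apply/funext => s /=; rewrite addr0 scale0r add0r [_%:A]mulr1.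
split=> [[/derivable1P gd <-]|[gd <-]].
  exact: (DeriveDef gd).
by apply: DeriveDef; first exact/derivable1P.
Qed.

Lemma is_derive_compr (R : realType) (V : normedModType R) (g : V -> R)
  (h : R -> R) (p v : V) (dg dh : R) :
  is_derive p v g dg -> is_derive (g p) 1 h dh ->
  is_derive p v (fun q => h (g q)) (dh * dg).
Proof.
move=> /is_derive_line Hg Hh; apply/is_derive_line.
apply: (@is_derive1_comp _ h (fun s => g (s *: v + p))).
by rewrite scale0r add0r.
Qed.

Lemma is_derive_coord (R : realType) (n : nat) (i : 'I_n.+1) (p v : 'rV[R]_n.+1) :
  is_derive p v (fun q : 'rV[R]_n.+1 => q 0 i) (v 0 i).
Proof.
have d : differentiable (fun q : 'rV[R]_n.+1 => q 0 i) p by exact: differentiable_coord.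
apply: DeriveDef; first exact: diff_derivable.
apply: cvg_lim => //; apply: cvg_near_cst.
exists 1 => //= h _ h0.
by rewrite !mxE addrK /GRing.scale /= mulKf.
Qed.

Lemma partial_val (R : realType) (n : nat) (i : 'I_n) (g : 'rV[R]_n -> R) p d :
  is_derive p (delta_mx 0 i) g d -> partial i g p = d.
Proof. by move=> H; rewrite /partial derive_val. Qed.

Lemma invmx_unique (R : comUnitRingType) (n : nat) (A B : 'M[R]_n) :
  A *m B = 1%:M -> invmx A = B.
Proof.
move=> AB; have [Au _] := mulmx1_unit AB.
by rewrite -[LHS]mulmx1 -AB mulmxA mulVmx// mul1mx.
Qed.

Definition quad {R : realType} (c : seq R) (x y : R) : R :=
  c`_0 + c`_1 * x + c`_2 * y + c`_3 * x ^+ 2 + c`_4 * (x * y) + c`_5 * y ^+ 2.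

Lemma partial_quad (R : realType) (m : 'I_3) (c : seq R) (p : 'rV[R]_3) :
  partial m (fun q => quad c (q 0 0) (q 0 1)) p =
  (m == 0)%:R * (c`_1 + 2 * c`_3 * p 0 0 + c`_4 * p 0 1) +
  (m == 1)%:R * (c`_2 + c`_4 * p 0 0 + 2 * c`_5 * p 0 1).
Proof.
apply: partial_val; rewrite /quad.
have D0 := is_derive_coord 0 p (delta_mx 0 m).
have D1 := is_derive_coord 1 p (delta_mx 0 m).
apply: is_derive_eq.
rewrite /GRing.scale/= !mxE /= -!(eq_sym m).
ring.
Qed.

(* Every entry of the metric, and every Christoffel symbol, is a quadratic
   polynomial in x and y, stored as its list of coefficients for [quad]. *)
Definition nil_metric_coef {R : realType} (i j : nat) : seq R :=
  match i, j with
  | 0, 0 => [:: 1; 0; 0; 0; 0; 4^-1]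
  | 1, 1 => [:: 1; 0; 0; 4^-1; 0; 0]
  | 2, 2 => [:: 1; 0; 0; 0; 0; 0]
  | 0, 1 | 1, 0 => [:: 0; 0; 0; 0; - 4^-1; 0]
  | 0, 2 | 2, 0 => [:: 0; 0; 2^-1; 0; 0; 0]
  | 1, 2 | 2, 1 => [:: 0; - 2^-1; 0; 0; 0; 0]
  | _, _ => [::]
  end.

Lemma nil_metricE (R : realType) (i j : 'I_3) (p : 'rV[R]_3) :
  nil_metric p i j = quad (nil_metric_coef i j) (p 0 0) (p 0 1).
Proof.
case: i => [[|[|[|//]]] hi]; case: j => [[|[|[|//]]] hj];
  rewrite /nil_metric /quad !mxE !big_ord_recl !big_ord0 !mxE /=; field => //.
Qed.

(** The sum of the squares of the orthonormal frame d/dx - (y/2) d/dz, d/dy + (x/2) d/dz, d/dz,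
    which is dual to dx, dy, eta. *)
Definition nil_inv {R : realType} (x y : R) : 'M[R]_3 :=
  \matrix_(i, j) match nat_of_ord i, nat_of_ord j with
  | 0, 2 | 2, 0 => - (y / 2)
  | 1, 2 | 2, 1 => x / 2
  | 0, 1 | 1, 0 => 0
  | 2, 2 => 1 + (x ^+ 2 + y ^+ 2) / 4
  | _, _ => 1
  end.

Lemma invmx_nil_metric (R : realType) (p : 'rV[R]_3) :
  invmx (nil_metric p) = nil_inv (p 0 0) (p 0 1).
Proof.
apply: invmx_unique; apply/matrixP => i j.
rewrite !mxE !big_ord_recl !big_ord0 !nil_metricE !mxE.
by case: i => [[|[|[|//]]] hi]; case: j => [[|[|[|//]]] hj];
  rewrite /quad /=; field => //.
Qed.

Definition nil_christoffel_coef {R : realType} (k i j : nat) : seq R :=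
  match k, i, j with
  | 0, 0, 1 | 0, 1, 0 => [:: 0; 0; 4^-1; 0; 0; 0]
  | 0, 1, 1 => [:: 0; - 2^-1; 0; 0; 0; 0]
  | 0, 1, 2 | 0, 2, 1 => [:: 2^-1; 0; 0; 0; 0; 0]
  | 1, 0, 0 => [:: 0; 0; - 2^-1; 0; 0; 0]
  | 1, 0, 1 | 1, 1, 0 => [:: 0; 4^-1; 0; 0; 0; 0]
  | 1, 0, 2 | 1, 2, 0 => [:: - 2^-1; 0; 0; 0; 0; 0]
  | 2, 0, 0 => [:: 0; 0; 0; 0; - 4^-1; 0]
  | 2, 0, 1 | 2, 1, 0 => [:: 0; 0; 0; 8^-1; 0; - 8^-1]
  | 2, 0, 2 | 2, 2, 0 => [:: 0; - 4^-1; 0; 0; 0; 0]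
  | 2, 1, 1 => [:: 0; 0; 0; 0; 4^-1; 0]
  | 2, 1, 2 | 2, 2, 1 => [:: 0; 0; - 4^-1; 0; 0; 0]
  | _, _, _ => [::]
  end.

Lemma partial_nil_metric (R : realType) (m i j : 'I_3) (p : 'rV[R]_3) :
  partial m (fun q => nil_metric q i j) p =
  partial m (fun q => quad (nil_metric_coef i j) (q 0 0) (q 0 1)) p.
Proof. by congr (partial m _ p); apply/funext => q; exact: nil_metricE. Qed.

Lemma nil_christoffelE (R : realType) (k i j : 'I_3) (p : 'rV[R]_3) :
  christoffel nil_metric k i j p =
  quad (nil_christoffel_coef k i j) (p 0 0) (p 0 1).
Proof.
rewrite /christoffel invmx_nil_metric !big_ord_recl big_ord0.
rewrite !partial_nil_metric !partial_quad !mxE.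
by case: k => [[|[|[|//]]] hk]; case: i => [[|[|[|//]]] hi];
  case: j => [[|[|[|//]]] hj]; rewrite /quad /=; field => //.
Qed.

(** The matrix of - (dx^2 + dy^2) / 2 + eta^2 / 2: the Ricci curvature is - 1/2 on horizontal
    vectors and 1/2 along the fibre. [nil_ricci_normE] reads it in this form. *)
Definition nil_ricci {R : realType} (x y : R) : 'M[R]_3 :=
  \matrix_(i, j) match nat_of_ord i, nat_of_ord j with
  | 0, 2 | 2, 0 => y / 4
  | 1, 2 | 2, 1 => - (x / 4)
  | 0, 1 | 1, 0 => - (x * y / 8)
  | 0, 0 => - 2^-1 + y ^+ 2 / 8
  | 1, 1 => - 2^-1 + x ^+ 2 / 8
  | _, _ => 2^-1
  end.

Lemma nil_ricciE (R : realType) (p : 'rV[R]_3) :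
  ricci nil_metric p = nil_ricci (p 0 0) (p 0 1).
Proof.
have E k i j m : partial m (christoffel nil_metric k i j) p =
    partial m (fun q => quad (nil_christoffel_coef k i j) (q 0 0) (q 0 1)) p.
  by congr (partial m _ p); apply/funext => q; exact: nil_christoffelE.
apply/matrixP => i j.
rewrite [LHS]mxE !big_ord_recl !big_ord0 !E !partial_quad !nil_christoffelE [RHS]mxE.
by case: i => [[|[|[|//]]] hi]; case: j => [[|[|[|//]]] hj];
  rewrite /quad /=; field => //.
Qed.

(** * One-variable calculus *)

Lemma is_derive_cont (R : realType) (F : R -> R) (x d : R) :
  is_derive x 1 F d -> {for x, continuous F}.
Proof. by case=> + _ => /derivable1_diffP/differentiable_continuous. Qed.

Lemma MVT_le (R : realType) (F dF : R -> R) (a b : R) : a <= b ->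
  (forall x, a <= x <= b -> is_derive x 1 F (dF x)) ->
  exists2 c, a <= c <= b & F b - F a = dF c * (b - a).
Proof.
move=> ab H.
have [x|//|c] := @MVT_segment R F dF a b ab.
- by rewrite in_itv/= => /andP[ax xb]; apply: H; rewrite !ltW.
- apply: derivable_within_continuous => x; rewrite in_itv/= => xab.
  by case: (H x xab).
- by rewrite in_itv/= => cab E; exists c.
Qed.

Lemma MVT_between (R : realType) (F dF : R -> R) (a b : R) :
  (forall x : R, `|x - a| <= `|b - a| -> is_derive x 1 F (dF x)) ->
  exists2 c, `|c - a| <= `|b - a| & F b - F a = dF c * (b - a).
Proof.
move=> H; have [ab|ba] := leP a b.
  have ball x : a <= x <= b -> `|x - a| <= `|b - a|.
    by move=> /andP[ax xb]; rewrite !ger0_norm ?subr_ge0// lerD2r.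
  have [c cab ->] := MVT_le ab (fun x xab => H x (ball x xab)).
  by exists c => //; exact: ball.
have ball x : b <= x <= a -> `|x - a| <= `|b - a|.
  by move=> /andP[bx xa]; rewrite !ler0_norm ?subr_le0// ?(ltW ba)// lerN2 lerD2r.
have [c cab E] := MVT_le (ltW ba) (fun x xab => H x (ball x xab)).
exists c; last by rewrite -opprB E -mulrN opprB.
exact: ball.
Qed.

Lemma derive_gt0_lt (R : realType) (F dF : R -> R) (a b : R) :
  (forall x : R, is_derive x 1 F (dF x)) -> (forall x, 0 < dF x) ->
  (F a < F b) = (a < b).
Proof.
move=> H dF0.
have lt_ (x y : R) : x < y -> F x < F y.
  move=> xy; have [c _ E] := MVT_le (ltW xy) (fun x _ => H x).
  by rewrite -subr_gt0 E mulr_gt0 ?subr_gt0.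
have [/lt_ ->//|/lt_ /ltW|->] := ltgtP a b; last by rewrite ltxx.
by rewrite ltNge => ->.
Qed.

Lemma derive_gt0_inj (R : realType) (F dF : R -> R) :
  (forall x : R, is_derive x 1 F (dF x)) -> (forall x, 0 < dF x) -> injective F.
Proof.
move=> H H0 x y E; apply/eqP; rewrite eq_le !leNgt; apply/andP; split.
  by rewrite -(derive_gt0_lt y x H H0) E ltxx.
by rewrite -(derive_gt0_lt x y H H0) E ltxx.
Qed.

(** The integral from - n is a primitive only to the right of - n. Normalised at 0 it no longer
    depends on n ([E]), so n may grow with the point and the primitive becomes global. *)
Lemma antiderivative (R : realType) (h : R -> R) : continuous h ->
  exists F : R -> R, F 0 = 0 /\ forall x : R, is_derive x 1 F (h x).
Proof.
move=> hc; pose mu := @lebesgue_measure R.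
pose G (n x : R) := (\int[mu]_(t in [set` `[- n, x]]) (h t))%R.
have dG (n x : R) : - n < x -> is_derive x 1 (G n) (h x).
  move=> nx; have [|//|d E] := @continuous_FTC1_closed R h (- n) x (x + 1) _ _ nx (hc x).
  - by rewrite ltrDl.
  - apply: continuous_compact_integrable; first exact: segment_compact.
    exact: continuous_subspaceT.
  - by apply: DeriveDef d _; rewrite -derive1E.
have E (n m x : R) : `|x| < n -> `|x| < m -> G n x - G n 0 = G m x - G m 0.
  move=> xn xm; pose D (y : R) := G n y - G m y.
  have dD (y : R) : `|y| <= `|x| -> is_derive y 1 D 0.
    move=> yx; rewrite -(subrr (h y)); apply: is_deriveB; apply: dG.
      by rewrite ltrNl (le_lt_trans _ xn)// (le_trans _ yx)// -normrN ler_norm.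
    by rewrite ltrNl (le_lt_trans _ xm)// (le_trans _ yx)// -normrN ler_norm.
  have DE : D x = D 0.
    have [x0|x0] := leP 0 x.
      have [y|c _] := @MVT_le R D (fun=> 0) 0 x x0.
        by move=> /andP[y0 yx]; apply: dD; rewrite !ger0_norm.
      by rewrite mul0r => /eqP; rewrite subr_eq0 => /eqP.
    have [y|c _] := @MVT_le R D (fun=> 0) x 0 (ltW x0).
      by move=> /andP[y0 yx]; apply: dD; rewrite !ler0_norm ?lerN2// ltW.
    by rewrite mul0r => /eqP; rewrite subr_eq0 => /eqP.
  by move: DE; rewrite /D => DE; lra.
exists (fun x : R => G (`|x| + 1) x - G (`|x| + 1) 0); split; first by rewrite subrr.
move=> x.
(* The base point moves with y; on the ball of radius 1 around x it can be frozen at - (|x| + 2). *)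
apply: (@near_eq_is_derive _ _ _ (fun y : R => G (`|x| + 2) y - G (`|x| + 2) 0)).
  near=> y; apply: E; last by rewrite ltrDl.
  have : `|y - x| < 1 by near: y; exists 1 => //= z; rewrite /ball_ distrC.
  move=> yx; have := ler_normD (y - x) x; rewrite subrK; lra.
rewrite -[h x]subr0; apply: is_deriveB; apply: dG.
have := ler_norm (- x); rewrite normrN; lra.
Unshelve. all: by end_near. Qed.

Lemma is_derive_inv (R : realType) (g : R -> R) (x dg : R) :
  is_derive x 1 g dg -> g x != 0 ->
  is_derive x 1 (fun y : R => (g y)^-1) (- dg / g x ^+ 2).
Proof.
move=> Dg g0; apply: (is_derive_eq (is_deriveV g0 Dg)).
by rewrite /GRing.scale/= !mulNr mulrC.
Qed.

(** * The catenary equation *)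

Lemma catenary_gt0 (R : realType) (a : R) (h : R -> R) :
  0 < a -> catenary_solution a h -> forall t, 0 < h t.
Proof. by move=> a0 [ah _ _ _ _] t; exact: lt_le_trans (ah t). Qed.

Lemma catenary_derive (R : realType) (a : R) (h : R -> R) (t : R) :
  catenary_solution a h -> is_derive t 1 h (derive1 h t).
Proof.
move=> [_ dh _ _ _]; have [d _] := dh t.
by rewrite derive1E; exact: derivableP.
Qed.

Lemma catenary_derive' (R : realType) (a : R) (h : R -> R) (t : R) :
  catenary_solution a h -> is_derive t 1 (derive1 h) (derive1 (derive1 h) t).
Proof.
move=> [_ dh _ _ _]; have [_ d] := dh t.
by rewrite [X in is_derive _ _ _ X]derive1E; exact: derivableP.
Qed.

Lemma catenary_first_integral (R : realType) (a : R) (h : R -> R) (t : R) :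
  0 < a -> catenary_solution a h ->
  a ^+ 2 * (h t ^+ 2 + 4) * derive1 h t ^+ 2 = 4 * (h t ^+ 2 - a ^+ 2).
Proof.
move=> a0 sol; have h0 := catenary_gt0 a0 sol.
(* The equation gives (log (1 + h'^2))' = 8 h' / (h (h^2 + 4)) = (2 log h - log (h^2 + 4))', so
   [Phi] is conserved; its value at 0 is (a^2 + 4) / a^2. *)
pose Phi (s : R) := (1 + derive1 h s ^+ 2) * (h s ^+ 2 + 4) * (h s ^+ 2)^-1.
have dPhi (s : R) : is_derive s 1 Phi 0.
  have D1 := catenary_derive s sol; have D2 := catenary_derive' s sol.
  have hs0 : h s != 0 by rewrite gt_eqF.
  have hs2 : h s ^+ 2 != 0 by rewrite expf_neq0.
  have hs4 : h s ^+ 2 + 4 != 0 by rewrite gt_eqF// ltr_wpDl ?sqr_ge0.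
  have DV : is_derive s 1 (fun u : R => (h u ^+ 2)^-1)
      (- (2 * h s * derive1 h s) / (h s ^+ 2) ^+ 2).
    apply: is_derive_inv => //.
    by apply: is_derive_eq; rewrite /GRing.scale/=; ring.
  have E : derive1 (derive1 h) s = 4 * (1 + derive1 h s ^+ 2) / (h s * (h s ^+ 2 + 4)).
    have [_ _ /(_ s) <- _ _] := sol.
    by field; rewrite hs4 hs0.
  apply: is_derive_eq.
  rewrite /GRing.scale/= E /=.
  by field; rewrite hs4 hs0.
have := is_derive_0_is_cst t 0 dPhi; rewrite /Phi.
have [_ _ _ -> ->] := sol => H.
have ht0 : h t != 0 by rewrite gt_eqF.
have a0' : a != 0 by rewrite gt_eqF.
have : a ^+ 2 * h t ^+ 2 * ((1 + derive1 h t ^+ 2) * (h t ^+ 2 + 4) / h t ^+ 2) =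
  a ^+ 2 * h t ^+ 2 * ((1 + 0 ^+ 2) * (a ^+ 2 + 4) / a ^+ 2) by rewrite H.
have -> : a ^+ 2 * h t ^+ 2 * ((1 + derive1 h t ^+ 2) * (h t ^+ 2 + 4) / h t ^+ 2) =
  a ^+ 2 * ((1 + derive1 h t ^+ 2) * (h t ^+ 2 + 4)) by field.
have -> : a ^+ 2 * h t ^+ 2 * ((1 + 0 ^+ 2) * (a ^+ 2 + 4) / a ^+ 2) =
  h t ^+ 2 * (a ^+ 2 + 4) by field.
move=> K; lra.
Qed.

Lemma catenary_slope_sqr (R : realType) (a : R) (h : R -> R) (t : R) :
  0 < a -> catenary_solution a h ->
  derive1 h t ^+ 2 = 4 * (h t ^+ 2 - a ^+ 2) / (a ^+ 2 * (h t ^+ 2 + 4)).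
Proof.
move=> a0 sol; have <- := catenary_first_integral t a0 sol.
have hs4 : h t ^+ 2 + 4 != 0 by rewrite gt_eqF// ltr_wpDl ?sqr_ge0.
by field; rewrite hs4 gt_eqF.
Qed.

Lemma catenary_second (R : realType) (a : R) (h : R -> R) (t : R) :
  0 < a -> catenary_solution a h ->
  derive1 (derive1 h) t = 4 * (a ^+ 2 + 4) * h t / (a ^+ 2 * (h t ^+ 2 + 4) ^+ 2).
Proof.
move=> a0 sol; have h0 := catenary_gt0 a0 sol t.
have hs4 : h t ^+ 2 + 4 != 0 by rewrite gt_eqF// ltr_wpDl ?sqr_ge0.
have -> : derive1 (derive1 h) t = 4 * (1 + derive1 h t ^+ 2) / (h t * (h t ^+ 2 + 4)).
  have [_ _ /(_ t) <- _ _] := sol.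
  by field; rewrite hs4 gt_eqF.
rewrite (catenary_slope_sqr t a0 sol).
by field; rewrite hs4 !gt_eqF.
Qed.

Lemma catWE (R : realType) (f : R -> R -> R) (a t : R) :
  0 < a -> catenary_solution a (f a) -> catW f a t = a / f a t.
Proof.
move=> a0 sol; have h0 := catenary_gt0 a0 sol t.
have hs4 : f a t ^+ 2 + 4 != 0 by rewrite gt_eqF// ltr_wpDl ?sqr_ge0.
rewrite /catW; have -> : 1 + derive1 (f a) t ^+ 2 + 4^-1 * f a t ^+ 2 * derive1 (f a) t ^+ 2 =
    (f a t / a) ^+ 2.
  rewrite (catenary_slope_sqr t a0 sol).
  by field; rewrite hs4 gt_eqF.
by rewrite sqrtr_sqr ger0_norm ?invf_div// divr_ge0 ?ltW.
Qed.

(* In the parameter x the catenary is explicit, and the equation becomes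
   autonomous of first order: t is the integral of an elementary function of
   x and of the parameter a. *)
Lemma catenary_parameter (R : realType) (a : R) (h : R -> R) :
  0 < a -> catenary_solution a h ->
  let x := fun t => derive1 h t * Num.sqrt (h t ^+ 2 + 4) / 2 in
  [/\ x 0 = 0, forall t, h t = a * Num.sqrt (1 + x t ^+ 2)
    & forall t : R, is_derive t 1 x (2 * h t / (a ^+ 2 * Num.sqrt (h t ^+ 2 + 4)))].
Proof.
move=> a0 sol x; have h0 := catenary_gt0 a0 sol.
have h4 t : 0 < h t ^+ 2 + 4 by rewrite ltr_wpDl ?sqr_ge0.
have S2 t : Num.sqrt (h t ^+ 2 + 4) ^+ 2 = h t ^+ 2 + 4 by rewrite sqr_sqrtr// ltW.
split=> [|t|t].
- by have [_ _ _ _ E] := sol; rewrite /x E !mul0r.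
- have -> : 1 + x t ^+ 2 = (h t / a) ^+ 2.
    rewrite /x !exprMn S2 (catenary_slope_sqr t a0 sol).
    by field; rewrite !gt_eqF.
  by rewrite sqrtr_sqr ger0_norm ?divr_ge0 ?ltW// mulrC divfK// gt_eqF.
- have D1 := catenary_derive t sol; have D2 := catenary_derive' t sol.
  have D3 := is_derive1_sqrt (h4 t).
  have D4 : is_derive t 1 (fun s : R => h s ^+ 2 + 4) (2 * h t * derive1 h t).
    by apply: is_derive_eq; rewrite /GRing.scale/=; ring.
  have D5 := is_derive_compr D4 D3.
  rewrite /x; apply: is_derive_eq; rewrite /GRing.scale/=.
  rewrite (catenary_second t a0 sol).
  have s0 : 0 < Num.sqrt (h t ^+ 2 + 4) by rewrite sqrtr_gt0.
  have := S2 t; set s := Num.sqrt _ in s0 *.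
  have := catenary_slope_sqr t a0 sol; set p := derive1 h t; set H := h t.
  move=> P2 E.
  (* Eliminating H^2 in favour of the square root s, and p^2 through the first integral, leaves a
     rational identity. *)
  have EH : H ^+ 2 = s ^+ 2 - 4 by lra.
  have -> : a ^+ 2 * (H ^+ 2 + 4) ^+ 2 = a ^+ 2 * s ^+ 4 by rewrite -E; ring.
  rewrite -E EH in P2.
  have a0' : a != 0 by rewrite gt_eqF.
  have s0' : s != 0 by rewrite gt_eqF.
  transitivity (2^-1 * (p ^+ 2 * H / s + 4 * (a ^+ 2 + 4) * H / (a ^+ 2 * s ^+ 3))).
    by field; rewrite a0' s0'.
  by rewrite P2; field; rewrite a0' s0'.
Qed.

(** * Differentiability in the parameter *)

(** Derivatives in the parameter are obtained from Taylor estimates with an explicit remainder,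
    since these can be integrated and composed. *)
Lemma is_derive_quadratic (R : realType) (g : R -> R) (a L C e : R) : 0 < e ->
  (forall b, `|b - a| < e -> `|g b - g a - L * (b - a)| <= C * (b - a) ^+ 2) ->
  is_derive a 1 g L.
Proof.
move=> e0 H.
suff cv : h^-1 *: ((g \o shift a) (h *: 1) - g a) @[h --> (0 : R)^'] --> L.
  by apply: DeriveDef; [apply/cvg_ex; exists L | exact: cvg_lim].
apply/cvgrPdist_le => d d0; near=> h.
have hn0 : h != 0 by near: h; exact: nbhs_dnbhs_neq.
have he : `|h| < e.
  by near: h; apply: dnbhs0_lt.
have hd : `|h| <= d / (`|C| + 1).
  by near: h; apply: dnbhs0_le; rewrite divr_gt0// ltr_wpDl.
rewrite /= [h%:A]mulr1.
have := H (h + a); rewrite addrK => /(_ he) K.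
rewrite distrC -(ler_pM2l (x := `|h|)) ?normr_gt0// -normrM.
have -> : h * (h^-1 *: (g (h + a) - g a) - L) = g (h + a) - g a - L * h.
  by rewrite /GRing.scale/= mulrBr mulrA divff// mul1r [h * L]mulrC.
apply: (le_trans K); rewrite -real_normK ?num_real// expr2 mulrCA ler_wpM2l//.
have := ler_norm C; have := normr_ge0 h; have := normr_ge0 C.
move: hd; rewrite ler_pdivlMr ?ltr_wpDl// => hd C0 h0 Cl.
apply: le_trans hd; rewrite mulrC ler_wpM2l//; lra.
Unshelve. all: by end_near. Qed.

(* The bound is uniform in k, so that it survives integration. *)
Lemma sqrt_quadratic_bound (R : realType) (a : R) : 0 < a ->
  exists2 M, 0 <= M & forall b k, 0 < b < 2 * a -> 0 <= k <= 1 ->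
  `|Num.sqrt (b ^+ 4 + 4 * b ^+ 2 * k) / 2 - Num.sqrt (a ^+ 4 + 4 * a ^+ 2 * k) / 2
    - (b - a) * ((a ^+ 3 + 2 * a * k) / Num.sqrt (a ^+ 4 + 4 * a ^+ 2 * k))| <=
  M * (b - a) ^+ 2.
Proof.
move=> a0.
(* The two summands bound the two terms of [E] below: the numerators bound q and ga gb for 0 < b < 2
   a, the denominators come from r >= a^2 and r + s >= a^2. *)
pose M := (11 * a ^+ 2 + 4) / a ^+ 2 / 2 +
  (4 * a ^+ 3 + 8 * a) * (3 * a * (5 * a ^+ 2 + 4)) / (4 * a ^+ 6).
exists M.
  by rewrite !(addr_ge0, divr_ge0, mulr_ge0, exprn_ge0)// ltW.
move=> b k /andP[b0 b2] /andP[k0 k1].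
have pos c : 0 < c -> 0 < c ^+ 4 + 4 * c ^+ 2 * k.
  by move=> c0; rewrite ltr_pwDl ?exprn_gt0// !mulr_ge0// ?exprn_ge0// ?ltW.
have sq c : 0 < c -> Num.sqrt (c ^+ 4 + 4 * c ^+ 2 * k) ^+ 2 = c ^+ 4 + 4 * c ^+ 2 * k.
  by move=> c0; rewrite sqr_sqrtr// ltW// pos.
have ge c : 0 < c -> c ^+ 2 <= Num.sqrt (c ^+ 4 + 4 * c ^+ 2 * k).
  move=> c0; rewrite -[leLHS]ger0_norm ?sqr_ge0// -sqrtr_sqr ler_wsqrtr//.
  by rewrite -exprM lerDl !mulr_ge0// ?exprn_ge0// ?ltW.
have := sq b b0; have := sq a a0; have := ge b b0; have := ge a a0.
set r := Num.sqrt (a ^+ 4 + _); set s := Num.sqrt (b ^+ 4 + _).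
move=> ra sb r2 s2.
have a2 : 0 < a ^+ 2 by rewrite exprn_gt0.
have b2' : 0 < b ^+ 2 by rewrite exprn_gt0.
have r0 : 0 < r by exact: lt_le_trans ra.
have s0 : 0 < s by exact: lt_le_trans sb.
have rs0 : 0 < r + s by rewrite addr_gt0.
(* For the polynomial P b = b^4 + 4 b^2 k under the root, [ga] is P' a, and [gb], [q] are divided
   differences: P b - P a = (b - a) gb and gb - ga = (b - a) q. They make the factor (b - a)^2 of
   the remainder explicit. *)
pose gb := (b + a) * (b ^+ 2 + a ^+ 2 + 4 * k).
pose q := 6 * a ^+ 2 + 4 * k + 4 * a * (b - a) + (b - a) ^+ 2.
pose ga := 4 * a ^+ 3 + 8 * a * k.
have srE : s - r = (b - a) * gb / (r + s).
  apply: (mulIf (lt0r_neq0 rs0)); rewrite divfK ?gt_eqF//.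
  have -> : (s - r) * (r + s) = s ^+ 2 - r ^+ 2 by ring.
  by rewrite s2 r2 /gb; ring.
have E : s / 2 - r / 2 - (b - a) * ((a ^+ 3 + 2 * a * k) / r) =
   (b - a) ^+ 2 * (q / (r + s) / 2 - ga * gb / (4 * r * (r + s) ^+ 2)).
  transitivity ((b - a) * ((gb - ga) / (r + s) / 2 -
                           ga * (s - r) / (4 * r * (r + s)))).
    have -> : s / 2 - r / 2 = (b - a) * gb / (r + s) / 2 by rewrite -srE; ring.
    have -> : (a ^+ 3 + 2 * a * k) / r = ga / (4 * r) by rewrite /ga; field; rewrite gt_eqF.
    by field; rewrite !gt_eqF.
  have -> : gb - ga = (b - a) * q by rewrite /gb /ga /q; ring.
  by rewrite srE; field; rewrite !gt_eqF.
have bl : `|b - a| <= a by rewrite ler_norml; apply/andP; split; lra.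
have q_le : `|q| <= 11 * a ^+ 2 + 4.
  have d2 : (b - a) ^+ 2 <= a ^+ 2 by rewrite -real_normK ?num_real// lerXn2r ?nnegrE// ltW.
  have d1 : `|a * (b - a)| <= a ^+ 2 by rewrite normrM gtr0_norm// expr2 ler_pM2l.
  move: d1; rewrite ler_norml => /andP[d3 d4]; have := sqr_ge0 (b - a).
  rewrite /q ler_norml => d5; apply/andP; split; lra.
have ga0 : 0 <= ga by rewrite /ga !(addr_ge0, mulr_ge0, exprn_ge0)// ltW.
have gb0 : 0 <= gb by rewrite /gb !(addr_ge0, mulr_ge0, exprn_ge0)// ltW.
have ga_le : ga <= 4 * a ^+ 3 + 8 * a by rewrite lerD2l ler_piMr// mulr_ge0// ltW.
have gb_le : gb <= 3 * a * (5 * a ^+ 2 + 4).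
  have b_le : b ^+ 2 <= (2 * a) ^+ 2 by rewrite lerXn2r ?nnegrE ?mulr_ge0 ?ltW.
  have h1 : b + a <= 3 * a by lra.
  have h2 : b ^+ 2 + a ^+ 2 + 4 * k <= 5 * a ^+ 2 + 4 by rewrite exprMn in b_le; lra.
  by apply: ler_pM => //; rewrite !addr_ge0 ?mulr_ge0// ltW.
rewrite E normrM ger0_norm ?sqr_ge0// mulrC ler_wpM2r ?sqr_ge0//.
apply: (le_trans (ler_normB _ _)); rewrite /M lerD//.
  rewrite !normrM !normfV (gtr0_norm rs0) (ger0_norm (ler0n _ 2)).
  rewrite ler_wpM2r// ler_pM// ?invr_ge0 ?(ltW rs0)// lef_pV2 ?posrE//.
  by rewrite (le_trans ra)// lerDl ltW.
have rs2 : (a ^+ 2) ^+ 2 <= (r + s) ^+ 2.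
  by rewrite lerXn2r ?nnegrE ?(ltW rs0) ?(ltW a2)// (le_trans ra)// lerDl ltW.
have den : 4 * a ^+ 6 <= 4 * r * (r + s) ^+ 2.
  have -> : 4 * a ^+ 6 = 4 * a ^+ 2 * (a ^+ 2) ^+ 2 by ring.
  by apply: ler_pM => //; rewrite ?ler_pM2l// ?mulr_ge0// ?exprn_ge0// ltW.
have den0 : 0 < 4 * a ^+ 6 by rewrite mulr_gt0// exprn_gt0.
have den1 := lt_le_trans den0 den.
rewrite ger0_norm; last by apply: divr_ge0; [exact: mulr_ge0|exact: ltW].
apply: ler_pM; first exact: mulr_ge0.
- by rewrite invr_ge0 ltW.
- exact: ler_pM.
- by rewrite lef_pV2.
Qed.

(* dt/dx for the parameter x of [catenary_parameter]. *)
Definition cat_time_rate {R : realType} (b y : R) : R :=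
  Num.sqrt (b ^+ 4 + 4 * b ^+ 2 * (1 + y ^+ 2)^-1) / 2.

Lemma inv1sqr_bound (R : realType) (y : R) : 0 <= (1 + y ^+ 2)^-1 <= 1.
Proof.
have h : 1 <= 1 + y ^+ 2 by rewrite lerDl sqr_ge0.
by rewrite invr_ge0 (le_trans _ h)//= invf_le1// (lt_le_trans _ h).
Qed.

Lemma continuous_inv1sqr (R : realType) : continuous (fun y : R => (1 + y ^+ 2)^-1).
Proof.
move=> y; apply: is_derive_cont; apply: is_derive_inv.
by rewrite gt_eqF// ltr_pwDl// sqr_ge0.
Qed.

Lemma continuous_sqrt_comp (R : realType) (g : R -> R) (y : R) :
  {for y, continuous g} -> {for y, continuous (fun z => Num.sqrt (g z))}.
Proof. by move=> cg; apply: (continuous_comp cg); exact: sqrt_continuous. Qed.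

(** This lower bound, uniform in y, makes the primitive of the rate injective and controls how far
    the parameter moves when b varies. *)
Lemma cat_time_rate_ge (R : realType) (b y : R) : b ^+ 2 / 2 <= cat_time_rate b y.
Proof.
rewrite ler_pM2r// -[leLHS]ger0_norm ?sqr_ge0// -sqrtr_sqr ler_wsqrtr//.
have /andP[k0 _] := inv1sqr_bound y.
by rewrite -exprM lerDl mulr_ge0// mulr_ge0// sqr_ge0.
Qed.

Lemma continuous_cat_time_rate (R : realType) (b : R) : continuous (cat_time_rate b).
Proof.
move=> y; apply: cvgM; last exact: cvg_cst.
apply: (@continuous_sqrt_comp _ (fun y => b ^+ 4 + 4 * b ^+ 2 * (1 + y ^+ 2)^-1)).
apply: cvgD; first exact: cvg_cst.
by apply: cvgM; [exact: cvg_cst|exact: continuous_inv1sqr].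
Qed.

Lemma catenary_sqr (R : realType) (b : R) (h : R -> R) (t : R) :
  0 < b -> catenary_solution b h ->
  h t ^+ 2 = b ^+ 2 * (1 + (derive1 h t * Num.sqrt (h t ^+ 2 + 4) / 2) ^+ 2).
Proof.
move=> b0 sol; have [_ /(_ t) hE _] := catenary_parameter b0 sol.
by rewrite {1}hE exprMn sqr_sqrtr ?addr_ge0 ?sqr_ge0.
Qed.

Lemma cat_time_rateE (R : realType) (b : R) (h : R -> R) (t : R) :
  0 < b -> catenary_solution b h ->
  Num.sqrt (b ^+ 4 + 4 * b ^+ 2 *
    (1 + (derive1 h t * Num.sqrt (h t ^+ 2 + 4) / 2) ^+ 2)^-1) =
  b ^+ 2 * Num.sqrt (h t ^+ 2 + 4) / h t.
Proof.
move=> b0 sol; have h0 := catenary_gt0 b0 sol t.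
have := catenary_sqr t b0 sol; set x := _ / 2 => h2; clearbody x.
have x0 : 0 < 1 + x ^+ 2 by rewrite ltr_pwDl// sqr_ge0.
have h4 : 0 < h t ^+ 2 + 4 by rewrite ltr_wpDl ?sqr_ge0.
have -> : b ^+ 4 + 4 * b ^+ 2 * (1 + x ^+ 2)^-1 =
    (b ^+ 2 * Num.sqrt (h t ^+ 2 + 4) / h t) ^+ 2.
  rewrite !exprMn sqr_sqrtr ?(ltW h4)// exprVn h2.
  by field; rewrite !gt_eqF.
rewrite sqrtr_sqr ger0_norm//.
by rewrite divr_ge0 ?mulr_ge0 ?sqrtr_ge0 ?(ltW h0) ?(ltW b0).
Qed.

Lemma cat_timeK (R : realType) (b : R) (h T : R -> R) (t : R) :
  0 < b -> catenary_solution b h -> T 0 = 0 ->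
  (forall y : R, is_derive y 1 T (cat_time_rate b y)) ->
  T (derive1 h t * Num.sqrt (h t ^+ 2 + 4) / 2) = t.
Proof.
move=> b0 sol T0 dT.
pose x (t : R) := derive1 h t * Num.sqrt (h t ^+ 2 + 4) / 2.
have [x0 hE dx] := catenary_parameter b0 sol.
rewrite -/(x 0) in x0.
have D (s : R) : is_derive s 1 (fun s => T (x s) - s) 0.
  have D1 := is_derive_compr (dx s) (dT (x s)).
  apply: is_derive_eq.
  rewrite /cat_time_rate /x cat_time_rateE//.
  have h0 := catenary_gt0 b0 sol s.
  have h4 : 0 < Num.sqrt (h s ^+ 2 + 4) by rewrite sqrtr_gt0 ltr_wpDl ?sqr_ge0.
  by field; rewrite !gt_eqF.
have := is_derive_0_is_cst t 0 D; rewrite x0 T0 subrr => /eqP.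
by rewrite subr_eq0 => /eqP.
Qed.

(* With T_b the primitive of [cat_time_rate b] and x_b the parameter of f_b,
   T_b (x_b t) = t; hence f_b t = (b / a) * f_a (T_a (x_b t)), and only the time
   change b |-> T_a (x_b t) has to be differentiated. *)
Lemma catenary_variation (R : realType) (f : R -> R -> R) (a : R) :
  (forall b : R, 0 < b -> catenary_solution b (f b)) -> 0 < a ->
  exists tau : R -> R, [/\ tau 0 = 0,
    forall t : R, is_derive t 1 tau (2 * (f a t ^+ 2 + 2) / (a * (f a t ^+ 2 + 4)))
  & forall t : R, is_derive a 1 (fun b => f b t) (f a t / a - derive1 (f a) t * tau t)].
Proof.
move=> hf a0; have sol := hf a a0.
pose x b t := derive1 (f b) t * Num.sqrt (f b t ^+ 2 + 4) / 2.
pose k (y : R) := (1 + y ^+ 2)^-1.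
(* [J] is the derivative of [cat_time_rate b] in b at b = a. Its primitive [T'] is then the
   derivative of T_b in b, and tau is [T'] along the catenary. *)
pose J y := (a ^+ 3 + 2 * a * k y) / Num.sqrt (a ^+ 4 + 4 * a ^+ 2 * k y).
have a2 : 0 < a ^+ 2 by rewrite exprn_gt0.
have S_ge y : a ^+ 2 <= Num.sqrt (a ^+ 4 + 4 * a ^+ 2 * k y).
  by have := cat_time_rate_ge a y; rewrite ler_pM2r.
have S0 y : 0 < Num.sqrt (a ^+ 4 + 4 * a ^+ 2 * k y) by exact: lt_le_trans (S_ge y).
have cJ : continuous J.
  move=> y; apply: cvgM.
    apply: cvgD; first exact: cvg_cst.
    by apply: cvgM; [exact: cvg_cst|exact: continuous_inv1sqr].
  apply: cvgV; first by rewrite gt_eqF.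
  apply: (@continuous_sqrt_comp _ (fun y => a ^+ 4 + 4 * a ^+ 2 * k y)).
  apply: cvgD; first exact: cvg_cst.
  by apply: cvgM; [exact: cvg_cst|exact: continuous_inv1sqr].
have [Ta [Ta0 dTa]] := antiderivative (@continuous_cat_time_rate R a).
have [T' [T'0 dT']] := antiderivative cJ.
have [M M0 HM] := sqrt_quadratic_bound a0.
have [x0 xE dx] := catenary_parameter a0 sol.
exists (fun t => T' (x a t)); split.
- by rewrite /x x0.
- move=> t.
  have h0 := catenary_gt0 a0 sol t.
  have h4 : 0 < f a t ^+ 2 + 4 by rewrite ltr_wpDl ?sqr_ge0.
  have s4 : 0 < Num.sqrt (f a t ^+ 2 + 4) by rewrite sqrtr_gt0.
  apply: (is_derive_eq (is_derive_compr (dx t) (dT' _))).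
  rewrite /J {2}/k cat_time_rateE//.
  have -> : k (derive1 (f a) t * Num.sqrt (f a t ^+ 2 + 4) / 2) = a ^+ 2 / f a t ^+ 2.
    have := catenary_sqr t a0 sol; set y := _ / 2 => h2; clearbody y.
    rewrite /k h2; field; rewrite !gt_eqF//.
    by rewrite ltr_pwDl// sqr_ge0.
  rewrite -[X in _ = _ / (a * X)](sqr_sqrtr (ltW h4)).
  by field; rewrite !gt_eqF.
move=> t; pose s := x a t.
have Tas : Ta s = t by exact: cat_timeK.
have Jb y : `|J y| <= (a ^+ 3 + 2 * a) / a ^+ 2.
  have /andP[k0 k1] := inv1sqr_bound y.
  have n0 : 0 <= a ^+ 3 + 2 * a * k y by rewrite addr_ge0 ?mulr_ge0 ?exprn_ge0 ?(ltW a0).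
  rewrite ger0_norm; last by apply: divr_ge0 => //; exact: ltW.
  apply: ler_pM => //; first by rewrite lerD2l ler_piMr// mulr_ge0// ltW.
  by rewrite lef_pV2 ?posrE.
have kb (y : R) := inv1sqr_bound y.
(* A Lipschitz constant at a for b |-> x_b t: the rate is at least (a / 2)^2 / 2 = a^2 / 8 for b > a
   / 2, and T_b (x_b t) = t = T_b s - d T' s - rem s bounds the rate times the displacement. In [C]
   below, the first summand pays for replacing T' (x_b t) by T' s, the second for [rem] at x_b t. *)
pose C1 := 8 / a ^+ 2 * (`|T' s| + M * a * `|s|).
have C10 : 0 <= C1.
  by apply: mulr_ge0; [exact: divr_ge0 (ltW _)|rewrite addr_ge0 ?mulr_ge0 ?(ltW a0)].
pose C := (a ^+ 3 + 2 * a) / a ^+ 2 * C1 + M * (`|s| + C1 * a).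
(* Implicit differentiation of T_b (x_b t) = t, carried out with remainders. *)
have dPhi : is_derive a 1 (fun b => Ta (x b t)) (- T' s).
  apply: (@is_derive_quadratic _ _ _ _ C (a / 2)); first by rewrite divr_gt0.
  move=> b ba.
  have /andP[b1 b2] : a / 2 < b < 2 * a.
    by move: ba; rewrite ltr_norml => /andP[? ?]; apply/andP; split; lra.
  have b0 : 0 < b by apply: lt_trans b1; rewrite divr_gt0.
  have bM : 0 < b < 2 * a by rewrite b0.
  have [Tb [Tb0 dTb]] := antiderivative (@continuous_cat_time_rate R b).
  pose y := x b t.
  have Tby : Tb y = t by exact: cat_timeK (hf b b0) Tb0 dTb.
  (* [rem] is the first-order Taylor remainder of T_b in b. Its derivative in z is the remainder of
     the rates, so the uniform bound M d^2 integrates to M d^2 |z|. *)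
  pose d := b - a; rewrite -/d -/y.
  pose rem z := Tb z - Ta z - d * T' z.
  have remb z : `|rem z| <= M * d ^+ 2 * `|z|.
    have drem (u : R) : is_derive u 1 rem (cat_time_rate b u - cat_time_rate a u - d * J u).
      have D1 := dTb u; have D2 := dTa u; have D3 := dT' u.
      by rewrite /rem; apply: is_derive_eq; rewrite /GRing.scale/=; ring.
    have [c _ E] := MVT_between (a := 0) (b := z) (fun u _ => drem u).
    have -> : rem z = (cat_time_rate b c - cat_time_rate a c - d * J c) * (z - 0).
      by rewrite -E /rem Tb0 Ta0 T'0; ring.
    by rewrite subr0 normrM ler_wpM2r//; exact: (HM b (k c) bM (kb c)).
  have da : `|d| <= a by move: ba; rewrite -/d => /ltW/le_trans; apply; lra.
  have d2E : d ^+ 2 = `|d| * `|d| by rewrite -normrM -expr2 ger0_norm// sqr_ge0.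
  have ys : `|y - s| <= C1 * `|d|.
    have [c _ E] := MVT_between (a := s) (b := y) (fun u _ => dTb u).
    have E2 : cat_time_rate b c * (y - s) = - (d * T' s + rem s).
      by rewrite -E Tby /rem Tas; ring.
    have Hc : a ^+ 2 / 8 <= cat_time_rate b c.
      apply: le_trans (cat_time_rate_ge b c).
      have : (a / 2) ^+ 2 <= b ^+ 2 by rewrite lerXn2r ?nnegrE ?divr_ge0 ?(ltW a0) ?(ltW b0) ?(ltW b1).
      by rewrite expr_div_n; lra.
    have H1 : a ^+ 2 / 8 * `|y - s| <= `|d| * (`|T' s| + M * a * `|s|).
      apply: (@le_trans _ _ (cat_time_rate b c * `|y - s|)); first by rewrite ler_wpM2r.
      have Hc0 : 0 <= cat_time_rate b c by apply: le_trans Hc; rewrite divr_ge0// ltW.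
      rewrite -{1}(ger0_norm Hc0) -normrM E2 normrN.
      apply: (le_trans (ler_normD _ _)); rewrite mulrDr normrM lerD2l.
      apply: (le_trans (remb s)); rewrite d2E !mulrA ler_wpM2r//.
      by rewrite (mulrC M) ler_wpM2l ?mulr_ge0.
    have a8 : 0 < a ^+ 2 / 8 by rewrite divr_gt0.
    rewrite -(ler_pM2l a8); apply: (le_trans H1).
    by rewrite /C1 le_eqVlt; apply/orP; left; apply/eqP; field; rewrite gt_eqF.
  have yb : `|y| <= `|s| + C1 * a.
    rewrite -{1}(subrK s y) addrC; apply: (le_trans (ler_normD _ _)).
    by rewrite lerD2l (le_trans ys)// ler_wpM2l.
  have T'b : `|T' y - T' s| <= (a ^+ 3 + 2 * a) / a ^+ 2 * (C1 * `|d|).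
    have [c _ ->] := MVT_between (a := s) (b := y) (fun u _ => dT' u).
    by rewrite normrM; apply: ler_pM.
  have -> : Ta y - Ta s - - T' s * d = - (d * (T' y - T' s)) - rem y.
    by rewrite Tas /rem Tby; ring.
  apply: (le_trans (ler_normB _ _)); rewrite normrN normrM /C mulrDl lerD//.
    have -> : (a ^+ 3 + 2 * a) / a ^+ 2 * C1 * d ^+ 2 =
       `|d| * ((a ^+ 3 + 2 * a) / a ^+ 2 * (C1 * `|d|)) by rewrite d2E; ring.
    by rewrite ler_wpM2l.
  by apply: (le_trans (remb y)); rewrite mulrAC ler_wpM2r ?sqr_ge0// ler_wpM2l.
have df := catenary_derive t sol; rewrite -{1}Tas in df.
have D1 := is_derive_compr dPhi df.
have D : is_derive a 1 (fun b => b / a * f a (Ta (x b t))) (f a t / a - derive1 (f a) t * T' s).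
  apply: is_derive_eq; rewrite /GRing.scale/= -/s Tas.
  by field; rewrite gt_eqF.
apply: near_eq_is_derive D.
near=> b.
have b0 : 0 < b by near: b; exact: lt_nbhsr.
(* Ta inverts x_a on the left and is injective, so it also inverts it on the right at the points
   that it reaches. Then f_a at time Ta (x_b t) has the same parameter x as f_b at time t, and the
   two values differ by the factor b / a. *)
have E : x a (Ta (x b t)) = x b t.
  have K : Ta (x a (Ta (x b t))) = Ta (x b t) by exact: cat_timeK.
  apply: (derive_gt0_inj dTa _ K) => u.
  exact: lt_le_trans (divr_gt0 a2 (ltr0n _ 2)) (cat_time_rate_ge a u).
have [_ /(_ t) -> _] := catenary_parameter b0 (hf b b0).
rewrite xE -/(x _ _) E -/(x _ _).
by field; rewrite gt_eqF.
Unshelve. all: by end_near.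
Qed.

(** * Geometry of the catenoid *)

Definition mx2 {R : realType} (a b c d : R) : 'M[R]_2 :=
  \matrix_(i, j) (if i == 0 then [:: a; b] else [:: c; d])`_j.

Lemma ord2_cases (i : 'I_2) : i = 0 \/ i = 1.
Proof. by case: i => [[|[|//]] hi]; [left|right]; exact/val_inj. Qed.

Lemma mulmx2 (R : realType) (a b c d a' b' c' d' : R) :
  mx2 a b c d *m mx2 a' b' c' d' =
  mx2 (a * a' + b * c') (a * b' + b * d') (c * a' + d * c') (c * b' + d * d').
Proof.
apply/matrixP => i j; rewrite !mxE !big_ord_recl big_ord0 !mxE.
by case: i => [[|[|//]] hi]; case: j => [[|[|//]] hj] /=; rewrite addr0.
Qed.

Lemma det_mx2 (R : realType) (a b c d : R) : \det (mx2 a b c d) = a * d - b * c.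
Proof.
rewrite (expand_det_row _ 0) !big_ord_recl big_ord0 /cofactor !det_mx11 !mxE /=.
by rewrite addr0 mul1r mulN1r mulrN.
Qed.

Lemma trace_mx2 (R : realType) (a b c d : R) : \tr (mx2 a b c d) = a + d.
Proof. by rewrite /mxtrace !big_ord_recl big_ord0 !mxE/= addr0. Qed.

Lemma nil_innerE (R : realType) (p u v : 'rV[R]_3) :
  inner nil_metric p u v = u 0 0 * v 0 0 + u 0 1 * v 0 1 +
   (u 0 2 + (p 0 1 * u 0 0 - p 0 0 * u 0 1) / 2) *
   (v 0 2 + (p 0 1 * v 0 0 - p 0 0 * v 0 1) / 2).
Proof.
rewrite /inner !mxE !big_ord_recl !big_ord0 !mxE !big_ord_recl !big_ord0 !nil_metricE /quad /=.
rewrite -!/(_ == _).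
have -> : @lift 3 ord0 (@lift 2 ord0 ord0) = 2 by exact/val_inj.
have -> : @lift 3 ord0 ord0 = 1 by exact/val_inj.
have -> : ord0 = 0 :> 'I_3 by exact/val_inj.
by field.
Qed.

Lemma vec3E (R : realType) (x y z : R) :
  (vec3 x y z 0 0 = x) * (vec3 x y z 0 1 = y) * (vec3 x y z 0 2 = z).
Proof. by rewrite !mxE. Qed.

Lemma catenoid_tangent0 (R : realType) (f : R -> R -> R) (a : R) (q : 'rV[R]_2) :
  catenary_solution a (f a) ->
  tangent (catenoid_map f a) 0 q =
  vec3 (derive1 (f a) (q 0 0) * cos (q 0 1)) (derive1 (f a) (q 0 0) * sin (q 0 1)) 1.
Proof.
move=> sol; apply/rowP => k; rewrite !mxE; apply: partial_val.
have D0 := is_derive_coord 0 q (delta_mx 0 0).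
have D1 := is_derive_coord 1 q (delta_mx 0 0).
have Df := is_derive_compr D0 (catenary_derive (q 0 0) sol).
have Dc := is_derive_compr D1 (is_derive_cos (q 0 1)).
have Ds := is_derive_compr D1 (is_derive_sin (q 0 1)).
case: k => [[|[|[|//]]] hk] /=.
- rewrite (_ : (fun q' => _) = (fun q' : 'rV_2 => f a (q' 0 0) * cos (q' 0 1))).
    by apply: is_derive_eq; rewrite /GRing.scale/= !mxE/=; ring.
  by apply/funext => q'; rewrite mxE.
- rewrite (_ : (fun q' => _) = (fun q' : 'rV_2 => f a (q' 0 0) * sin (q' 0 1))).
    by apply: is_derive_eq; rewrite /GRing.scale/= !mxE/=; ring.
  by apply/funext => q'; rewrite mxE.
- rewrite (_ : (fun q' => _) = (fun q' : 'rV_2 => q' 0 0)).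
    by apply: is_derive_eq; rewrite !mxE.
  by apply/funext => q'; rewrite mxE.
Qed.

Lemma catenoid_tangent1 (R : realType) (f : R -> R -> R) (a : R) (q : 'rV[R]_2) :
  catenary_solution a (f a) ->
  tangent (catenoid_map f a) 1 q =
  vec3 (- (f a (q 0 0) * sin (q 0 1))) (f a (q 0 0) * cos (q 0 1)) 0.
Proof.
move=> sol; apply/rowP => k; rewrite !mxE; apply: partial_val.
have D0 := is_derive_coord 0 q (delta_mx 0 1).
have D1 := is_derive_coord 1 q (delta_mx 0 1).
have Df := is_derive_compr D0 (catenary_derive (q 0 0) sol).
have Dc := is_derive_compr D1 (is_derive_cos (q 0 1)).
have Ds := is_derive_compr D1 (is_derive_sin (q 0 1)).
case: k => [[|[|[|//]]] hk] /=.
- rewrite (_ : (fun q' => _) = (fun q' : 'rV_2 => f a (q' 0 0) * cos (q' 0 1))).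
    by apply: is_derive_eq; rewrite /GRing.scale/= !mxE/=; ring.
  by apply/funext => q'; rewrite mxE.
- rewrite (_ : (fun q' => _) = (fun q' : 'rV_2 => f a (q' 0 0) * sin (q' 0 1))).
    by apply: is_derive_eq; rewrite /GRing.scale/= !mxE/=; ring.
  by apply/funext => q'; rewrite mxE.
- rewrite (_ : (fun q' => _) = (fun q' : 'rV_2 => q' 0 0)).
    by apply: is_derive_eq; rewrite !mxE.
  by apply/funext => q'; rewrite mxE.
Qed.

Lemma catenoid_first_form (R : realType) (f : R -> R -> R) (a : R) (q : 'rV[R]_2) :
  catenary_solution a (f a) ->
  first_form nil_metric (catenoid_map f a) q =
  let r := f a (q 0 0) in
  mx2 (1 + derive1 (f a) (q 0 0) ^+ 2) (- (r ^+ 2 / 2)) (- (r ^+ 2 / 2)) (r ^+ 2 + r ^+ 4 / 4).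
Proof.
move=> sol; apply/matrixP => i j; rewrite mxE nil_innerE.
have cs := cos2Dsin2 (q 0 1).
case: (ord2_cases i) => ->; case: (ord2_cases j) => ->;
  rewrite ?catenoid_tangent0 ?catenoid_tangent1// !vec3E !mxE/=.
all: have c2 : cos (q 0 1) ^+ 2 = 1 - sin (q 0 1) ^+ 2 by rewrite -cs addrK.
- by field: c2.
- by field: c2.
- by field: c2.
- by field: c2.
Qed.

(** The second argument is a covector whose index has been raised, so the metric cancels. Pairings
    with the normal thus reduce to Euclidean ones with the cross product. *)
Lemma nil_inner_normal (R : realType) (p w c : 'rV[R]_3) :
  inner nil_metric p w (c *m invmx (nil_metric p)) =
  w 0 0 * c 0 0 + w 0 1 * c 0 1 + w 0 2 * c 0 2.
Proof.
rewrite nil_innerE invmx_nil_metric !mxE !big_ord_recl !big_ord0 !mxE/=.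
have -> : @lift 3 ord0 (@lift 2 ord0 ord0) = 2 by exact/val_inj.
have -> : @lift 3 ord0 ord0 = 1 by exact/val_inj.
have -> : ord0 = 0 :> 'I_3 by exact/val_inj.
by field.
Qed.

Lemma catenoid_normal_norm (R : realType) (f : R -> R -> R) (a : R) (q : 'rV[R]_2) :
  0 < a -> catenary_solution a (f a) ->
  let X := catenoid_map f a in
  inner nil_metric (X q) (normal_dir nil_metric X q) (normal_dir nil_metric X q) =
  (f a (q 0 0) ^+ 2 / a) ^+ 2.
Proof.
move=> a0 sol X; have f0 := catenary_gt0 a0 sol (q 0 0).
have c2 : cos (q 0 1) ^+ 2 = 1 - sin (q 0 1) ^+ 2 by rewrite -(cos2Dsin2 (q 0 1)) addrK.
rewrite {2}/normal_dir nil_inner_normal /normal_dir invmx_nil_metric.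
rewrite catenoid_tangent0// catenoid_tangent1//.
rewrite /cross !vec3E !mxE !big_ord_recl !big_ord0 !mxE/=.
have K := catenary_first_integral (q 0 0) a0 sol.
have f4 : f a (q 0 0) ^+ 2 + 4 != 0 by rewrite gt_eqF// ltr_wpDl ?sqr_ge0.
transitivity (f a (q 0 0) ^+ 2 + f a (q 0 0) ^+ 2 / 4 *
   (a ^+ 2 * (f a (q 0 0) ^+ 2 + 4) * derive1 (f a) (q 0 0) ^+ 2) / a ^+ 2).
  by field: c2; rewrite gt_eqF.
by rewrite K; field; rewrite gt_eqF.
Qed.

Lemma catenoid_unit_normal (R : realType) (f : R -> R -> R) (a : R) (q : 'rV[R]_2) :
  0 < a -> catenary_solution a (f a) ->
  unit_normal nil_metric (catenoid_map f a) q =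
  (a / f a (q 0 0) ^+ 2) *: normal_dir nil_metric (catenoid_map f a) q.
Proof.
move=> a0 sol; have f0 := catenary_gt0 a0 sol (q 0 0).
rewrite /unit_normal catenoid_normal_norm// sqrtr_sqr ger0_norm ?invf_div//.
by rewrite divr_ge0 ?sqr_ge0 ?ltW.
Qed.

Lemma catenoid_second_form_val (R : realType) (f : R -> R -> R) (a : R) (q : 'rV[R]_2)
  (al be : 'I_2) :
  0 < a -> catenary_solution a (f a) ->
  let X := catenoid_map f a in
  let w := covariant nil_metric X al be q in
  second_form nil_metric X q al be =
  a / f a (q 0 0) ^+ 2 * (f a (q 0 0) *
   (derive1 (f a) (q 0 0) * w 0 2 - cos (q 0 1) * w 0 0 - sin (q 0 1) * w 0 1)).
Proof.
move=> a0 sol X w; have f0 := catenary_gt0 a0 sol (q 0 0).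
have c2 : cos (q 0 1) ^+ 2 = 1 - sin (q 0 1) ^+ 2 by rewrite -(cos2Dsin2 (q 0 1)) addrK.
rewrite mxE catenoid_unit_normal// /normal_dir scalemxAl nil_inner_normal -/w.
rewrite catenoid_tangent0// catenoid_tangent1// ![fun_of_matrix (_ *: _) _ _]mxE /cross !vec3E.
by field: c2; rewrite gt_eqF.
Qed.

Lemma catenoid_partial_tangent (R : realType) (f : R -> R -> R) (a : R) (q : 'rV[R]_2)
  (al be : 'I_2) :
  catenary_solution a (f a) ->
  \row_k partial al (fun q' => tangent (catenoid_map f a) be q' 0 k) q =
  let t := q 0 0 in let c := cos (q 0 1) in let s := sin (q 0 1) in
  if be == 0 then
    if al == 0 then vec3 (derive1 (derive1 (f a)) t * c) (derive1 (derive1 (f a)) t * s) 0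
    else vec3 (- (derive1 (f a) t * s)) (derive1 (f a) t * c) 0
  else
    if al == 0 then vec3 (- (derive1 (f a) t * s)) (derive1 (f a) t * c) 0
    else vec3 (- (f a t * c)) (- (f a t * s)) 0.
Proof.
move=> sol; apply/rowP => k; rewrite mxE; apply: partial_val.
have D0 := is_derive_coord 0 q (delta_mx 0 al).
have D1 := is_derive_coord 1 q (delta_mx 0 al).
have Df := is_derive_compr D0 (catenary_derive (q 0 0) sol).
have Df' := is_derive_compr D0 (catenary_derive' (q 0 0) sol).
have Dc := is_derive_compr D1 (is_derive_cos (q 0 1)).
have Ds := is_derive_compr D1 (is_derive_sin (q 0 1)).
case: (ord2_cases be) => ->.
  rewrite (_ : (fun q' => _) = fun q' : 'rV[R]_2 =>
     vec3 (derive1 (f a) (q' 0 0) * cos (q' 0 1)) (derive1 (f a) (q' 0 0) * sin (q' 0 1)) 1 0 k); last first.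
    by apply/funext => q'; rewrite catenoid_tangent0.
  case: k => [[|[|[|//]]] hk] /=.
  - rewrite (_ : (fun q' => _) = (fun q' : 'rV_2 => derive1 (f a) (q' 0 0) * cos (q' 0 1))).
      apply: is_derive_eq; rewrite /GRing.scale/= !mxE/=.
      by case: (ord2_cases al) => -> /=; rewrite ?mxE/=; ring.
    by apply/funext => q'; rewrite mxE.
  - rewrite (_ : (fun q' => _) = (fun q' : 'rV_2 => derive1 (f a) (q' 0 0) * sin (q' 0 1))).
      apply: is_derive_eq; rewrite /GRing.scale/= !mxE/=.
      by case: (ord2_cases al) => -> /=; rewrite ?mxE/=; ring.
    by apply/funext => q'; rewrite mxE.
  - rewrite (_ : (fun q' => _) = cst (1 : R)).
      by apply: is_derive_eq; case: (ord2_cases al) => -> /=; rewrite ?mxE.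
    by apply/funext => q'; rewrite mxE.
rewrite (_ : (fun q' => _) = fun q' : 'rV[R]_2 =>
    vec3 (- (f a (q' 0 0) * sin (q' 0 1))) (f a (q' 0 0) * cos (q' 0 1)) 0 0 k); last first.
  by apply/funext => q'; rewrite catenoid_tangent1.
case: k => [[|[|[|//]]] hk] /=.
- rewrite (_ : (fun q' => _) = (fun q' : 'rV_2 => - (f a (q' 0 0) * sin (q' 0 1)))).
    apply: is_derive_eq; rewrite /GRing.scale/= !mxE/=.
    by case: (ord2_cases al) => -> /=; rewrite ?mxE/=; ring.
  by apply/funext => q'; rewrite mxE.
- rewrite (_ : (fun q' => _) = (fun q' : 'rV_2 => f a (q' 0 0) * cos (q' 0 1))).
    apply: is_derive_eq; rewrite /GRing.scale/= !mxE/=.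
    by case: (ord2_cases al) => -> /=; rewrite ?mxE/=; ring.
  by apply/funext => q'; rewrite mxE.
- rewrite (_ : (fun q' => _) = cst (0 : R)).
    by apply: is_derive_eq; case: (ord2_cases al) => -> /=; rewrite ?mxE.
  by apply/funext => q'; rewrite mxE.
Qed.

Lemma catenoid_second_form (R : realType) (f : R -> R -> R) (a : R) (q : 'rV[R]_2) :
  0 < a -> catenary_solution a (f a) ->
  let r := f a (q 0 0) in let p := derive1 (f a) (q 0 0) in
  second_form nil_metric (catenoid_map f a) q =
  (a / r ^+ 2) *: mx2 (- (r * derive1 (derive1 (f a)) (q 0 0)) - r ^+ 2 * p ^+ 2 / 2)
     (- (r ^+ 2 / 2) + r ^+ 4 * p ^+ 2 / 8) (- (r ^+ 2 / 2) + r ^+ 4 * p ^+ 2 / 8)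
     (r ^+ 2 + r ^+ 4 / 2).
Proof.
move=> a0 sol r p; have f0 := catenary_gt0 a0 sol (q 0 0).
have c2 : cos (q 0 1) ^+ 2 = 1 - sin (q 0 1) ^+ 2 by rewrite -(cos2Dsin2 (q 0 1)) addrK.
apply/matrixP => al be; rewrite catenoid_second_form_val// [RHS]mxE; congr (_ * _).
have covE k : covariant nil_metric (catenoid_map f a) al be q 0 k =
   (\row_k partial al (fun q' => tangent (catenoid_map f a) be q' 0 k) q) 0 k +
   \sum_(i < 3) \sum_(j < 3) quad (nil_christoffel_coef k i j)
      (f a (q 0 0) * cos (q 0 1)) (f a (q 0 0) * sin (q 0 1)) *
      tangent (catenoid_map f a) al q 0 i * tangent (catenoid_map f a) be q 0 j.
  rewrite [LHS]mxE [in RHS]mxE; congr (_ + _); apply: eq_bigr => i _; apply: eq_bigr => j _.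
  by rewrite nil_christoffelE !mxE.
rewrite !covE catenoid_partial_tangent// !big_ord_recl !big_ord0.
case: (ord2_cases al) => ->; case: (ord2_cases be) => -> /=;
  rewrite /r /p ?catenoid_tangent0 ?catenoid_tangent1// /quad !mxE/=; by field: c2.
Qed.

Lemma scale_mx2 (R : realType) (k a b c d : R) :
  k *: mx2 a b c d = mx2 (k * a) (k * b) (k * c) (k * d).
Proof.
apply/matrixP => i j; rewrite !mxE.
by case: (ord2_cases i) => ->; case: (ord2_cases j) => ->.
Qed.

Lemma mx2_1 (R : realType) : mx2 (1 : R) 0 0 1 = 1%:M.
Proof.
apply/matrixP => i j; rewrite !mxE.
by case: (ord2_cases i) => ->; case: (ord2_cases j) => ->.
Qed.

Lemma catenoid_first_form_inv (R : realType) (f : R -> R -> R) (a : R) (q : 'rV[R]_2) :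
  0 < a -> catenary_solution a (f a) ->
  let r := f a (q 0 0) in
  invmx (first_form nil_metric (catenoid_map f a) q) =
  mx2 (a ^+ 2 * (r ^+ 2 + 4) / (4 * r ^+ 2)) (a ^+ 2 / (2 * r ^+ 2))
      (a ^+ 2 / (2 * r ^+ 2)) ((a ^+ 2 + 4) / (r ^+ 2 * (r ^+ 2 + 4))).
Proof.
move=> a0 sol r; have f0 : 0 < r := catenary_gt0 a0 sol (q 0 0).
have r4 : 0 < r ^+ 2 + 4 by rewrite ltr_wpDl ?sqr_ge0.
apply: invmx_unique; rewrite catenoid_first_form// mulmx2 -mx2_1 -/r.
rewrite (catenary_slope_sqr (q 0 0) a0 sol) -/r.
by congr mx2; field; rewrite !gt_eqF.
Qed.

Lemma catenoid_area_element (R : realType) (f : R -> R -> R) (a : R) (q : 'rV[R]_2) :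
  0 < a -> catenary_solution a (f a) ->
  Num.sqrt (\det (first_form nil_metric (catenoid_map f a) q)) = f a (q 0 0) ^+ 2 / a.
Proof.
move=> a0 sol; have f0 := catenary_gt0 a0 sol (q 0 0).
have r4 : 0 < f a (q 0 0) ^+ 2 + 4 by rewrite ltr_wpDl ?sqr_ge0.
rewrite catenoid_first_form// det_mx2 (catenary_slope_sqr (q 0 0) a0 sol).
set r := f a (q 0 0) in f0 r4 *.
rewrite (_ : _ - _ = (r ^+ 2 / a) ^+ 2); last by field; rewrite !gt_eqF.
by rewrite sqrtr_sqr ger0_norm// divr_ge0 ?sqr_ge0 ?ltW.
Qed.

Lemma catenoid_second_form_sqnorm (R : realType) (f : R -> R -> R) (a : R) (q : 'rV[R]_2) :
  0 < a -> catenary_solution a (f a) ->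
  let r := f a (q 0 0) in
  second_form_sqnorm nil_metric (catenoid_map f a) q =
  (r ^+ 8 + 16 * a ^+ 2 * (r ^+ 2 + 2) ^+ 2) / (2 * r ^+ 4 * (r ^+ 2 + 4) ^+ 2).
Proof.
move=> a0 sol r; have f0 : 0 < r := catenary_gt0 a0 sol (q 0 0).
have r4 : 0 < r ^+ 2 + 4 by rewrite ltr_wpDl ?sqr_ge0.
rewrite /second_form_sqnorm catenoid_first_form_inv// catenoid_second_form//.
rewrite (catenary_slope_sqr (q 0 0) a0 sol) (catenary_second (q 0 0) a0 sol) -/r.
rewrite scale_mx2 !mulmx2 trace_mx2.
transitivity ((a / r ^+ 2) ^+ 2 * (r ^+ 8 + 16 * a ^+ 2 * (r ^+ 2 + 2) ^+ 2) /
  (2 * a ^+ 2 * (r ^+ 2 + 4) ^+ 2)); last by field; rewrite !gt_eqF.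
by field; rewrite !gt_eqF.
Qed.

Lemma nil_ricci_normE (R : realType) (x y : R) (u : 'rV[R]_3) :
  (u *m nil_ricci x y *m u^T) 0 0 =
  - ((u 0 0) ^+ 2 + (u 0 1) ^+ 2) / 2 +
  (u 0 2 + (y * u 0 0 - x * u 0 1) / 2) ^+ 2 / 2.
Proof.
rewrite !mxE !big_ord_recl !big_ord0 !mxE !big_ord_recl !big_ord0 !mxE /=.
have -> : @lift 3 ord0 (@lift 2 ord0 ord0) = 2 by exact/val_inj.
have -> : @lift 3 ord0 ord0 = 1 by exact/val_inj.
have -> : ord0 = 0 :> 'I_3 by exact/val_inj.
by field.
Qed.

Lemma catenoid_ricci_normal (R : realType) (f : R -> R -> R) (a : R) (q : 'rV[R]_2) :
  0 < a -> catenary_solution a (f a) ->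
  let r := f a (q 0 0) in
  ricci_normal nil_metric (catenoid_map f a) q =
  - 2^-1 + 4 * (r ^+ 2 - a ^+ 2) / (r ^+ 2 * (r ^+ 2 + 4)).
Proof.
move=> a0 sol r; have f0 : 0 < r := catenary_gt0 a0 sol (q 0 0).
have c2 : cos (q 0 1) ^+ 2 = 1 - sin (q 0 1) ^+ 2 by rewrite -(cos2Dsin2 (q 0 1)) addrK.
rewrite /ricci_normal nil_ricciE nil_ricci_normE catenoid_unit_normal//.
rewrite /normal_dir invmx_nil_metric catenoid_tangent0// catenoid_tangent1//.
rewrite /cross !vec3E !mxE !big_ord_recl !big_ord0 !mxE/= -/r.
have r4 : 0 < r ^+ 2 + 4 by rewrite ltr_wpDl ?sqr_ge0.
have := catenary_slope_sqr (q 0 0) a0 sol; rewrite -/r; set p := derive1 (f a) (q 0 0) => p2.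
transitivity ((a / r ^+ 2) ^+ 2 * (r ^+ 2 * p ^+ 2 - (r ^+ 2 + r ^+ 4 * p ^+ 2 / 4)) / 2).
  by field: c2; rewrite gt_eqF.
by rewrite p2; field; rewrite !gt_eqF.
Qed.

(** The coefficient |A|^2 + Ric(N) of the Jacobi operator, a function of the radius r = f a t alone
    once f_t and f_tt are eliminated. *)
Definition cat_potential {R : realType} (a r : R) : R :=
  4 * ((a ^+ 2 + 2) * r ^+ 4 + 4 * a ^+ 2 * r ^+ 2 + 8 * a ^+ 2) /
  (r ^+ 4 * (r ^+ 2 + 4) ^+ 2).

Lemma catenoid_potentialE (R : realType) (f : R -> R -> R) (a : R) (q : 'rV[R]_2) :
  0 < a -> catenary_solution a (f a) ->
  second_form_sqnorm nil_metric (catenoid_map f a) q +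
  ricci_normal nil_metric (catenoid_map f a) q = cat_potential a (f a (q 0 0)).
Proof.
move=> a0 sol; have f0 := catenary_gt0 a0 sol (q 0 0).
rewrite catenoid_second_form_sqnorm// catenoid_ricci_normal// /cat_potential.
have r4 : 0 < f a (q 0 0) ^+ 2 + 4 by rewrite ltr_wpDl ?sqr_ge0.
by field; rewrite !gt_eqF.
Qed.

Lemma is_derive_comb (R : realType) (V : normedModType R) (q v : V)
  (g A h B : V -> R) (dg dA dh dB : R) :
  is_derive q v g dg -> is_derive q v A dA -> is_derive q v h dh ->
  is_derive q v B dB ->
  is_derive q v (fun x => g x * A x + h x * B x)
    (dg * A q + g q * dA + (dh * B q + h q * dB)).
Proof. by move=> *; apply: is_derive_eq; rewrite /GRing.scale/=; ring. Qed.

Lemma catenoid_jacobiE (R : realType) (f : R -> R -> R) (a : R) (w : 'rV[R]_2 -> R)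
    (q : 'rV[R]_2) :
  0 < a -> catenary_solution a (f a) ->
  (forall i j : 'I_2, derivable (partial i w) q (delta_mx 0 j)) ->
  let r := f a (q 0 0) in
  jacobi nil_metric (catenoid_map f a) w q =
  - (a ^+ 2 * (r ^+ 2 + 4) / (4 * r ^+ 2) * partial 0 (partial 0 w) q
     + a ^+ 2 / (2 * r ^+ 2) * (partial 0 (partial 1 w) q + partial 1 (partial 0 w) q)
     + (a ^+ 2 + 4) / (r ^+ 2 * (r ^+ 2 + 4)) * partial 1 (partial 1 w) q
     + a ^+ 2 * derive1 (f a) (q 0 0) / (2 * r) * partial 0 w q)
  - cat_potential a r * w q.
Proof.
move=> a0 sol dw r; have f0 : 0 < r := catenary_gt0 a0 sol (q 0 0).
have r4 : 0 < r ^+ 2 + 4 by rewrite ltr_wpDl ?sqr_ge0.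
rewrite /jacobi catenoid_potentialE// -/r; congr (- _ - _).
rewrite /laplacian catenoid_area_element// -/r.
have E (al : 'I_2) : (fun q' : 'rV[R]_2 =>
     Num.sqrt (\det (first_form nil_metric (catenoid_map f a) q')) *
     (\sum_(be < 2) invmx (first_form nil_metric (catenoid_map f a) q') al be *
       partial be w q')) =
   if al == 0 then fun q' : 'rV[R]_2 => a / 4 * (f a (q' 0 0) ^+ 2 + 4) * partial 0 w q'
                    + a / 2 * partial 1 w q'
   else fun q' : 'rV[R]_2 => a / 2 * partial 0 w q'
                    + (a ^+ 2 + 4) / a * (f a (q' 0 0) ^+ 2 + 4)^-1 * partial 1 w q'.
  apply/funext => q'; rewrite catenoid_area_element// catenoid_first_form_inv//.
  have g0 := catenary_gt0 a0 sol (q' 0 0).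
  have g4 : 0 < f a (q' 0 0) ^+ 2 + 4 by rewrite ltr_wpDl ?sqr_ge0.
  rewrite !big_ord_recl big_ord0 !mxE.
  have -> : lift ord0 ord0 = 1 :> 'I_2 by exact/val_inj.
  have -> : ord0 = 0 :> 'I_2 by exact/val_inj.
  by case: (ord2_cases al) => -> /=; field; rewrite !gt_eqF.
rewrite !big_ord_recl big_ord0 !E /=.
have -> : lift ord0 ord0 = 1 :> 'I_2 by exact/val_inj.
have -> : ord0 = 0 :> 'I_2 by exact/val_inj.
have D i j : is_derive q (delta_mx 0 j) (partial i w) (partial j (partial i w) q).
  exact: derivableP.
have D0 j := is_derive_coord 0 q (delta_mx 0 j).
have Df j := is_derive_compr (D0 j) (catenary_derive (q 0 0) sol).
have -> : partial 0 (fun q' : 'rV[R]_2 => a / 4 * (f a (q' 0 0) ^+ 2 + 4) * partial 0 w q'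
                    + a / 2 * partial 1 w q') q =
  a / 4 * (r ^+ 2 + 4) * partial 0 (partial 0 w) q + a / 2 * r * derive1 (f a) (q 0 0) * partial 0 w q
  + a / 2 * partial 0 (partial 1 w) q.
  have Dg : is_derive q (delta_mx 0 0) (fun q' : 'rV_2 => a / 4 * (f a (q' 0 0) ^+ 2 + 4))
      (a / 2 * r * derive1 (f a) (q 0 0)).
    have Df0 := Df 0; apply: is_derive_eq.
    by rewrite /GRing.scale/= mxE/= -/r; field.
  apply: partial_val.
  apply: (is_derive_eq (is_derive_comb Dg (D 0 0) (is_derive_cst (a / 2) q _) (D 1 0))).
  rewrite -/r /cst; generalize (partial 0 w q) (partial 1 w q)
    (partial 0 (partial 0 w) q) (partial 0 (partial 1 w) q) => *; ring.
have -> : partial 1 (fun q' : 'rV[R]_2 => a / 2 * partial 0 w q'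
                    + (a ^+ 2 + 4) / a * (f a (q' 0 0) ^+ 2 + 4)^-1 * partial 1 w q') q =
  a / 2 * partial 1 (partial 0 w) q + (a ^+ 2 + 4) / a / (r ^+ 2 + 4) * partial 1 (partial 1 w) q.
  have Dg : is_derive q (delta_mx 0 1) (fun q' : 'rV_2 => (f a (q' 0 0) ^+ 2 + 4)^-1) 0.
    have Dh : is_derive (q 0 0) 1 (fun t => (f a t ^+ 2 + 4)^-1)
        (- (2 * r * derive1 (f a) (q 0 0)) / (r ^+ 2 + 4) ^+ 2).
      have Dff := catenary_derive (q 0 0) sol.
      apply: is_derive_inv; last by rewrite gt_eqF.
      by apply: is_derive_eq; rewrite /GRing.scale/= -/r; ring.
    apply: (is_derive_eq (is_derive_compr (D0 1) Dh)).
    by rewrite !mxE/= mulr0.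
  have Dg' : is_derive q (delta_mx 0 1)
      (fun q' : 'rV_2 => (a ^+ 2 + 4) / a * (f a (q' 0 0) ^+ 2 + 4)^-1) 0.
    by apply: is_derive_eq; rewrite /GRing.scale/=; ring.
  apply: partial_val.
  apply: (is_derive_eq (is_derive_comb (is_derive_cst (a / 2) q _) (D 0 1) Dg' (D 1 1))).
  rewrite -/r /cst; generalize (partial 0 w q) (partial 1 w q)
    (partial 1 (partial 0 w) q) (partial 1 (partial 1 w) q) => *; ring.
generalize (partial 0 w q) (partial 1 w q) (partial 0 (partial 0 w) q)
  (partial 1 (partial 0 w) q) (partial 0 (partial 1 w) q) (partial 1 (partial 1 w) q) => *.
by field; rewrite !gt_eqF.
Qed.

(** * Second-order conditions at a maximum *)

Lemma is_derive_along (R : realType) (V W : normedModType R) (g : V -> W)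
  (p v : V) (s : R) (dg : W) :
  is_derive (s *: v + p) v g dg -> is_derive s 1 (fun u : R => g (u *: v + p)) dg.
Proof.
move=> [gd gE].
have E : (fun h : R => h^-1 *: ((g \o shift (s *: v + p)) (h *: v) - g (s *: v + p))) =
    (fun h : R => h^-1 *: (((fun u : R => g (u *: v + p)) \o shift s) (h *: 1)
                           - g (s *: v + p))).
  by apply/funext => h /=; rewrite [h%:A]mulr1 scalerDl addrA.
by apply: DeriveDef; [rewrite /derivable -E|rewrite -gE /derive -E].
Qed.

(** The increment is split into a leg along e1 followed by a leg along e0. The mean value theorem
    applies on each leg, and continuity of the partial derivatives at q controls the intermediate
    points. This derives differentiability in oblique directions from the coordinate data of
    [Ck]. *)
Lemma is_derive_span2 (R : realType) (V : normedModType R) (g : V -> R)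
  (g0 g1 : V -> R) (q e0 e1 : V) (x y : R) :
  (\forall p \near q, is_derive p e0 g (g0 p)) ->
  (\forall p \near q, is_derive p e1 g (g1 p)) ->
  {for q, continuous g0} -> {for q, continuous g1} ->
  is_derive q (x *: e0 + y *: e1) g (x * g0 q + y * g1 q).
Proof.
move=> d0 d1 c0 c1.
suff cv : h^-1 *: ((g \o shift q) (h *: (x *: e0 + y *: e1)) - g q) @[h --> (0 : R)^']
    --> x * g0 q + y * g1 q.
  by apply: DeriveDef; [apply/cvg_ex; eexists; exact: cv | exact: cvg_lim].
apply/cvgrPdist_le => eps eps0.
pose eta := eps / (`|x| + `|y| + 1).
have xy0 : 0 < `|x| + `|y| + 1 by rewrite ltr_wpDl// addr_ge0.
have eta0 : 0 < eta by rewrite divr_gt0.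
have c0' : \forall p \near q, `|g0 q - g0 p| <= eta.
  by move/cvgrPdist_le : c0 => /(_ eta eta0).
have c1' : \forall p \near q, `|g1 q - g1 p| <= eta.
  by move/cvgrPdist_le : c1 => /(_ eta eta0).
have [d /= d_gt0 Hd] := (@nbhs_ballP _ _ _ _).1 (filterI (filterI d0 d1) (filterI c0' c1')).
have near_q (s t : R) : `|s| * `|e0| + `|t| * `|e1| < d ->
    ball q d (s *: e0 + (t *: e1 + q)).
  move=> st; rewrite -ball_normE /ball_/= addrA distrC addrK.
  by apply: le_lt_trans st; rewrite (le_trans (ler_normD _ _))// !normrZ.
(* |h| N < d keeps both legs inside the ball where the hypotheses hold; the summand 1 keeps N
   positive. *)
pose N := `|x| * `|e0| + `|y| * `|e1| + 1.
have N0 : 0 < N by rewrite ltr_wpDl// addr_ge0// mulr_ge0.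
near=> h.
have h0 : h != 0 by near: h; exact: nbhs_dnbhs_neq.
have hN : `|h| < d / N by near: h; apply: dnbhs0_lt; rewrite divr_gt0.
have hd (s t : R) : `|s| <= `|h * x| -> `|t| <= `|h * y| ->
    `|s| * `|e0| + `|t| * `|e1| < d.
  move=> sx ty; move: hN; rewrite ltr_pdivlMr//; apply: le_lt_trans.
  rewrite /N mulrDr mulr1 mulrDr -addrA lerD//.
    by rewrite mulrA -normrM ler_wpM2r.
  by rewrite -[leLHS]addr0 lerD// mulrA -normrM ler_wpM2r.
have [s1 s1h E1] : exists2 c, `|c - 0| <= `|h * y - 0| &
    g ((h * y) *: e1 + q) - g (0 *: e1 + q) = g1 (c *: e1 + q) * (h * y - 0).
  apply: (@MVT_between _ (fun s => g (s *: e1 + q)) (fun s => g1 (s *: e1 + q))).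
  move=> s; rewrite !subr0 => sh; apply: is_derive_along.
  have := near_q 0 s; rewrite scale0r add0r => /(_ (hd 0 s _ sh)) /Hd.
  by rewrite normr0 => /(_ (normr_ge0 _)) [[_]].
have [s0 s0h E0] : exists2 c, `|c - 0| <= `|h * x - 0| &
    g ((h * x) *: e0 + ((h * y) *: e1 + q)) - g (0 *: e0 + ((h * y) *: e1 + q)) =
    g0 (c *: e0 + ((h * y) *: e1 + q)) * (h * x - 0).
  apply: (@MVT_between _ (fun s => g (s *: e0 + ((h * y) *: e1 + q)))
           (fun s => g0 (s *: e0 + ((h * y) *: e1 + q)))).
  move=> s; rewrite !subr0 => sh; apply: is_derive_along.
  by have /Hd [[]] := near_q s (h * y) (hd s (h * y) sh (lexx _)).
rewrite !subr0 scale0r add0r in E1 s1h; rewrite !subr0 scale0r add0r in E0 s0h.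
have b1 : `|g1 q - g1 (s1 *: e1 + q)| <= eta.
  have := near_q 0 s1; rewrite scale0r add0r => /(_ (hd 0 s1 _ s1h)) /Hd.
  by rewrite normr0 => /(_ (normr_ge0 _)) [_ []].
have b0 : `|g0 q - g0 (s0 *: e0 + ((h * y) *: e1 + q))| <= eta.
  by have /Hd [_ []] := near_q s0 (h * y) (hd s0 (h * y) s0h (lexx _)).
rewrite /= [h *: (_ + _)]scalerDr [h *: (x *: _)]scalerA [h *: (y *: _)]scalerA
  -[(h * x) *: e0 + (h * y) *: e1 + q]addrA.
set P := _ *: e0 + _ in E0 *.
have -> : h^-1 *: (g P - g q) = x * g0 (s0 *: e0 + ((h * y) *: e1 + q)) +
    y * g1 (s1 *: e1 + q).
  rewrite -(subrK (g ((h * y) *: e1 + q)) (g P)) -addrA E0 E1 /GRing.scale/=.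
  by field.
rewrite opprD addrACA -!mulrBr (le_trans (ler_normD _ _))// !normrM.
apply: (@le_trans _ _ ((`|x| + `|y|) * eta)).
  by rewrite mulrDl lerD// ler_wpM2l.
rewrite /eta mulrA ler_pdivrMr// mulrC ler_wpM2l// ?ltW//.
by rewrite ltrDl.
Unshelve. all: by end_near. Qed.

(** The first derivative vanishes at the interior maximum. If D were positive, [dphi] would be
    positive just to the right of 0, and the mean value theorem would give phi s > phi 0 there. *)
Lemma second_derive_max_le0 (R : realType) (phi dphi : R -> R) (D : R) :
  (\forall s \near (0 : R), is_derive (s : R) 1 phi (dphi s)) ->
  is_derive (0 : R) 1 dphi D -> (\forall s \near (0 : R), phi s <= phi 0) ->
  dphi 0 = 0 /\ D <= 0.
Proof.
move=> dp ddp mx.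
have [d /= d0 Hd] := (@nbhs_ballP _ _ _ _).1 (filterI dp mx).
have inb (s : R) : `|s| < d -> ball (0 : R) d s.
  by rewrite -ball_normE /ball_/= sub0r normrN.
have dphi0 : dphi 0 = 0.
  have -> : dphi 0 = 'D_1 phi 0.
    by have [[_ <-]] := Hd 0 (inb 0 (eq_ind_r (fun z => z < d) d0 (normr0 _))).
  have D0 : is_derive (0 : R) 1 phi 0.
    apply: (@derive1_at_max _ phi (- d) d).
    - lra.
    - by move=> t; rewrite in_itv/= -ltr_norml => /inb/Hd [[]].
    - by rewrite in_itv/= oppr_lt0 d0.
    - by move=> t; rewrite in_itv/= -ltr_norml => /inb/Hd [].
  by rewrite derive_val.
split=> //; rewrite leNgt; apply/negP => D0.
have : \forall h \near (0 : R)^', 0 < h^-1 *: ((dphi \o shift 0) (h *: 1) - dphi 0).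
  have [+ E] := ddp => /cvg_ex[l cl]; have lE : l = D by rewrite -E /derive; exact/esym/cvg_lim.
  by rewrite lE in cl; move/cvgr_gt : cl; apply.
move=> /nbhs_ballP[e /= e0 He].
pose s := Num.min (d / 2) (e / 2).
have s0 : 0 < s by rewrite lt_min !divr_gt0.
have sd : s < d by rewrite gt_min; apply/orP; left; lra.
have se : s < e by rewrite gt_min; apply/orP; right; lra.
have dphis (t : R) : 0 <= t <= s -> is_derive t 1 phi (dphi t).
  move=> /andP[t0 ts]; have [] // := Hd t.
  by apply: inb; rewrite ger0_norm// (le_lt_trans ts).
have [t|//|c] := @MVT R phi dphi 0 s s0.
- by rewrite in_itv/= => /andP[t0 ts]; apply: dphis; rewrite !ltW.
- apply: derivable_within_continuous => t; rewrite in_itv/= => ts.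
  by case: (dphis t ts).
rewrite in_itv/= => /andP[c0 cs]; rewrite subr0 => E.
have : 0 < c^-1 * dphi c.
  have := He c; rewrite /= addr0 dphi0 subr0 [c%:A]mulr1; apply; last by rewrite gt_eqF.
  by rewrite -ball_normE /ball_/= sub0r normrN gtr0_norm// (lt_trans cs).
rewrite pmulr_rgt0 ?invr_gt0// => dc.
have [_] := Hd s (inb s (eq_ind_r (fun z => z < d) sd (gtr0_norm s0))).
by rewrite -subr_le0 E leNgt pmulr_rgt0// s0.
Qed.

(** Restrict g to the line through q with direction x e0 + y e1: the quadratic form is the second
    derivative of this restriction. Only the sum of the mixed derivatives enters. *)
Lemma max_second_order (R : realType) (V : normedModType R) (g g0 g1 g00 g01 g10 g11 : V -> R)
  (q e0 e1 : V) :
  (\forall p \near q, [/\ is_derive p e0 g (g0 p), is_derive p e1 g (g1 p),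
     {for p, continuous g0} & {for p, continuous g1}]) ->
  (\forall p \near q, is_derive p e0 g0 (g00 p) /\ is_derive p e1 g0 (g01 p)) ->
  (\forall p \near q, is_derive p e0 g1 (g10 p) /\ is_derive p e1 g1 (g11 p)) ->
  {for q, continuous g00} -> {for q, continuous g01} ->
  {for q, continuous g10} -> {for q, continuous g11} ->
  (\forall p \near q, g p <= g q) ->
  [/\ g0 q = 0, g1 q = 0
    & forall x y, x ^+ 2 * g00 q + x * y * (g01 q + g10 q) + y ^+ 2 * g11 q <= 0].
Proof.
move=> H1 H2 H3 c00 c01 c10 c11 mx.
have K x y : x * g0 q + y * g1 q = 0 /\
    x ^+ 2 * g00 q + x * y * (g01 q + g10 q) + y ^+ 2 * g11 q <= 0.
  pose xi := x *: e0 + y *: e1.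
  have line : (s *: xi + q) @[s --> (0 : R)] --> q.
    rewrite -[X in _ --> X]add0r -(scale0r xi).
    apply: cvgD; last exact: cvg_cst.
    by apply: cvgZr_tmp; exact: cvg_id.
  pose dphi s := x * g0 (s *: xi + q) + y * g1 (s *: xi + q).
  have := @second_derive_max_le0 R (fun s => g (s *: xi + q)) dphi
    (x * (x * g00 q + y * g01 q) + y * (x * g10 q + y * g11 q)).
  rewrite /dphi scale0r add0r => /(_ _ _ _)[| | |->].
  - have near_xi : \forall p \near q, is_derive p xi g (x * g0 p + y * g1 p).
      (* [is_derive_span2] is applied at every p near q and needs its hypotheses near p, not only at
         p. *)
      move: (H1) => /near_join; apply: filterS => p Hp.
      have [_ _ c0 c1] := nbhs_singleton Hp.
      by apply: is_derive_span2 c0 c1; move: Hp; apply: filterS => p' [].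
    have near_0 : \forall s \near (0 : R), is_derive (s *: xi + q) xi g
        (x * g0 (s *: xi + q) + y * g1 (s *: xi + q)) := line _ near_xi.
    by near=> s; apply: is_derive_along; near: s.
  - have Dg0 : is_derive q xi g0 (x * g00 q + y * g01 q).
      by apply: is_derive_span2 => //; move: H2; apply: filterS => p [].
    have Dg1 : is_derive q xi g1 (x * g10 q + y * g11 q).
      by apply: is_derive_span2 => //; move: H3; apply: filterS => p [].
    have L0 : is_derive (0 : R) 1 (fun s : R => g0 (s *: xi + q)) (x * g00 q + y * g01 q).
      exact: (proj1 (is_derive_line g0 q xi _) Dg0).
    have L1 : is_derive (0 : R) 1 (fun s : R => g1 (s *: xi + q)) (x * g10 q + y * g11 q).
      exact: (proj1 (is_derive_line g1 q xi _) Dg1).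
    by apply: is_derive_eq; rewrite /GRing.scale/=; ring.
  - exact: (line (fun p => g p <= g q)).
  - by move=> h; split=> //; apply: le_trans h; rewrite le_eqVlt; apply/orP; left; apply/eqP; ring.
split=> [||x y]; last by have [] := K x y.
- by have [+ _] := K 1 0; rewrite mul1r mul0r addr0.
- by have [+ _] := K 0 1; rewrite mul1r mul0r add0r.
Unshelve. all: by end_near. Qed.

(* A times the left-hand side is Q(A, B) + (A C - B^2) g11 for the quadratic
   form Q of the hypothesis. *)
Lemma elliptic_le0 (R : realFieldType) (A B C g00 g01 g10 g11 : R) :
  0 < A -> B ^+ 2 <= A * C ->
  (forall x y, x ^+ 2 * g00 + x * y * (g01 + g10) + y ^+ 2 * g11 <= 0) ->
  A * g00 + B * (g10 + g01) + C * g11 <= 0.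
Proof.
move=> A0 BC H.
have g11_le0 : g11 <= 0 by have := H 0 1; rewrite !expr2; lra.
rewrite -(pmulr_rle0 _ A0).
have -> : A * (A * g00 + B * (g10 + g01) + C * g11) =
  (A ^+ 2 * g00 + A * B * (g01 + g10) + B ^+ 2 * g11) + (A * C - B ^+ 2) * g11 by ring.
by rewrite -[leRHS]addr0 lerD// mulr_ge0_le0// subr_ge0.
Qed.

(** * Lower bounds for Dirichlet eigenvalues *)

Lemma continuous_vec3 (R : realType) (T : topologicalType) (x y z : T -> R) (q : T) :
  {for q, continuous x} -> {for q, continuous y} -> {for q, continuous z} ->
  {for q, continuous (fun p => vec3 (x p) (y p) (z p))}.
Proof.
move=> cx cy cz A [P HP sPA].
have Hx : \forall p \near q, P 0 0 (x p).
  by apply: cx; have := HP 0 0; rewrite /= /vec3 mxE.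
have Hy : \forall p \near q, P 0 1 (y p).
  by apply: cy; have := HP 0 1; rewrite /= /vec3 mxE.
have Hz : \forall p \near q, P 0 2 (z p).
  by apply: cz; have := HP 0 2; rewrite /= /vec3 mxE.
suff H : \forall p \near q, A (vec3 (x p) (y p) (z p)) by exact: H.
near=> p; apply: sPA => i j; rewrite (ord1 i) /vec3 mxE.
have [->|->|->] : [\/ j = 0, j = 1 | j = 2].
  by case: j => [[|[|[|//]]] hj]; [apply: Or31|apply: Or32|apply: Or33]; exact/val_inj.
- by near: p.
- by near: p.
- by near: p.
Unshelve. all: by end_near. Qed.

Lemma continuous_catenoid_map (R : realType) (f : R -> R -> R) (a : R) :
  catenary_solution a (f a) -> continuous (catenoid_map f a).
Proof.
move=> sol q.
have c0 : {for q, continuous (fun q : 'rV[R]_2 => q 0 0)} by exact: coord_continuous.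
have c1 : {for q, continuous (fun q : 'rV[R]_2 => q 0 1)} by exact: coord_continuous.
have cf : {for q, continuous (fun q : 'rV[R]_2 => f a (q 0 0))}.
  by apply: (continuous_comp c0); exact: is_derive_cont (catenary_derive _ sol).
have cc : {for q, continuous (fun q : 'rV[R]_2 => cos (q 0 1))}.
  by apply: (continuous_comp c1); exact: continuous_cos.
have cs : {for q, continuous (fun q : 'rV[R]_2 => sin (q 0 1))}.
  by apply: (continuous_comp c1); exact: continuous_sin.
apply: (@continuous_vec3 R _ (fun q : 'rV[R]_2 => f a (q 0 0) * cos (q 0 1))
  (fun q => f a (q 0 0) * sin (q 0 1)) (fun q => q 0 0)).
- exact: cvgM cf cc.
- exact: cvgM cf cs.
- exact: c0.
Qed.

Lemma rel_interior_open (R : realType) (X : 'rV[R]_2 -> 'rV[R]_3) (D : set 'rV[R]_3)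
  (q : 'rV[R]_2) : continuous X ->
  rel_interior X D (X q) -> \forall q' \near q, rel_interior X D (X q').
Proof.
move=> cX [DX [V Vo VD]].
have : \forall q' \near q, V (X q') by apply: cX; exact: open_nbhs_nbhs.
apply: filterS => q' Vq'; split; first by apply: VD; split=> //; exists q'.
by exists V => //; split=> //; case: Vo.
Qed.

(* Barta's argument: where |u| / w is maximal, with value m, the function
   |u| - m w has a local maximum equal to 0, so its gradient vanishes there and
   its second-order terms have a sign. *)
Lemma dirichlet_eigenvalue_ge (R : realType) (f : R -> R -> R) (a : R)
  (D : set 'rV[R]_3) (l c : R) (w w1 w2 : R -> R) :
  let X := catenoid_map f a in
  0 < a -> catenary_solution a (f a) ->
  compact (closure D) -> closure D `<=` range X ->
  (forall t : R, is_derive t 1 w (w1 t)) -> (forall t : R, is_derive t 1 w1 (w2 t)) ->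
  continuous w2 ->
  (forall p, closure D p -> 0 < w (p 0 2)) ->
  (forall p, closure D p -> let t := p 0 2 in let r := f a t in
    c * w t <= - (a ^+ 2 * (r ^+ 2 + 4) / (4 * r ^+ 2) * w2 t
                  + a ^+ 2 * derive1 (f a) t / (2 * r) * w1 t) - cat_potential a r * w t) ->
  dirichlet_eigenvalue nil_metric X D l -> c <= l.
Proof.
move=> X a0 sol cD DX dw dw1 cw2 w_gt0 w_super [u [[p0 p0D up0] U2 cu u0 Ju]].
have cX : continuous X by exact: continuous_catenoid_map.
(* A constant sign making u positive at p0 stands in for the absolute value, which would not be
   differentiable. *)
pose sg : R := if 0 < u p0 then 1 else -1.
have sgu0 : 0 < sg * u p0.
  rewrite /sg; case: ifP => [|/negbT]; first by rewrite mul1r.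
  by rewrite -leNgt mulN1r oppr_gt0 lt_neqAle up0.
have sub : rel_interior X D `<=` closure D by move=> p [Dp _]; exact: subset_closure.
pose g p := sg * u p / w (p 0 2).
have cg : {within closure D, continuous g}.
  rewrite continuous_subspace_in => p pD; apply: cvgM.
    by apply: cvgM; [exact: cvg_cst|exact: cu].
  apply: cvgV; first by rewrite gt_eqF// w_gt0//; exact/set_mem.
  apply: continuous_subspaceT => {p pD} p.
  apply: (@continuous_comp _ _ _ (fun p : 'rV[R]_3 => p 0 2) w).
    exact: coord_continuous.
  exact: is_derive_cont (dw _).
have [ps psD gmax] := compact_EVT_max (ex_intro _ p0 (sub _ p0D)) cD cg.
rewrite inE in psD.
have gps : 0 < g ps.
  apply: lt_le_trans (gmax p0 (mem_set (sub _ p0D))).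
  by rewrite divr_gt0// w_gt0//; exact: sub.
have ups : 0 < sg * u ps.
  have w0 := w_gt0 _ psD.
  by move: gps; rewrite /g pmulr_lgt0// invr_gt0.
(* The maximum is positive while u vanishes on the relative boundary, so it is attained in the
   interior, where the equation holds. *)
have psI : rel_interior X D ps.
  apply: contrapT => nI; move: ups.
  by rewrite u0 ?mulr0 ?ltxx//; split.
have [q _ qE] := DX _ psD.
rewrite -{}qE in psD gmax gps ups psI *.
set m := g (X q) in gps.
have X2 q' : X q' 0 2 = q' 0 0 by rewrite /vec3 mxE.
have mE : sg * u (X q) = m * w (q 0 0).
  by rewrite /m /g X2 divfK// gt_eqF//; have := w_gt0 _ psD; rewrite X2.
have nearI := rel_interior_open cX psI.
pose U := u \o X.
have [cU dU] := U2.
have dUi i q' : rel_interior X D (X q') -> is_derive q' (delta_mx 0 i) U (partial i U q').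
  by move=> Hq; have [d _] := dU i; exact/derivableP/d.
have cUi i q' : rel_interior X D (X q') -> {for q', continuous (partial i U)}.
  by move=> Hq; have [_ [cc _]] := dU i; exact: cc.
have dUij i j q' : rel_interior X D (X q') ->
    is_derive q' (delta_mx 0 j) (partial i U) (partial j (partial i U) q').
  by move=> Hq; have [_ [_ /(_ j)[d _]]] := dU i; exact/derivableP/d.
have cUij i j q' : rel_interior X D (X q') -> {for q', continuous (partial j (partial i U))}.
  by move=> Hq; have [_ [_ /(_ j)[_ [cc _]]]] := dU i; exact: cc.
have c0 (q' : 'rV[R]_2) : {for q', continuous (fun q : 'rV[R]_2 => q 0 0)} by exact: coord_continuous.
have cwt (h : R -> R) (q' : 'rV[R]_2) : {for q' 0 0, continuous h} ->
    {for q', continuous (fun q : 'rV[R]_2 => h (q 0 0))}.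
  by move=> ch; apply: (continuous_comp (c0 q')).
have dwt (h : R -> R) dh (i : 'I_2) (q' : 'rV[R]_2) : is_derive (q' 0 0) 1 h dh ->
    is_derive q' (delta_mx 0 i) (fun q : 'rV[R]_2 => h (q 0 0)) ((i == 0)%:R * dh).
  move=> Dh; apply: (is_derive_eq (is_derive_compr (is_derive_coord 0 q' (delta_mx 0 i)) Dh)).
  by rewrite mxE/= eq_sym mulrC.
have comb (A B : 'rV[R]_2 -> R) dA dB (i : 'I_2) (q' : 'rV[R]_2) :
    is_derive q' (delta_mx 0 i) A dA -> is_derive q' (delta_mx 0 i) B dB ->
    is_derive q' (delta_mx 0 i) (fun q => sg * A q - m * B q) (sg * dA - m * dB).
  by move=> DA DB; apply: is_derive_eq.
have ccomb (A B : 'rV[R]_2 -> R) (q' : 'rV[R]_2) :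
    {for q', continuous A} -> {for q', continuous B} ->
    {for q', continuous (fun q => sg * A q - m * B q)}.
  by move=> CA CB; exact: (cvgB (cvgM (cvg_cst sg) CA) (cvgM (cvg_cst m) CB)).
have cst0 (q' : 'rV[R]_2) : {for q', continuous (fun _ : 'rV[R]_2 => (0 : R))} by apply: cst_continuous.
have := @max_second_order R _ (fun q => sg * U q - m * w (q 0 0))
  (fun q => sg * partial 0 U q - m * w1 (q 0 0)) (fun q => sg * partial 1 U q - m * 0)
  (fun q => sg * partial 0 (partial 0 U) q - m * w2 (q 0 0))
  (fun q => sg * partial 1 (partial 0 U) q - m * 0)
  (fun q => sg * partial 0 (partial 1 U) q - m * 0)
  (fun q => sg * partial 1 (partial 1 U) q - m * 0)
  q (delta_mx 0 0) (delta_mx 0 1).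
case.
- move: nearI; apply: filterS => q' Hq; split.
  + by apply: comb (dUi 0 q' Hq) _; have := dwt w _ 0 q' (dw _); rewrite mul1r.
  + by apply: comb (dUi 1 q' Hq) _; have := dwt w _ 1 q' (dw _); rewrite mul0r.
  + by apply: ccomb (cUi 0 q' Hq) (cwt _ _ _); exact: is_derive_cont (dw1 _).
  + exact: ccomb (cUi 1 q' Hq) _.
- move: nearI; apply: filterS => q' Hq; split.
  + by apply: comb (dUij 0 0 q' Hq) _; have := dwt w1 _ 0 q' (dw1 _); rewrite mul1r.
  + by apply: comb (dUij 0 1 q' Hq) _; have := dwt w1 _ 1 q' (dw1 _); rewrite mul0r.
- move: nearI; apply: filterS => q' Hq; split.
  + by apply: comb (dUij 1 0 q' Hq) _; exact: is_derive_cst.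
  + by apply: comb (dUij 1 1 q' Hq) _; exact: is_derive_cst.
- exact: ccomb (cUij 0 0 q psI) (cwt _ _ (cw2 _)).
- exact: ccomb (cUij 0 1 q psI) _.
- exact: ccomb (cUij 1 0 q psI) _.
- exact: ccomb (cUij 1 1 q psI) _.
- move: nearI; apply: filterS => q' Hq.
  have w0 := w_gt0 _ (sub _ Hq); rewrite X2 in w0.
  rewrite /U/= mE subrr subr_le0.
  have := gmax _ (mem_set (sub _ Hq)).
  by rewrite -/m /g X2 ler_pdivrMr.
move=> g0 _ Q.
have sols := w_super _ psD; rewrite X2/= in sols.
have f0 := catenary_gt0 a0 sol (q 0 0).
have r4 : 0 < f a (q 0 0) ^+ 2 + 4 by rewrite ltr_wpDl ?sqr_ge0.
have E := Ju q psI; rewrite catenoid_jacobiE// in E; last first.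
  by move=> i j; case: (dUij i j q psI).
set A := a ^+ 2 * (f a (q 0 0) ^+ 2 + 4) / (4 * f a (q 0 0) ^+ 2) in E sols.
set B := a ^+ 2 / (2 * f a (q 0 0) ^+ 2) in E.
set C := (a ^+ 2 + 4) / (f a (q 0 0) ^+ 2 * (f a (q 0 0) ^+ 2 + 4)) in E.
have A0 : 0 < A by rewrite divr_gt0 ?mulr_gt0 ?exprn_gt0.
have BC : B ^+ 2 <= A * C.
  rewrite -subr_ge0 (_ : _ - _ = (a / f a (q 0 0) ^+ 2) ^+ 2) ?sqr_ge0//.
  by rewrite /A /B /C; field; rewrite !gt_eqF.
have K := elliptic_le0 A0 BC Q.
move: E g0 K; rewrite -/U /=.
set b := a ^+ 2 * _ / _ in sols *; set V := cat_potential a _ in sols *.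
generalize (partial 0 U q) (partial 1 U q) (partial 0 (partial 0 U) q)
  (partial 1 (partial 0 U) q) (partial 0 (partial 1 U) q) (partial 1 (partial 1 U) q).
move=> u_0 u_1 u00 u10 u01 u11 E g0 K; change (U q) with (u (X q)) in E.
have {}sols : m * (c * w (q 0 0)) <= m * (- (A * w2 (q 0 0) + b * w1 (q 0 0)) - V * w (q 0 0)).
  by rewrite ler_wpM2l// ltW.
have E1 : l * (sg * u (X q)) =
    - (A * (sg * u00) + B * (sg * u01 + sg * u10) + C * (sg * u11) + b * (sg * u_0))
    - V * (sg * u (X q)) by rewrite mulrCA -E; ring.
have g0' : sg * u_0 = m * w1 (q 0 0) by apply/eqP; rewrite -subr_eq0 g0.
rewrite g0' mE in E1.
rewrite -(ler_pM2r ups) mE.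
have -> : c * (m * w (q 0 0)) = m * (c * w (q 0 0)) by ring.
(* At q the values and gradients of sg u and m w agree, so l m w and m times the Jacobi operator of
   w differ only by the second-order part of sg u - m w, which [K] shows to be nonpositive. *)
have -> : l * (m * w (q 0 0)) = m * (- (A * w2 (q 0 0) + b * w1 (q 0 0)) - V * w (q 0 0)) -
   (A * (sg * u00 - m * w2 (q 0 0)) +
    B * (sg * u01 - m * 0 + (sg * u10 - m * 0)) + C * (sg * u11 - m * 0)).
  by rewrite E1; ring.
by rewrite -[leLHS]subr0 lerB.
Qed.

(** * Rotationally invariant Jacobi functions *)

(** No uniqueness theorem for the equation is invoked. The rate is even in x, so its primitive T is
    odd; T is injective with T (x t) = t, so x is odd, and h depends on x through x^2. *)
Lemma catenary_even (R : realType) (b : R) (h : R -> R) (t : R) :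
  0 < b -> catenary_solution b h -> h (- t) = h t.
Proof.
move=> b0 sol; have [T [T0 dT]] := antiderivative (@continuous_cat_time_rate R b).
have TN y : T (- y) = - T y.
  have D (s : R) : is_derive s 1 (fun u : R => T (- u) + T u) 0.
    have D1 : is_derive s 1 (fun u : R => T (- u)) (cat_time_rate b (- s) * -1).
      by apply: is_derive_compr.
    have D2 := dT s; apply: is_derive_eq.
    by rewrite /cat_time_rate sqrrN; ring.
  have := is_derive_0_is_cst y 0 D; rewrite oppr0 T0 addr0 => /eqP.
  by rewrite addr_eq0 => /eqP.
pose x (t : R) := derive1 h t * Num.sqrt (h t ^+ 2 + 4) / 2.
have xN : x (- t) = - x t.
  have K : T (x (- t)) = T (- x t) by rewrite TN !cat_timeK.
  apply: (derive_gt0_inj dT _ K) => u.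
  exact: lt_le_trans (divr_gt0 (exprn_gt0 2 b0) (ltr0n _ 2)) (cat_time_rate_ge b u).
have [_ hE _] := catenary_parameter b0 sol.
by rewrite (hE (- t)) (hE t) -/(x (- t)) -/(x t) xN sqrrN.
Qed.

(* On functions of t alone the Jacobi operator is - cat_op. *)
Definition cat_op {R : realType} (f : R -> R -> R) (a t w w1 w2 : R) : R :=
  let r := f a t in
  a ^+ 2 * (r ^+ 2 + 4) / (4 * r ^+ 2) * w2 + a ^+ 2 * derive1 (f a) t / (2 * r) * w1
  + cat_potential a r * w.

(* The Jacobi function W f_t of the vertical translations, as W = a / f. *)
Definition cat_v {R : realType} (f : R -> R -> R) (a t : R) : R :=
  a * derive1 (f a) t / f a t.

Definition cat_v1 {R : realType} (f : R -> R -> R) (a t : R) : R :=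
  let r := f a t in
  4 * (2 * a ^+ 2 * r ^+ 2 - r ^+ 4 + 4 * a ^+ 2) / (a * (r ^+ 2 * (r ^+ 2 + 4) ^+ 2)).

(** The Jacobi equation solved for the second derivative. Thus [cat_v_jacobi] is mere algebra, and
    the content, that v satisfies the equation, lies in [cat_v1_derive]. *)
Definition cat_v2 {R : realType} (f : R -> R -> R) (a t : R) : R :=
  let r := f a t in
  - (a ^+ 2 * derive1 (f a) t / (2 * r) * cat_v1 f a t + cat_potential a r * cat_v f a t)
  * (4 * r ^+ 2) / (a ^+ 2 * (r ^+ 2 + 4)).

Lemma cat_v_derive (R : realType) (f : R -> R -> R) (a t : R) :
  0 < a -> catenary_solution a (f a) -> is_derive t 1 (cat_v f a) (cat_v1 f a t).
Proof.
move=> a0 sol; have f0 := catenary_gt0 a0 sol t.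
have r4 : 0 < f a t ^+ 2 + 4 by rewrite ltr_wpDl ?sqr_ge0.
have D1 := catenary_derive t sol; have D2 := catenary_derive' t sol.
have D3 := is_derive_inv D1 (lt0r_neq0 f0).
rewrite /cat_v; apply: is_derive_eq; rewrite /GRing.scale/=.
rewrite (catenary_second t a0 sol) /cat_v1.
transitivity (4 * (a ^+ 2 + 4) / (a * (f a t ^+ 2 + 4) ^+ 2) -
  a * derive1 (f a) t ^+ 2 / f a t ^+ 2); first by field; rewrite !gt_eqF.
by rewrite (catenary_slope_sqr t a0 sol); field; rewrite !gt_eqF.
Qed.

Lemma cat_v1_derive (R : realType) (f : R -> R -> R) (a t : R) :
  0 < a -> catenary_solution a (f a) -> is_derive t 1 (cat_v1 f a) (cat_v2 f a t).
Proof.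
move=> a0 sol; have f0 := catenary_gt0 a0 sol t.
have r4 : 0 < f a t ^+ 2 + 4 by rewrite ltr_wpDl ?sqr_ge0.
have D1 := catenary_derive t sol.
have D : is_derive t 1 (fun s => a * (f a s ^+ 2 * (f a s ^+ 2 + 4) ^+ 2))
   (a * (2 * f a t * (f a t ^+ 2 + 4) ^+ 2 + f a t ^+ 2 * (2 * (f a t ^+ 2 + 4) * (2 * f a t)))
    * derive1 (f a) t).
  by apply: is_derive_eq; rewrite /GRing.scale/=; ring.
have d0 : a * (f a t ^+ 2 * (f a t ^+ 2 + 4) ^+ 2) != 0 by rewrite !mulf_neq0 ?expf_neq0// gt_eqF.
have D3 := is_derive_inv D d0.
have D4 : is_derive t 1 (fun s => 4 * (2 * a ^+ 2 * f a s ^+ 2 - f a s ^+ 4 + 4 * a ^+ 2))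
  (4 * (4 * a ^+ 2 * f a t - 4 * f a t ^+ 3) * derive1 (f a) t).
  by apply: is_derive_eq; rewrite /GRing.scale/=; ring.
rewrite /cat_v1; apply: is_derive_eq; rewrite /GRing.scale/=.
rewrite /cat_v2 /cat_v1 /cat_v /cat_potential.
by field; rewrite !gt_eqF.
Qed.

Lemma cat_v2_continuous (R : realType) (f : R -> R -> R) (a : R) :
  0 < a -> catenary_solution a (f a) -> continuous (cat_v2 f a).
Proof.
move=> a0 sol t; have f0 := catenary_gt0 a0 sol t.
have r4 : 0 < f a t ^+ 2 + 4 by rewrite ltr_wpDl ?sqr_ge0.
have D1 := catenary_derive t sol; have D2 := catenary_derive' t sol.
have D3 := cat_v_derive t a0 sol; have D4 := cat_v1_derive t a0 sol.
have Di (n d : R -> R) dn dd : is_derive t 1 n dn -> is_derive t 1 d dd -> d t != 0 ->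
   is_derive t 1 (fun s => n s / d s) (n t * (- dd / d t ^+ 2) + (d t)^-1 * dn).
  by move=> Dn Dd d0; have := is_derive_inv Dd d0 => Dd'; apply: is_derive_eq.
have E1 : is_derive t 1 (fun s : R => 2 * f a s) (2 * derive1 (f a) t).
  by apply: is_derive_eq.
have E2 : is_derive t 1 (fun s : R => a ^+ 2 * derive1 (f a) s) (a ^+ 2 * derive1 (derive1 (f a)) t).
  by apply: is_derive_eq.
have E3 := Di _ _ _ _ E2 E1 (lt0r_neq0 (mulr_gt0 (ltr0n _ 2) f0)).
have E4 : is_derive t 1 (fun s : R => f a s ^+ 4 * (f a s ^+ 2 + 4) ^+ 2)
  (f a t ^+ 3 * 4 * derive1 (f a) t * (f a t ^+ 2 + 4) ^+ 2 +
   f a t ^+ 4 * (2 * (f a t ^+ 2 + 4) * (2 * f a t * derive1 (f a) t))).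
  by apply: is_derive_eq; rewrite /GRing.scale/=; ring.
have d4 : f a t ^+ 4 * (f a t ^+ 2 + 4) ^+ 2 != 0 by rewrite mulf_neq0 ?expf_neq0// gt_eqF.
have E5 : is_derive t 1 (fun s : R => 4 * ((a ^+ 2 + 2) * f a s ^+ 4 + 4 * a ^+ 2 * f a s ^+ 2 + 8 * a ^+ 2))
   (4 * ((a ^+ 2 + 2) * (4 * f a t ^+ 3 * derive1 (f a) t) + 4 * a ^+ 2 * (2 * f a t * derive1 (f a) t))).
  by apply: is_derive_eq; rewrite /GRing.scale/=; ring.
have E6 := Di _ _ _ _ E5 E4 d4.
have E7 : is_derive t 1 (fun s : R => a ^+ 2 * (f a s ^+ 2 + 4)) (a ^+ 2 * (2 * f a t * derive1 (f a) t)).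
  by apply: is_derive_eq; rewrite /GRing.scale/=; ring.
have d7 : a ^+ 2 * (f a t ^+ 2 + 4) != 0 by rewrite mulf_neq0 ?expf_neq0// gt_eqF.
have E8 := is_derive_inv E7 d7.
by rewrite /cat_v2 /cat_potential; apply: is_derive_cont.
Qed.

Lemma cat_v_jacobi (R : realType) (f : R -> R -> R) (a t : R) :
  0 < a -> catenary_solution a (f a) ->
  cat_op f a t (cat_v f a t) (cat_v1 f a t) (cat_v2 f a t) = 0.
Proof.
move=> a0 sol; have f0 := catenary_gt0 a0 sol t.
have r4 : 0 < f a t ^+ 2 + 4 by rewrite ltr_wpDl ?sqr_ge0.
rewrite /cat_op /cat_v2; move: (cat_v1 f a t) (cat_v f a t) (cat_potential a (f a t)) => x y z.
by field; rewrite !gt_eqF.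
Qed.

Definition cat_tau1 {R : realType} (f : R -> R -> R) (a t : R) : R :=
  2 * (f a t ^+ 2 + 2) / (a * (f a t ^+ 2 + 4)).

Definition cat_tau2 {R : realType} (f : R -> R -> R) (a t : R) : R :=
  8 * f a t * derive1 (f a) t / (a * (f a t ^+ 2 + 4) ^+ 2).

Lemma cat_tau1_derive (R : realType) (f : R -> R -> R) (a t : R) :
  0 < a -> catenary_solution a (f a) -> is_derive t 1 (cat_tau1 f a) (cat_tau2 f a t).
Proof.
move=> a0 sol; have f0 := catenary_gt0 a0 sol t.
have r4 : 0 < f a t ^+ 2 + 4 by rewrite ltr_wpDl ?sqr_ge0.
have D1 := catenary_derive t sol.
have D : is_derive t 1 (fun s : R => a * (f a s ^+ 2 + 4)) (a * (2 * f a t * derive1 (f a) t)).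
  by apply: is_derive_eq; rewrite /GRing.scale/=; ring.
have d7 : a * (f a t ^+ 2 + 4) != 0 by rewrite mulf_neq0// gt_eqF.
have D2 := is_derive_inv D d7.
rewrite /cat_tau1; apply: is_derive_eq; rewrite /GRing.scale/= /cat_tau2.
by field; rewrite !gt_eqF.
Qed.

Lemma cat_tau2_continuous (R : realType) (f : R -> R -> R) (a : R) :
  0 < a -> catenary_solution a (f a) -> continuous (cat_tau2 f a).
Proof.
move=> a0 sol t; have f0 := catenary_gt0 a0 sol t.
have r4 : 0 < f a t ^+ 2 + 4 by rewrite ltr_wpDl ?sqr_ge0.
have D1 := catenary_derive t sol; have D2 := catenary_derive' t sol.
have D : is_derive t 1 (fun s : R => a * (f a s ^+ 2 + 4) ^+ 2)
   (a * (2 * (f a t ^+ 2 + 4) * (2 * f a t * derive1 (f a) t))).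
  by apply: is_derive_eq; rewrite /GRing.scale/=; ring.
have d7 : a * (f a t ^+ 2 + 4) ^+ 2 != 0 by rewrite mulf_neq0 ?expf_neq0// gt_eqF.
have D3 := is_derive_inv D d7.
by rewrite /cat_tau2; apply: is_derive_cont.
Qed.

(** Here [tau] is a number, the value at t. The factor of c - tau is [cat_op] of v, hence 0; in the
    rest f_t occurs only squared, and the first integral reduces it to a rational identity in f. *)
Lemma cat_family_jacobi (R : realType) (f : R -> R -> R) (a t c tau : R) :
  0 < a -> catenary_solution a (f a) ->
  let v := cat_v f a t in let v1 := cat_v1 f a t in let v2 := cat_v2 f a t in
  let tau1 := cat_tau1 f a t in let tau2 := cat_tau2 f a t in
  cat_op f a t (1 + (c - tau) * v) ((c - tau) * v1 - tau1 * v)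
    ((c - tau) * v2 - 2 * tau1 * v1 - tau2 * v) = 0.
Proof.
move=> a0 sol v v1 v2 tau1 tau2; have f0 := catenary_gt0 a0 sol t.
have r4 : 0 < f a t ^+ 2 + 4 by rewrite ltr_wpDl ?sqr_ge0.
have := cat_v_jacobi t a0 sol; rewrite -/v -/v1 -/v2 => J.
transitivity ((c - tau) * cat_op f a t v v1 v2 + cat_op f a t 1 (- tau1 * v) (- 2 * tau1 * v1 - tau2 * v)).
  by rewrite /cat_op; ring.
rewrite J mulr0 add0r /cat_op /tau1 /tau2 /v /v1 /cat_v1 /cat_v /cat_tau1 /cat_tau2 /cat_potential.
have P := catenary_slope_sqr t a0 sol.
set p := derive1 (f a) t in P *; set r := f a t in P f0 r4 *.
transitivity (a ^+ 2 * (r ^+ 2 + 4) / (4 * r ^+ 2) *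
  (-2 * (2 * (r ^+ 2 + 2) / (a * (r ^+ 2 + 4))) *
   (4 * (2 * a ^+ 2 * r ^+ 2 - r ^+ 4 + 4 * a ^+ 2) /
    (a * (r ^+ 2 * (r ^+ 2 + 4) ^+ 2))) - 8 * p ^+ 2 / (r ^+ 2 + 4) ^+ 2)
  - a ^+ 3 / (2 * r ^+ 2) * p ^+ 2 * (2 * (r ^+ 2 + 2) / (a * (r ^+ 2 + 4)))
  + 4 * ((a ^+ 2 + 2) * r ^+ 4 + 4 * a ^+ 2 * r ^+ 2 + 8 * a ^+ 2) /
  (r ^+ 4 * (r ^+ 2 + 4) ^+ 2)); first by field; rewrite !gt_eqF.
by rewrite P; field; rewrite !gt_eqF.
Qed.

(** The left-hand side is the Wronskian e v' - e' v of v and e = 1 - tau v. In accordance with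
    Abel's identity it is inverse to the coefficient a (f^2 + 4) / 4 of the divergence form. *)
Lemma cat_wronskian (R : realType) (f : R -> R -> R) (a t : R) :
  0 < a -> catenary_solution a (f a) ->
  cat_v f a t ^+ 2 * cat_tau1 f a t + cat_v1 f a t = 4 / (a * (f a t ^+ 2 + 4)).
Proof.
move=> a0 sol; have f0 := catenary_gt0 a0 sol t.
have r4 : 0 < f a t ^+ 2 + 4 by rewrite ltr_wpDl ?sqr_ge0.
rewrite /cat_v !exprMn (catenary_slope_sqr t a0 sol) /cat_v1 /cat_tau1.
by field; rewrite !gt_eqF.
Qed.

(* The Jacobi functions e + c v, since e = 1 - tau v. *)
Definition cat_w {R : realType} (f : R -> R -> R) (a : R) (tau : R -> R) (c t : R) : R :=
  1 + (c - tau t) * cat_v f a t.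

Definition cat_w1 {R : realType} (f : R -> R -> R) (a : R) (tau : R -> R) (c t : R) : R :=
  (c - tau t) * cat_v1 f a t - cat_tau1 f a t * cat_v f a t.

Definition cat_w2 {R : realType} (f : R -> R -> R) (a : R) (tau : R -> R) (c t : R) : R :=
  (c - tau t) * cat_v2 f a t - 2 * cat_tau1 f a t * cat_v1 f a t
  - cat_tau2 f a t * cat_v f a t.

Lemma cat_w_derive (R : realType) (f : R -> R -> R) (a : R) (tau : R -> R) (c t : R) :
  0 < a -> catenary_solution a (f a) -> is_derive t 1 tau (cat_tau1 f a t) ->
  is_derive t 1 (cat_w f a tau c) (cat_w1 f a tau c t).
Proof.
move=> a0 sol D1; have D2 := cat_v_derive t a0 sol.
by rewrite /cat_w; apply: is_derive_eq; rewrite /GRing.scale/= /cat_w1; ring.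
Qed.

Lemma cat_w1_derive (R : realType) (f : R -> R -> R) (a : R) (tau : R -> R) (c t : R) :
  0 < a -> catenary_solution a (f a) -> is_derive t 1 tau (cat_tau1 f a t) ->
  is_derive t 1 (cat_w1 f a tau c) (cat_w2 f a tau c t).
Proof.
move=> a0 sol D1; have D2 := cat_v_derive t a0 sol; have D3 := cat_v1_derive t a0 sol.
have D4 := cat_tau1_derive t a0 sol.
by rewrite /cat_w1; apply: is_derive_eq; rewrite /GRing.scale/= /cat_w2; ring.
Qed.

Lemma cat_w2_continuous (R : realType) (f : R -> R -> R) (a : R) (tau : R -> R) (c : R) :
  0 < a -> catenary_solution a (f a) ->
  (forall t : R, is_derive t 1 tau (cat_tau1 f a t)) ->
  continuous (cat_w2 f a tau c).
Proof.
move=> a0 sol D1 t; have c0 := is_derive_cont (D1 t).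
have c1 := is_derive_cont (cat_v_derive t a0 sol).
have c2 := is_derive_cont (cat_v1_derive t a0 sol).
have c3 := @cat_v2_continuous _ _ _ a0 sol t.
have c4 := is_derive_cont (cat_tau1_derive t a0 sol).
have c5 := @cat_tau2_continuous _ _ _ a0 sol t.
apply: cvgB; last exact: cvgM c5 c1.
apply: cvgB; last by apply: cvgM => //; apply: cvgM => //; exact: cvg_cst.
by apply: cvgM => //; apply: cvgB => //; exact: cvg_cst.
Qed.

Lemma cat_slope_gt0 (R : realType) (a : R) (h : R -> R) (s t : R) :
  0 < a -> catenary_solution a h -> (derive1 h s < derive1 h t) = (s < t).
Proof.
move=> a0 sol; apply: (derive_gt0_lt _ _ (fun u => catenary_derive' u sol)) => u.
have h0 := catenary_gt0 a0 sol u.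
have p4 (x : R) : 0 < x ^+ 2 + 4 by rewrite ltr_wpDl ?sqr_ge0.
rewrite (catenary_second u a0 sol); apply: divr_gt0.
  by rewrite mulr_gt0// mulr_gt0.
by rewrite mulr_gt0// exprn_gt0.
Qed.

Lemma cat_v_gt0 (R : realType) (f : R -> R -> R) (a t : R) :
  0 < a -> catenary_solution a (f a) -> (0 < cat_v f a t) = (0 < t).
Proof.
move=> a0 sol; have f0 := catenary_gt0 a0 sol t; have [_ _ _ _ p0] := sol.
rewrite /cat_v pmulr_lgt0 ?invr_gt0// pmulr_rgt0//.
by rewrite -[X in X < _ = _]p0 (cat_slope_gt0 _ _ a0 sol).
Qed.

Lemma cat_v_lt0 (R : realType) (f : R -> R -> R) (a t : R) :
  0 < a -> catenary_solution a (f a) -> (cat_v f a t < 0) = (t < 0).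
Proof.
move=> a0 sol; have f0 := catenary_gt0 a0 sol t; have [_ _ _ _ p0] := sol.
rewrite /cat_v pmulr_llt0 ?invr_gt0// pmulr_rlt0//.
by rewrite -[X in _ < X = _]p0 (cat_slope_gt0 _ _ a0 sol).
Qed.

Lemma cat_v0 (R : realType) (f : R -> R -> R) (a : R) :
  catenary_solution a (f a) -> cat_v f a 0 = 0.
Proof. by move=> [_ _ _ _ p0]; rewrite /cat_v p0 mulr0 mul0r. Qed.

Lemma cat_v_neq0 (R : realType) (f : R -> R -> R) (a t : R) :
  0 < a -> catenary_solution a (f a) -> t != 0 -> cat_v f a t != 0.
Proof.
by move=> a0 sol; rewrite !neq_lt (cat_v_gt0 _ a0 sol) (cat_v_lt0 _ a0 sol).
Qed.

(* For t != 0, [cat_w c] vanishes at t exactly when kappa t = c. *)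
Definition cat_kappa {R : realType} (f : R -> R -> R) (a : R) (tau : R -> R) (t : R) : R :=
  tau t - (cat_v f a t)^-1.

Lemma cat_wE (R : realType) (f : R -> R -> R) (a : R) (tau : R -> R) (c t : R) :
  0 < a -> catenary_solution a (f a) -> t != 0 ->
  cat_w f a tau c t = cat_v f a t * (c - cat_kappa f a tau t).
Proof.
move=> a0 sol t0; rewrite /cat_w /cat_kappa.
by field; exact: cat_v_neq0.
Qed.

(** The Wronskian divided by v^2 is f^2 / (a (f^2 - a^2)), which exceeds 1 / a. A linear rate, and
    not just monotonicity, is what sends kappa to infinity and yields zeros for every c. *)
Lemma cat_kappa_growth (R : realType) (f : R -> R -> R) (a : R) (tau : R -> R) (s t : R) :
  0 < a -> catenary_solution a (f a) ->
  (forall t : R, is_derive t 1 tau (cat_tau1 f a t)) -> s <= t -> 0 < s \/ t < 0 ->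
  (t - s) / a <= cat_kappa f a tau t - cat_kappa f a tau s.
Proof.
move=> a0 sol dtau st st0.
have n0 u : s <= u <= t -> u != 0.
  by move=> /andP[su ut]; case: st0 => ?; rewrite neq_lt; apply/orP; [right|left]; lra.
have [u su|c cst ->] := @MVT_le R (cat_kappa f a tau)
    (fun u => cat_tau1 f a u + cat_v1 f a u / cat_v f a u ^+ 2) s t st.
  have D1 := is_derive_inv (cat_v_derive u a0 sol) (cat_v_neq0 a0 sol (n0 u su)).
  have D2 := dtau u.
  by rewrite /cat_kappa; apply: is_derive_eq; rewrite mulNr opprK.
rewrite mulrC ler_wpM2r ?subr_ge0//.
have v0 := cat_v_neq0 a0 sol (n0 c cst).
have f0 := catenary_gt0 a0 sol c.
have r4 : 0 < f a c ^+ 2 + 4 by rewrite ltr_wpDl ?sqr_ge0.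
have v2 : 0 < cat_v f a c ^+ 2 by rewrite exprn_even_gt0.
have -> : cat_tau1 f a c + cat_v1 f a c / cat_v f a c ^+ 2 =
    (cat_v f a c ^+ 2 * cat_tau1 f a c + cat_v1 f a c) / cat_v f a c ^+ 2.
  by field.
rewrite cat_wronskian// ler_pdivlMr//.
have -> : cat_v f a c ^+ 2 = 4 * (f a c ^+ 2 - a ^+ 2) / (f a c ^+ 2 * (f a c ^+ 2 + 4)).
  rewrite /cat_v !exprMn exprVn (catenary_slope_sqr c a0 sol).
  by field; rewrite !gt_eqF.
rewrite -subr_ge0 (_ : _ - _ = 4 * a ^+ 2 / (a * f a c ^+ 2 * (f a c ^+ 2 + 4))).
  by rewrite divr_ge0 ?mulr_ge0 ?exprn_ge0 ?(ltW a0) ?(ltW f0) ?(ltW r4).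
by field; rewrite !gt_eqF.
Qed.

Lemma cat_w_zero (R : realType) (f : R -> R -> R) (a : R) (tau : R -> R) (c : R) :
  0 < a -> catenary_solution a (f a) ->
  (forall t : R, is_derive t 1 tau (cat_tau1 f a t)) ->
  exists2 t, 0 < t & cat_w f a tau c t = 0.
Proof.
move=> a0 sol dtau.
have w0 : cat_w f a tau c 0 = 1 by rewrite /cat_w cat_v0// mulr0 addr0.
(* Chosen so that the growth of kappa from 1 to t is at least |c| + |kappa 1| + 1, which forces
   kappa t > c. *)
pose t := 1 + a * (`|c| + `|cat_kappa f a tau 1| + 1).
have t1 : 1 < t by rewrite ltrDl mulr_gt0// ltr_wpDl// addr_ge0.
have t0 : 0 < t by exact: lt_trans t1.
have wt : cat_w f a tau c t < 0.
  rewrite cat_wE ?gt_eqF// pmulr_rlt0 ?cat_v_gt0// subr_lt0.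
  have := cat_kappa_growth a0 sol dtau (ltW t1) (or_introl ltr01).
  have -> : (t - 1) / a = `|c| + `|cat_kappa f a tau 1| + 1.
    by rewrite /t; field; rewrite gt_eqF.
  have := ler_norm c; have := ler_norm (- cat_kappa f a tau 1); rewrite normrN; lra.
have [x||x] := @IVT R (cat_w f a tau c) 0 t 0 (ltW t0).
- apply: derivable_within_continuous => u _.
  by case: (cat_w_derive c a0 sol (dtau u)).
- by rewrite w0 ge_min (ltW wt) orbT le_max ler01.
rewrite in_itv/= => /andP[x0 _] wx; exists x => //.
rewrite lt_neqAle x0 andbT; apply/eqP => x0'.
by move: wx; rewrite -x0' w0 => /eqP; rewrite oner_eq0.
Qed.

(** A zero at s means c = kappa s, so for t > 0 the sign is that of kappa s - kappa t, and kappa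
    increases. At t = 0, where kappa is singular, the function equals 1. *)
Lemma cat_w_gt0 (R : realType) (f : R -> R -> R) (a : R) (tau : R -> R) (c s t : R) :
  0 < a -> catenary_solution a (f a) ->
  (forall t : R, is_derive t 1 tau (cat_tau1 f a t)) ->
  0 < s -> cat_w f a tau c s = 0 -> 0 <= t -> (0 < cat_w f a tau c t) = (t < s).
Proof.
move=> a0 sol dtau s0 ws; rewrite le_eqVlt => /orP[/eqP <-|t0].
  by rewrite /cat_w cat_v0// mulr0 addr0 ltr01 s0.
have v0 : 0 < cat_v f a t by rewrite cat_v_gt0.
have cE : c = cat_kappa f a tau s.
  move: ws; rewrite cat_wE ?gt_eqF// => /eqP; rewrite mulf_eq0.
  by rewrite (negbTE (cat_v_neq0 a0 sol (lt0r_neq0 s0))) subr_eq0 => /eqP.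
rewrite cat_wE ?gt_eqF// pmulr_rgt0// cE subr_gt0.
have [ts|st] := ltP t s.
  have := cat_kappa_growth a0 sol dtau (ltW ts) (or_introl t0).
  have : 0 < (s - t) / a by rewrite divr_gt0// subr_gt0.
  by move=> h1 h2; rewrite -subr_gt0 (lt_le_trans h1).
have := cat_kappa_growth a0 sol dtau st (or_introl s0).
have : 0 <= (t - s) / a by rewrite divr_ge0 ?subr_ge0// ltW.
by move=> h1 h2; apply/negbTE; rewrite -leNgt -subr_ge0 (le_trans h1).
Qed.

Lemma cat_w_gt0_neg (R : realType) (f : R -> R -> R) (a : R) (tau : R -> R) (c s t : R) :
  0 < a -> catenary_solution a (f a) ->
  (forall t : R, is_derive t 1 tau (cat_tau1 f a t)) ->
  s < 0 -> cat_w f a tau c s = 0 -> s < t <= 0 -> 0 < cat_w f a tau c t.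
Proof.
move=> a0 sol dtau s0 ws /andP[st]; rewrite le_eqVlt => /orP[/eqP ->|t0].
  by rewrite /cat_w cat_v0// mulr0 addr0 ltr01.
have v0 : cat_v f a t < 0 by rewrite cat_v_lt0.
have cE : c = cat_kappa f a tau s.
  move: ws; rewrite cat_wE ?lt_eqF// => /eqP; rewrite mulf_eq0.
  by rewrite (negbTE (cat_v_neq0 a0 sol (ltr0_neq0 s0))) subr_eq0 => /eqP.
rewrite cat_wE ?lt_eqF// nmulr_rgt0// cE subr_lt0.
have := cat_kappa_growth a0 sol dtau (ltW st) (or_intror t0).
have : 0 < (t - s) / a by rewrite divr_gt0// subr_gt0.
by move=> h1 h2; rewrite -subr_gt0 (lt_le_trans h1).
Qed.

(** * Supersolutions *)

Lemma continuous_at_add (R : realType) (T : topologicalType) (g h : T -> R) (u : T) :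
  {for u, continuous g} -> {for u, continuous h} ->
  {for u, continuous (fun x => g x + h x)}.
Proof. by move=> cg ch; apply: cvgD. Qed.

Lemma continuous_at_mul (R : realType) (T : topologicalType) (g h : T -> R) (u : T) :
  {for u, continuous g} -> {for u, continuous h} ->
  {for u, continuous (fun x => g x * h x)}.
Proof. by move=> cg ch; apply: cvgM. Qed.

Lemma continuous_itv_gt0 (R : realType) (g : R -> R) (s t : R) : s <= t ->
  continuous g -> (forall u, s <= u <= t -> 0 < g u) ->
  exists2 m : R, 0 < m & forall u, s <= u <= t -> m <= g u.
Proof.
move=> st cg g0.
have [c cst H] := EVT_min st (continuous_subspaceT cg).
by exists (g c); [apply: g0; rewrite in_itv/= in cst|move=> u ust; apply: H; rewrite in_itv].
Qed.

Lemma continuous_itv_bounded (R : realType) (g : R -> R) (s t : R) : s <= t ->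
  continuous g -> exists2 M : R, 0 < M & forall u, s <= u <= t -> `|g u| <= M.
Proof.
move=> st cg.
have cg' : continuous (fun u => `|g u|).
  by move=> u; apply: cvg_norm; exact: cg.
have [c _ H] := EVT_max st (continuous_subspaceT cg').
exists (`|g c| + 1); first by rewrite ltr_wpDl.
by move=> u ust; rewrite ler_wpDr//; apply: H; rewrite in_itv.
Qed.

(** For a Jacobi function w the first summand vanishes, and with it the potential: only derivatives
    of the factor h remain. *)
Lemma cat_op_mul (R : realType) (f : R -> R -> R) (a t w w1 w2 h h1 h2 : R) :
  0 < a -> catenary_solution a (f a) ->
  cat_op f a t (w * h) (w1 * h + w * h1) (w2 * h + 2 * w1 * h1 + w * h2) =
  h * cat_op f a t w w1 w2 + a ^+ 2 / (4 * f a t ^+ 2) *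
   ((f a t ^+ 2 + 4) * (2 * w1 * h1 + w * h2) + 2 * f a t * derive1 (f a) t * w * h1).
Proof.
move=> a0 sol; have f0 := catenary_gt0 a0 sol t.
by rewrite /cat_op; field; rewrite gt_eqF.
Qed.

(* Multiply by C - exp (k u): for k large the second derivative of the factor
   dominates the first. *)
Lemma cat_strict_supersolution (R : realType) (f : R -> R -> R) (a : R)
    (w w1 w2 : R -> R) (s t : R) :
  0 < a -> catenary_solution a (f a) -> s <= t ->
  (forall u : R, is_derive u 1 w (w1 u)) -> (forall u : R, is_derive u 1 w1 (w2 u)) ->
  continuous w2 -> (forall u, s <= u <= t -> 0 < w u) ->
  (forall u, cat_op f a u (w u) (w1 u) (w2 u) = 0) ->
  exists (c : R) (W W1 W2 : R -> R), [/\ 0 < c,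
    (forall u : R, is_derive u 1 W (W1 u)) /\ (forall u : R, is_derive u 1 W1 (W2 u)),
    continuous W2
  & forall u, s <= u <= t -> 0 < W u /\ c * W u <= - cat_op f a u (W u) (W1 u) (W2 u)].
Proof.
move=> a0 sol st dw dw1 cw2 w0 Jw.
have cw : continuous w by move=> u; exact: is_derive_cont (dw u).
have cw1 : continuous w1 by move=> u; exact: is_derive_cont (dw1 u).
have cf : continuous (f a) by move=> u; exact: is_derive_cont (catenary_derive u sol).
have cp : continuous (derive1 (f a)) by move=> u; exact: is_derive_cont (catenary_derive' u sol).
have [m m0 wm] := continuous_itv_gt0 st cw w0.
have [wM wM0 wle] := continuous_itv_bounded st cw.
have [rM rM0 rle] := continuous_itv_bounded st cf.
have cg : continuous (fun u => (f a u ^+ 2 + 4) * (2 * w1 u) + 2 * f a u * derive1 (f a) u * w u).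
  move=> u; have D1 := catenary_derive u sol; have D2 := catenary_derive' u sol.
  have D3 := dw u; have D4 := dw1 u.
  exact: is_derive_cont.
have [M M0 Mle] := continuous_itv_bounded st cg.
(* Since (f^2 + 4) w >= 4 m, the term k (f^2 + 4) w is at least M + 1 and leaves a surplus of 1 over
   the first-order terms, bounded by M. *)
pose k := (M + 1) / (4 * m).
have k0 : 0 < k by rewrite divr_gt0 ?mulr_gt0// addr_gt0.
pose E (u : R) := expR (k * u).
have dE (u : R) : is_derive u 1 E (k * E u).
  have D : is_derive u 1 (fun u : R => k * u) k.
    by apply: is_derive_eq; rewrite /GRing.scale/= mulr1.
  by apply: (is_derive_eq (is_derive_compr D (is_derive_expR _))); rewrite mulrC.
pose C := E t + 1.
have E0 u : 0 < E u by exact: expR_gt0.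
have Et u : u <= t -> E u <= E t by move=> ut; rewrite ler_expR ler_pM2l.
have Es u : s <= u -> E s <= E u by move=> su; rewrite ler_expR ler_pM2l.
have C0 : 0 < C by rewrite addr_gt0.
(* A lower bound for - [cat_op] of the product divided by an upper bound for the product. The
   summand 1 in [C] keeps the factor C - E at least 1 on the segment. *)
exists (k * E s * (a ^+ 2 / (4 * rM ^+ 2)) / (wM * C)).
exists (fun u => w u * (C - E u)), (fun u => w1 u * (C - E u) + w u * - (k * E u)).
exists (fun u => w2 u * (C - E u) + 2 * w1 u * - (k * E u) + w u * - (k * (k * E u))).
have AM0 : 0 < a ^+ 2 / (4 * rM ^+ 2) by rewrite divr_gt0 ?mulr_gt0 ?exprn_gt0.
split.
- apply: divr_gt0; last exact: mulr_gt0.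
  by rewrite mulr_gt0// mulr_gt0.
- split=> u; have D1 := dw u; have D2 := dw1 u; have D3 := dE u.
    by apply: is_derive_eq; rewrite /GRing.scale/=; ring.
  by apply: is_derive_eq; rewrite /GRing.scale/=; ring.
- move=> u; have c1 := cw u; have c2 := cw1 u; have c3 := cw2 u.
  have cE := is_derive_cont (dE u).
  have ckE : {for u, continuous (fun u => - (k * E u))}.
    by apply: cvgN; apply: cvgM => //; exact: cvg_cst.
  have ckkE : {for u, continuous (fun u => - (k * (k * E u)))}.
    by apply: cvgN; apply: cvgM; [exact: cvg_cst|apply: cvgM => //; exact: cvg_cst].
  have cCE : {for u, continuous (fun u => C - E u)} by apply: cvgB => //; exact: cvg_cst.
  have c2w : {for u, continuous (fun u => 2 * w1 u)} by apply: cvgM => //; exact: cvg_cst.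
  exact: cvgD (cvgD (cvgM c3 cCE) (cvgM c2w ckE)) (cvgM c1 ckkE).
move=> u sut; have /andP[su ut] := sut.
have wu := w0 u sut; have f0 := catenary_gt0 a0 sol u.
have h1 : 1 <= C - E u by have := Et u ut; rewrite /C; lra.
have h2 : C - E u <= C by rewrite gerBl ltW.
have h0 : 0 < C - E u by exact: lt_le_trans h1.
split; first by rewrite mulr_gt0.
rewrite (@cat_op_mul R f a u _ _ _ _ _ _ a0 sol) Jw mulr0 add0r.
have K1 : 1 <= (f a u ^+ 2 + 4) * (2 * w1 u) + 2 * f a u * derive1 (f a) u * w u
     + k * ((f a u ^+ 2 + 4) * w u).
  have := Mle u sut; rewrite ler_norml => /andP[Ml _].
  have : M + 1 <= k * ((f a u ^+ 2 + 4) * w u).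
    apply: (@le_trans _ _ (k * (4 * m))); first by rewrite /k divfK// gt_eqF// mulr_gt0.
    rewrite ler_pM2l//; apply: ler_pM => //; first exact: ltW.
      by rewrite lerDr sqr_ge0.
    exact: wm.
  move=> Mk; move: Ml; lra.
rewrite [leRHS](_ : _ = a ^+ 2 / (4 * f a u ^+ 2) * (k * E u *
   ((f a u ^+ 2 + 4) * (2 * w1 u) + 2 * f a u * derive1 (f a) u * w u
     + k * ((f a u ^+ 2 + 4) * w u)))); last by ring.
have W_le : w u * (C - E u) <= wM * C.
  by apply: ler_pM => //; [exact: ltW|exact: ltW|rewrite (le_trans (ler_norm _))// wle].
have WM0 : 0 < wM * C by rewrite mulr_gt0.
rewrite mulrAC ler_pdivrMr//.
have A_ge : a ^+ 2 / (4 * rM ^+ 2) <= a ^+ 2 / (4 * f a u ^+ 2).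
  rewrite ler_pM2l ?exprn_gt0// lef_pV2 ?posrE ?mulr_gt0 ?exprn_gt0//.
  rewrite ler_pM2l// lerXn2r ?nnegrE ?(ltW f0) ?(ltW rM0)//.
  by rewrite (le_trans (ler_norm _))// rle.
have X0 : 0 <= k * E s * (a ^+ 2 / (4 * rM ^+ 2)).
  by rewrite mulr_ge0 ?(ltW AM0)// mulr_ge0 ?(ltW k0) ?(ltW (E0 _)).
apply: ler_pM => //; first by rewrite mulr_ge0 ?ltW.
rewrite [leRHS]mulrC [leRHS]mulrAC; apply: (@le_trans _ _ (k * E u * (a ^+ 2 / (4 * f a u ^+ 2)))).
  apply: ler_pM; [|exact: ltW|by rewrite (ler_pM2l k0); exact: Es|exact: A_ge].
  by rewrite mulr_ge0 ?ltW.
rewrite ler_peMr// mulr_ge0//; first by rewrite mulr_ge0 ?ltW.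
exact: le_trans (ltW AM0) A_ge.
Qed.

(* Add a small multiple of v h to the Jacobi function, with h odd and
   h' = exp (- k u^2). As v h > 0 off 0, this is positive up to the ends of the
   band; for k large v h is a supersolution except near 0, where the Jacobi
   function is bounded below. *)
Lemma cat_near_supersolution (R : realType) (f : R -> R -> R) (a : R)
    (tau : R -> R) (c t1 t2 d : R) :
  0 < a -> catenary_solution a (f a) ->
  (forall t : R, is_derive t 1 tau (cat_tau1 f a t)) ->
  0 < t1 -> 0 < t2 -> 0 < d ->
  (forall u : R, - t1 < u < t2 -> 0 < cat_w f a tau c u) ->
  cat_w f a tau c (- t1) = 0 -> cat_w f a tau c t2 = 0 ->
  exists (W W1 W2 : R -> R), [/\
    (forall u : R, is_derive u 1 W (W1 u)) /\ (forall u : R, is_derive u 1 W1 (W2 u)),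
    continuous W2
  & forall u : R, - t1 <= u <= t2 -> 0 < W u /\ - d * W u <= - cat_op f a u (W u) (W1 u) (W2 u)].
Proof.
move=> a0 sol dtau t1_gt0 t2_gt0 d0 w_gt0 wt1 wt2.
pose w := cat_w f a tau c; pose w1 := cat_w1 f a tau c; pose w2 := cat_w2 f a tau c.
pose v := cat_v f a; pose v1 := cat_v1 f a; pose v2 := cat_v2 f a.
have dw (u : R) : is_derive u 1 w (w1 u) by exact: cat_w_derive.
have dw1 (u : R) : is_derive u 1 w1 (w2 u) by exact: cat_w1_derive.
have cw2 : continuous w2 by exact: cat_w2_continuous.
have dv (u : R) : is_derive u 1 v (v1 u) by exact: cat_v_derive.
have dv1 (u : R) : is_derive u 1 v1 (v2 u) by exact: cat_v1_derive.
have cv2 : continuous v2 by exact: cat_v2_continuous.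
have cw : continuous w by move=> u; exact: is_derive_cont (dw u).
have cv : continuous v by move=> u; exact: is_derive_cont (dv u).
have t12 : - t1 <= t2 by lra.
have w_ge0 (u : R) : - t1 <= u <= t2 -> 0 <= w u.
  move=> /andP[]; rewrite le_eqVlt => /orP[/eqP <-|u1]; first by rewrite /w wt1.
  rewrite le_eqVlt => /orP[/eqP ->|u2]; first by rewrite /w wt2.
  by apply/ltW/w_gt0; rewrite u1.
pose eta := Num.min t1 t2 / 2.
have eta1 : eta < t1.
  have : Num.min t1 t2 <= t1 by rewrite ge_min lexx.
  by rewrite /eta; lra.
have eta2 : eta < t2.
  have : Num.min t1 t2 <= t2 by rewrite ge_min lexx orbT.
  by rewrite /eta; lra.
have eta0 : 0 < eta by rewrite /eta divr_gt0// lt_min t1_gt0.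
have ctv : continuous (fun u : R => u * v u).
  by move=> u; apply: cvgM; [exact: cvg_id|exact: cv].
have tv (u : R) : u != 0 -> 0 < u * v u.
  rewrite neq_lt => /orP[u0|u0]; first by rewrite nmulr_rgt0// cat_v_lt0.
  by rewrite mulr_gt0// cat_v_gt0.
have [m1 m1_gt0 Hm1] : exists2 m : R, 0 < m & forall u : R, eta <= u <= t2 -> m <= u * v u.
  apply: continuous_itv_gt0 => // [|u /andP[u1 _]]; first exact: ltW.
  by apply: tv; rewrite gt_eqF// (lt_le_trans eta0).
have [m2 m2_gt0 Hm2] : exists2 m : R, 0 < m & forall u : R, - t1 <= u <= - eta -> m <= u * v u.
  apply: continuous_itv_gt0 => // [|u /andP[_ u1]]; first by rewrite lerN2 ltW.
  by apply: tv; rewrite lt_eqF// (le_lt_trans u1)// oppr_lt0.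
pose m := Num.min m1 m2.
have m_gt0 : 0 < m by rewrite lt_min m1_gt0.
have Hm (u : R) : - t1 <= u <= t2 -> eta <= `|u| -> m <= u * v u.
  move=> /andP[u1 u2]; have [u0|u0] := leP 0 u.
    rewrite ger0_norm// => ue; apply: (@le_trans _ _ m1); first by rewrite ge_min lexx.
    by apply: Hm1; rewrite ue.
  rewrite ltr0_norm// => ue; apply: (@le_trans _ _ m2); first by rewrite ge_min lexx orbT.
  by apply: Hm2; rewrite u1 lerNr.
have [m0 m0_gt0 Hm0] : exists2 m : R, 0 < m & forall u : R, - eta <= u <= eta -> m <= w u.
  apply: continuous_itv_gt0 => // [|u /andP[u1 u2]]; first lra.
  by apply: w_gt0; apply/andP; split; lra.
have cg : continuous (fun u : R => (f a u ^+ 2 + 4) * (2 * v1 u) + 2 * f a u * derive1 (f a) u * v u).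
  move=> u; have D1 := catenary_derive u sol; have D2 := catenary_derive' u sol.
  have D3 := dv u; have D4 := dv1 u.
  exact: is_derive_cont.
have [M M0 Mle] := continuous_itv_bounded t12 cg.
(* Makes 4 (2 k m) = M, so that for |u| >= eta the term from h'' outweighs the first-order terms. *)
pose k := M / (8 * m).
have k0 : 0 < k by rewrite divr_gt0// mulr_gt0.
pose h1 (u : R) := expR (- k * u ^+ 2).
have dh1 (u : R) : is_derive u 1 h1 (- 2 * k * u * h1 u).
  have D : is_derive u 1 (fun u : R => - k * u ^+ 2) (- 2 * k * u).
    by apply: is_derive_eq; rewrite /GRing.scale/=; ring.
  by apply: (is_derive_eq (is_derive_compr D (is_derive_expR _))); rewrite mulrC.
have h1_gt0 (u : R) : 0 < h1 u by exact: expR_gt0.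
have h1_le1 (u : R) : h1 u <= 1.
  by rewrite -expR0 ler_expR mulNr oppr_le0 mulr_ge0 ?sqr_ge0 ?ltW.
have [h [h0 dh]] : exists h : R -> R, h 0 = 0 /\ forall x : R, is_derive x 1 h (h1 x).
  by apply: antiderivative => u; exact: is_derive_cont (dh1 u).
have vh (u : R) : u != 0 -> 0 < v u * h u.
  rewrite neq_lt => /orP[u0|u0].
    by rewrite nmulr_rgt0 ?cat_v_lt0// -h0 (derive_gt0_lt _ _ dh h1_gt0).
  by rewrite mulr_gt0 ?cat_v_gt0// -h0 (derive_gt0_lt _ _ dh h1_gt0).
have [N N0 Nle] : exists2 N : R, 0 < N & forall u : R, - t1 <= u <= t2 ->
    `|(f a u ^+ 2 + 4) * (2 * v1 u - 2 * k * u * v u) + 2 * f a u * derive1 (f a) u * v u| <= N.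
  apply: continuous_itv_bounded => // u.
  have D1 := catenary_derive u sol; have D2 := catenary_derive' u sol.
  have D3 := dv u; have D4 := dv1 u.
  exact: is_derive_cont.
(* For |u| < eta the error, at most eps N = d m0, is paid by d times the Jacobi function, which is
   at least m0 there. *)
pose eps := d * m0 / N.
have eps0 : 0 < eps by rewrite divr_gt0// mulr_gt0.
exists (fun u : R => w u + eps * (v u * h u)), (fun u : R => w1 u + eps * (v1 u * h u + v u * h1 u)).
exists (fun u : R => w2 u + eps * (v2 u * h u + 2 * v1 u * h1 u + v u * (- 2 * k * u * h1 u))).
split.
- split=> u; have D1 := dw u; have D2 := dw1 u; have D3 := dv u; have D4 := dv1 u;
    have D5 := dh u; have D6 := dh1 u.
    by apply: is_derive_eq; rewrite /GRing.scale/=; ring.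
  by apply: is_derive_eq; rewrite /GRing.scale/=; ring.
- move=> u; have cvu := cv u; have cv2u := cv2 u; have cw2u := cw2 u.
  have cv1u := is_derive_cont (dv1 u).
  have chu := is_derive_cont (dh u); have ch1u := is_derive_cont (dh1 u).
  have c2v : {for u, continuous (fun u : R => 2 * v1 u)} by apply: cvgM => //; exact: cvg_cst.
  have cku : {for u, continuous (fun u : R => - 2 * k * u)}.
    by apply: cvgM; [exact: cvg_cst|exact: cvg_id].
  have ceps : {for u, continuous (fun=> eps)} by exact: cvg_cst.
  have c3 := continuous_at_mul cvu (continuous_at_mul cku ch1u).
  have c4 := continuous_at_add (continuous_at_mul cv2u chu) (continuous_at_mul c2v ch1u).
  exact: continuous_at_add cw2u (continuous_at_mul ceps (continuous_at_add c4 c3)).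
move=> u ut; have f0 := catenary_gt0 a0 sol u.
have wu := w_ge0 u ut.
have W0 : 0 < w u + eps * (v u * h u).
  have [->|un0] := eqVneq u 0.
    by rewrite /v cat_v0// mul0r mulr0 addr0; apply: w_gt0; rewrite oppr_lt0 t1_gt0.
  by rewrite ltr_wpDl// mulr_gt0// vh.
split=> //.
have -> : cat_op f a u (w u + eps * (v u * h u)) (w1 u + eps * (v1 u * h u + v u * h1 u))
   (w2 u + eps * (v2 u * h u + 2 * v1 u * h1 u + v u * (- 2 * k * u * h1 u))) =
  cat_op f a u (w u) (w1 u) (w2 u) + eps * cat_op f a u (v u * h u)
    (v1 u * h u + v u * h1 u) (v2 u * h u + 2 * v1 u * h1 u + v u * (- 2 * k * u * h1 u)).
  by rewrite /cat_op; ring.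
rewrite (cat_family_jacobi u c (tau u) a0 sol) add0r (@cat_op_mul R f a u _ _ _ _ _ _ a0 sol).
rewrite (cat_v_jacobi u a0 sol) mulr0 add0r.
(* As h'' = - 2 k u h', the factor h' comes out of every surviving term: [cat_op] of v h is A h' br
   with 0 < A <= 1 and 0 < h' <= 1, so only [br] has to be controlled. *)
pose br := (f a u ^+ 2 + 4) * (2 * v1 u - 2 * k * u * v u) +
   2 * f a u * derive1 (f a) u * v u.
rewrite (_ : (f a u ^+ 2 + 4) * _ + _ = h1 u * br); last by rewrite /br -/v -/v1; ring.
pose A := a ^+ 2 / (4 * f a u ^+ 2).
have A0 : 0 < A by rewrite divr_gt0 ?mulr_gt0 ?exprn_gt0.
have A1 : A <= 1.
  have [ar _ _ _ _] := sol.
  rewrite ler_pdivrMr ?mulr_gt0 ?exprn_gt0// mul1r.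
  have : a ^+ 2 <= f a u ^+ 2 by rewrite lerXn2r ?nnegrE ?(ltW a0) ?(ltW f0)// ar.
  by have := exprn_gt0 2 f0; lra.
rewrite -/A mulNr lerN2.
have dW : 0 < d * (w u + eps * (v u * h u)) by rewrite mulr_gt0.
have [ue|ue] := leP eta `|u|.
  suff br0 : br <= 0.
    apply: (@le_trans _ _ 0); last exact: ltW.
    by rewrite pmulr_rle0// pmulr_rle0// pmulr_rle0.
  have Mk : M <= (f a u ^+ 2 + 4) * (2 * k * (u * v u)).
    have -> : M = 4 * (2 * k * m) by rewrite /k; field; rewrite gt_eqF.
    apply: ler_pM => //; first exact: mulr_ge0 (mulr_ge0 (ler0n _ 2) (ltW k0)) (ltW m_gt0).
      by rewrite lerDr sqr_ge0.
    by rewrite (ler_pM2l (mulr_gt0 (ltr0n _ 2) k0)); exact: Hm.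
  have := Mle u ut; rewrite ler_norml => /andP[_ Mu].
  have -> : br = (f a u ^+ 2 + 4) * (2 * v1 u) + 2 * f a u * derive1 (f a) u * v u
     - (f a u ^+ 2 + 4) * (2 * k * (u * v u)) by rewrite /br; ring.
  by rewrite subr_le0 (le_trans Mu).
have m0w : m0 <= w u by apply: Hm0; move: ue; rewrite ltr_norml => /andP[? ?]; rewrite !ltW.
have vh0 : 0 <= v u * h u.
  have [->|/vh/ltW//] := eqVneq u 0.
  by rewrite /v cat_v0// mul0r.
apply: (@le_trans _ _ (eps * N)); last first.
  rewrite /eps divfK ?gt_eqF// ler_pM2l//.
  by rewrite (le_trans m0w)// lerDl mulr_ge0// ltW.
rewrite ler_pM2l//; apply: le_trans (Nle u ut); rewrite -/br.
apply: (le_trans (ler_norm _)); rewrite normrM (gtr0_norm A0) normrM (gtr0_norm (h1_gt0 u)).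
by rewrite mulrA ler_piMl// mulr_ile1 ?(ltW A0) ?(ltW (h1_gt0 u)) ?A1 ?h1_le1.
Qed.

(** * Slices and bands of the catenoid *)

Definition catenoid_slice {R : realType} (f : R -> R -> R) (a : R) (I : set R) :
    set 'rV[R]_3 :=
  [set p | range (catenoid_map f a) p /\ I (p 0 2)].

Lemma catenoid_map_z (R : realType) (f : R -> R -> R) (a : R) (q : 'rV[R]_2) :
  catenoid_map f a q 0 2 = q 0 0.
Proof. by rewrite mxE. Qed.

Lemma catenoid_sliceE (R : realType) (f : R -> R -> R) (a : R) (I : set R) (q : 'rV[R]_2) :
  catenoid_slice f a I (catenoid_map f a q) <-> I (q 0 0).
Proof.
rewrite /catenoid_slice/= catenoid_map_z; split=> [[]//|Iq].
by split=> //; exists q.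
Qed.

(** Bands restrict theta to [0, 2 pi], which makes them visibly compact; this shows that they still
    contain the full circle at each height, hence are slices. *)
Lemma angle_reduction (R : realType) (x : R) :
  exists y : R, [/\ 0 <= y <= 2 * pi, cos y = cos x & sin y = sin x].
Proof.
have cb : -1 <= cos x <= 1 by rewrite cos_geN1 cos_le1.
have c1 := acosK (x := cos x); rewrite in_itv/= in c1.
have s1 := sin_acos cb.
have sE : Num.sqrt (1 - cos x ^+ 2) = `|sin x|.
  by rewrite -sqrtr_sqr; congr Num.sqrt; rewrite -(cos2Dsin2 x) [_ + sin x ^+ 2]addrC addrK.
have y0 := acos_ge0 cb; have ypi := acos_lepi cb; have p0 := pi_ge0 R.
have [sx|sx] := leP 0 (sin x).
  exists (acos (cos x)); split; [apply/andP; split; lra|exact: c1|].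
  by rewrite s1 sE ger0_norm.
exists (- acos (cos x) + pi *+ 2); split.
- by rewrite mulr2n; apply/andP; split; lra.
- by rewrite cosD2pi cosN; exact: c1.
- by rewrite sinD2pi sinN s1 sE ltr0_norm// opprK.
Qed.

Lemma catenoid_bandE (R : realType) (f : R -> R -> R) (a s t : R) :
  catenoid_band f a s t = catenoid_slice f a [set u | s <= u <= t].
Proof.
apply/seteqP; split=> [p [q [qst _] <-]|p [[q _ <-]]].
  exact/catenoid_sliceE.
rewrite /= catenoid_map_z => qst.
have [y [y2 cy sy]] := angle_reduction (q 0 1).
exists (vec2 (q 0 0) y); first by rewrite /= !mxE.
by rewrite /catenoid_map !mxE/= cy sy.
Qed.

Lemma catenoid_curve_continuous (R : realType) (f : R -> R -> R) (a : R) (q v : 'rV[R]_2) :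
  catenary_solution a (f a) ->
  continuous (fun x : R => catenoid_map f a (x *: v + q)).
Proof.
move=> sol x.
apply: (@continuous_comp _ _ _ (fun x : R => x *: v + q) (catenoid_map f a)).
  by apply: cvgD; [apply: cvgZr_tmp; exact: cvg_id|exact: cvg_cst].
exact: continuous_catenoid_map.
Qed.

Lemma catenoid_near (R : realType) (f : R -> R -> R) (a e : R) (q v : 'rV[R]_2)
    (V : set 'rV[R]_3) :
  catenary_solution a (f a) -> nbhs (catenoid_map f a q) V -> 0 < e ->
  exists2 x : R, 0 < x < e & V (catenoid_map f a (x *: v + q)).
Proof.
move=> sol VX e0.
have : \forall x \near (0 : R), V (catenoid_map f a (x *: v + q)).
  by apply: catenoid_curve_continuous => //; rewrite scale0r add0r.
move=> /nbhs_ballP[d /= d0 Hd].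
have m0 : 0 < Num.min d e by rewrite lt_min d0.
exists (Num.min d e / 2).
  by rewrite divr_gt0//= ltr_pdivrMr// (@le_lt_trans _ _ e) ?ge_min ?lexx ?orbT// ltr_pMr// ltr1n.
apply: Hd; rewrite -ball_normE /ball_/= sub0r normrN gtr0_norm ?divr_gt0//.
by rewrite ltr_pdivrMr// (@le_lt_trans _ _ d) ?ge_min ?lexx// ltr_pMr// ltr1n.
Qed.

Lemma catenoid_slice_rel_interior (R : realType) (f : R -> R -> R) (a : R) (I : set R) :
  open I -> rel_interior (catenoid_map f a) (catenoid_slice f a I) = catenoid_slice f a I.
Proof.
move=> oI; apply/seteqP; split=> [p []//|p [Xp Ip]]; split=> //.
exists [set p : 'rV[R]_3 | I (p 0 2)]; last by move=> p' [Ip' Xp']; split.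
split=> //.
apply: (@open_comp _ _ (fun p : 'rV[R]_3 => p 0 2) I) => // p' _.
exact: coord_continuous.
Qed.

(** The slice is the image of the convex set of parameters with t in I, hence a union of images of
    segments issuing from one point. *)
Lemma catenoid_slice_connected (R : realType) (f : R -> R -> R) (a : R) (I : set R) :
  catenary_solution a (f a) -> is_interval I -> connected (catenoid_slice f a I).
Proof.
move=> sol iI; have [[t0 It0]|I0] := pselect (exists t, I t); last first.
  rewrite (_ : catenoid_slice f a I = set0); first exact: connected0.
  by apply/seteqP; split=> // p [_ Ip]; apply: I0; exists (p 0 2).
pose q0 : 'rV[R]_2 := vec2 t0 0.
have -> : catenoid_slice f a I = \bigcup_(q in [set q : 'rV[R]_2 | I (q 0 0)])
    ((fun x : R => catenoid_map f a (x *: (q - q0) + q0)) @` `[0, 1]).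
  apply/seteqP; split=> [p [[q _ <-] Ip]|p [q /= Iq [x]]].
    rewrite catenoid_map_z in Ip; exists q => //; exists 1; first by rewrite /= in_itv/= ler01 lexx.
    by rewrite scale1r subrK.
  rewrite /= in_itv/= => /andP[x0 x1] <-.
  apply/catenoid_sliceE; rewrite !mxE/=.
  have [tq|qt] := leP t0 (q 0 0).
    apply: (iI _ _ It0 Iq); apply/andP; split.
      by rewrite lerDr mulr_ge0// subr_ge0.
    by rewrite -lerBrDr ler_piMl// subr_ge0.
  apply: (iI _ _ Iq It0); apply/andP; split.
    rewrite -lerBlDr -[leLHS]mul1r.
    by rewrite ler_wnM2r// subr_le0 ltW.
  by rewrite gerDr mulr_ge0_le0// subr_le0 ltW.
apply: bigcup_connected.
  exists (catenoid_map f a q0) => q _; exists 0; first by rewrite /= in_itv/= ler01 lexx.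
  by rewrite scale0r add0r.
move=> q _; apply: connected_continuous_connected; first exact: segment_connected.
by apply: continuous_subspaceT; exact: catenoid_curve_continuous.
Qed.

Lemma catenoid_slice_domain (R : realType) (f : R -> R -> R) (a : R) (I : set R) :
  catenary_solution a (f a) -> open I -> is_interval I -> I !=set0 ->
  is_domain (catenoid_map f a) (catenoid_slice f a I).
Proof.
move=> sol oI iI [t It]; split.
- by move=> p [].
- exact: catenoid_slice_rel_interior.
- by exists (catenoid_map f a (vec2 t 0)); apply/catenoid_sliceE; rewrite mxE.
- exact: catenoid_slice_connected.
Qed.

Lemma catenoid_band_compact (R : realType) (f : R -> R -> R) (a s t : R) :
  catenary_solution a (f a) -> compact (catenoid_band f a s t).
Proof.
move=> sol; rewrite /catenoid_band; apply: continuous_compact.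
  by apply: continuous_subspaceT; exact: continuous_catenoid_map.
pose A (i : 'I_2) : set R := if i == 0 then `[s, t]%classic else `[0, 2 * pi]%classic.
rewrite (_ : mkset _ = [set v : 'rV[R]_2 | forall i, A i (v ord0 i)]).
  have cA i : compact (A i) by rewrite /A; case: ifP => _; exact: segment_compact.
  exact: rV_compact cA.
apply/seteqP; split=> [q [q0 q1] i|q H].
  by case: (ord2_cases i) => ->; rewrite /A /= in_itv.
by have := H 0; have := H 1; rewrite /A /= !in_itv.
Qed.

Lemma catenoid_band_closure (R : realType) (f : R -> R -> R) (a s t : R) :
  catenary_solution a (f a) -> closure (catenoid_band f a s t) = catenoid_band f a s t.
Proof.
move=> sol; apply/esym/closure_id; apply: compact_closed; first exact: norm_hausdorff.
exact: catenoid_band_compact.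
Qed.

(** At an end circle, an arbitrarily small step in the t direction leaves the band while staying on
    the catenoid. *)
Lemma catenoid_band_rel_interior (R : realType) (f : R -> R -> R) (a s t : R) :
  catenary_solution a (f a) ->
  rel_interior (catenoid_map f a) (catenoid_band f a s t) =
  catenoid_slice f a [set u | s < u < t].
Proof.
move=> sol; rewrite catenoid_bandE; apply/seteqP; split=> [p [[[q _ <-]]]|p Hp].
  rewrite /= catenoid_map_z => /andP[sq qt] [V Vo VD].
  apply/catenoid_sliceE => /=.
  have VX : nbhs (catenoid_map f a q) V by exact: open_nbhs_nbhs.
  have step (e x : R) : V (catenoid_map f a (x *: (e *: delta_mx 0 0) + q)) ->
      s <= x * e + q 0 0 <= t.
    move=> Vx; have : catenoid_slice f a [set u | s <= u <= t]
        (catenoid_map f a (x *: (e *: delta_mx 0 0) + q)).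
      by apply: VD; split=> //; eexists.
    by move/catenoid_sliceE; rewrite !mxE/= mulr1.
  rewrite !lt_neqAle sq qt !andbT; apply/andP; split; apply/eqP => E.
    have [x /andP[x0 _] /step] := catenoid_near (-1 *: delta_mx 0 0) sol VX ltr01.
    by rewrite -E mulrN1 => /andP[]; rewrite lerDr oppr_ge0 leNgt x0.
  have [x /andP[x0 _] /step] := catenoid_near (1 *: delta_mx 0 0) sol VX ltr01.
  by rewrite E mulr1 => /andP[_]; rewrite gerDr leNgt x0.
have E : [set u : R | s < u < t] = `]s, t[%classic.
  by apply/seteqP; split=> u; rewrite /= in_itv.
have oI : open [set u : R | s < u < t] by rewrite E; exact: itv_open.
move: Hp; rewrite -{1}(catenoid_slice_rel_interior f a oI) => -[[Xp /= /andP[sp pt]] [V Vo VD]].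
split; first by split=> //=; rewrite !ltW.
by exists V => // p' /VD [Xp' /= /andP[? ?]]; split=> //=; rewrite !ltW.
Qed.

Lemma Ck_cst (R : realType) (n k : nat) (U : set 'rV[R]_n) (c : R) :
  Ck k U (fun=> c).
Proof.
elim: k c => [|k IH] c; split=> //; try by move=> p _; exact: cst_continuous.
move=> i; split=> [p _|]; first exact: derivable_cst.
rewrite (_ : partial i _ = fun=> 0) //.
by apply/funext => p; apply: partial_val; exact: is_derive_cst.
Qed.

Lemma smooth_affine (R : realType) (n : nat) (i : 'I_n.+1) (U : set 'rV[R]_n.+1) (b c : R) :
  smooth_on U (fun q => b * q 0 i + c) /\
  forall q, partial i (fun q => b * q 0 i + c) q = b.
Proof.
have D (q v : 'rV[R]_n.+1) : is_derive q v (fun q => b * q 0 i + c) (b * v 0 i).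
  by have D := is_derive_coord i q v; apply: is_derive_eq; rewrite /GRing.scale/=; ring.
have Pj j : partial j (fun q : 'rV[R]_n.+1 => b * q 0 i + c) = fun=> b * (delta_mx 0 j : 'rV[R]_n.+1) 0 i.
  by apply/funext => q; apply: partial_val.
split=> [k|q]; last by rewrite Pj mxE !eqxx mulr1.
have cc (p : 'rV[R]_n.+1) : {for p, continuous (fun q : 'rV[R]_n.+1 => b * q 0 i + c)}.
  have ci : {for p, continuous (fun q : 'rV[R]_n.+1 => q 0 i)} by exact: coord_continuous.
  have ck (y : R) : {for p, continuous (fun _ : 'rV[R]_n.+1 => y)} by apply: cst_continuous.
  exact: continuous_at_add (continuous_at_mul (ck b) ci) (ck c).
case: k => [|k]; split=> // j; split; first by move=> p _; case: (D p (delta_mx 0 j)).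
by rewrite Pj; exact: Ck_cst.
Qed.

(** * Stability of bands and of half catenoids *)

Lemma catenoid_band_regular (R : realType) (f : R -> R -> R) (a s t : R) :
  catenary_solution a (f a) -> s < t ->
  regular_domain (catenoid_map f a) (catenoid_band f a s t).
Proof.
move=> sol st.
have E : [set u : R | s < u < t] = `]s, t[%classic.
  by apply/seteqP; split=> u; rewrite /= in_itv.
have oI : open [set u : R | s < u < t] by rewrite E; exact: itv_open.
have iI : is_interval [set u : R | s < u < t].
  by rewrite E; exact: interval_is_interval.
have intE := catenoid_band_rel_interior s t sol.
have cz (i : 'I_2) : continuous (fun q : 'rV[R]_2 => q 0 i) by exact: coord_continuous.
split.
- rewrite intE; apply: catenoid_slice_domain => //.
  by exists ((s + t) / 2) => /=; apply/andP; split; lra.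
- rewrite intE catenoid_bandE => p [[q _ <-]]; rewrite /= catenoid_map_z => /andP[sq qt] B BX.
  (* A small step towards the middle height enters the open slice, even from an end circle. *)
  pose mid := (s + t) / 2 - q 0 0.
  have [x /andP[x0 x1] Bx] := catenoid_near (mid *: delta_mx 0 0) sol BX ltr01.
  exists (catenoid_map f a (x *: (mid *: delta_mx 0 0) + q)); split=> //.
  apply/catenoid_sliceE; rewrite /= !mxE/= mulr1 /mid.
  have -> : x * ((s + t) / 2 - q 0 0) + q 0 0 = (1 - x) * q 0 0 + x * ((s + t) / 2) by ring.
  have d1 : 0 <= (1 - x) * (q 0 0 - s) by rewrite mulr_ge0 ?subr_ge0// ltW.
  have d2 : 0 <= (1 - x) * (t - q 0 0) by rewrite mulr_ge0 ?subr_ge0// ltW.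
  have d3 : 0 < x * (t - s) by rewrite mulr_gt0 ?subr_gt0.
  by apply/andP; split; lra.
- by rewrite catenoid_band_closure//; exact: catenoid_band_compact.
- by rewrite catenoid_band_closure// catenoid_bandE => p [].
- move=> q; rewrite /rel_boundary catenoid_band_closure// intE catenoid_bandE.
  move=> [/catenoid_sliceE/= /andP[sq qt] /catenoid_sliceE/= nq].
  have [qs|sq'] := leP (q 0 0) s.
    (* In the chart neighbourhood q 0 0 < t only the lower end is visible, and s - q 0 0 is a
       defining function; the upper end is treated symmetrically. *)
    have qE : q 0 0 = s by apply/eqP; rewrite eq_le qs.
    have [sm dm] := smooth_affine (0 : 'I_2) [set q' : 'rV[R]_2 | q' 0 0 < t] (- 1) s.
    exists [set q' : 'rV[R]_2 | q' 0 0 < t], (fun q' => - 1 * q' 0 0 + s); split=> //.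
    + split; last by rewrite /= qE.
      by apply: (@open_comp _ _ (fun q : 'rV[R]_2 => q 0 0) [set u : R | u < t]) => [q' _|];
        [exact: cz|exact: open_lt].
    + by exists 0; rewrite dm oppr_eq0 oner_eq0.
    + move=> q' /= q't; split=> [/catenoid_sliceE/= /andP[sq' _]|h]; first lra.
      by apply/catenoid_sliceE => /=; apply/andP; split; lra.
  have qE : q 0 0 = t.
    apply/eqP; rewrite eq_le qt leNgt; apply/negP => qt'.
    by apply: nq; rewrite sq' qt'.
  have [sm dm] := smooth_affine (0 : 'I_2) [set q' : 'rV[R]_2 | s < q' 0 0] 1 (- t).
  exists [set q' : 'rV[R]_2 | s < q' 0 0], (fun q' => 1 * q' 0 0 + - t); split=> //.
  + split; last by rewrite /= qE.
    by apply: (@open_comp _ _ (fun q : 'rV[R]_2 => q 0 0) [set u : R | s < u]) => [q' _|];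
      [exact: cz|exact: open_gt].
  + by exists 0; rewrite dm oner_eq0.
  + move=> q' /= sq'0; split=> [/catenoid_sliceE/= /andP[_ q't]|h]; first lra.
    by apply/catenoid_sliceE => /=; apply/andP; split; lra.
Qed.

Lemma cat_op_superE (R : realType) (f : R -> R -> R) (a t w w1 w2 : R) :
  - cat_op f a t w w1 w2 = - (a ^+ 2 * (f a t ^+ 2 + 4) / (4 * f a t ^+ 2) * w2
     + a ^+ 2 * derive1 (f a) t / (2 * f a t) * w1) - cat_potential a (f a t) * w.
Proof. by rewrite /cat_op opprD. Qed.

Lemma partial_height (R : realType) (h h1 : R -> R) (i : 'I_2) :
  (forall t : R, is_derive t 1 h (h1 t)) ->
  (forall q : 'rV[R]_2, is_derive q (delta_mx 0 i) (fun q => h (q 0 0)) ((i == 0)%:R * h1 (q 0 0))).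
Proof.
move=> dh q; apply: (is_derive_eq (is_derive_compr (is_derive_coord 0 q (delta_mx 0 i)) (dh _))).
by rewrite mxE/= eq_sym mulrC.
Qed.

Lemma partial_heightE (R : realType) (h h1 : R -> R) (i : 'I_2) :
  (forall t : R, is_derive t 1 h (h1 t)) ->
  partial i (fun q : 'rV[R]_2 => h (q 0 0)) = fun q => (i == 0)%:R * h1 (q 0 0).
Proof.
by move=> dh; apply/funext => q; apply: partial_val; exact: partial_height.
Qed.

Lemma dirichlet_eigenvalue0 (R : realType) (f : R -> R -> R) (a s t : R) (w w1 w2 : R -> R) :
  0 < a -> catenary_solution a (f a) -> s < 0 < t ->
  (forall u : R, is_derive u 1 w (w1 u)) -> (forall u : R, is_derive u 1 w1 (w2 u)) ->
  continuous w2 -> (forall u, cat_op f a u (w u) (w1 u) (w2 u) = 0) ->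
  w s = 0 -> w t = 0 -> w 0 != 0 ->
  dirichlet_eigenvalue nil_metric (catenoid_map f a) (catenoid_band f a s t) 0.
Proof.
move=> a0 sol /andP[s0 t0] dw dw1 cw2 Jw ws wt w0.
have intE := catenoid_band_rel_interior s t sol.
have comp (h : R -> R) : continuous h ->
    forall q : 'rV[R]_2, {for q, continuous (fun q : 'rV[R]_2 => h (q 0 0))}.
  move=> ch q; apply: (@continuous_comp _ _ _ (fun q : 'rV[R]_2 => q 0 0) h).
    exact: coord_continuous.
  exact: ch.
have comp' (k : R) (h : R -> R) : continuous h ->
    forall q : 'rV[R]_2, {for q, continuous (fun q : 'rV[R]_2 => k * h (q 0 0))}.
  move=> ch q; apply: continuous_at_mul; [exact: cst_continuous|exact: comp].
have cw : continuous w by move=> u; exact: is_derive_cont (dw u).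
have cw1 : continuous w1 by move=> u; exact: is_derive_cont (dw1 u).
have XE : (fun p : 'rV[R]_3 => w (p 0 2)) \o catenoid_map f a = fun q : 'rV[R]_2 => w (q 0 0).
  by apply/funext => q /=; rewrite catenoid_map_z.
have P1 (i : 'I_2) : partial i (fun q : 'rV[R]_2 => w (q 0 0)) =
    fun q => (i == 0)%:R * w1 (q 0 0) by exact: partial_heightE.
have dP (i j : 'I_2) (q : 'rV[R]_2) : is_derive q (delta_mx 0 j)
   (fun q : 'rV[R]_2 => (i == 0)%:R * w1 (q 0 0))
   ((i == 0)%:R * ((j == 0)%:R * w2 (q 0 0))).
  have D := partial_height j dw1 q.
  by apply: is_derive_eq; rewrite /GRing.scale/=; ring.
have P2 (i j : 'I_2) : partial j (fun q : 'rV[R]_2 => (i == 0)%:R * w1 (q 0 0)) =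
    fun q => (i == 0)%:R * ((j == 0)%:R * w2 (q 0 0)).
  by apply/funext => q; apply: partial_val.
exists (fun p => w (p 0 2)); split.
- exists (catenoid_map f a (vec2 0 0)); last by rewrite catenoid_map_z mxE.
  by rewrite intE; apply/catenoid_sliceE; rewrite /= mxE s0 t0.
- rewrite XE; split=> [q _|i]; first exact: comp.
  split=> [q _|]; first by case: (partial_height i dw q).
  rewrite P1; split=> [q _|j]; first exact: comp'.
  split=> [q _|]; first by case: (dP i j q).
  rewrite P2; split=> // q _; apply: continuous_at_mul; first exact: cst_continuous.
  exact: comp'.
- apply: continuous_subspaceT => p.
  apply: (@continuous_comp _ _ _ (fun p : 'rV[R]_3 => p 0 2) w); last exact: cw.
  exact: coord_continuous.
- move=> p; rewrite /rel_boundary catenoid_band_closure// intE catenoid_bandE => -[[[q _ <-]]].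
  rewrite catenoid_map_z /= => /andP[sq qt] nq.
  have [qs|sq'] := leP (q 0 0) s.
    by have -> : q 0 0 = s by apply/eqP; rewrite eq_le qs.
  have [tq|qt'] := leP t (q 0 0).
    by have -> : q 0 0 = t by apply/eqP; rewrite eq_le qt.
  by case: nq; apply/catenoid_sliceE; rewrite /= sq'.
- move=> q _; rewrite mul0r XE catenoid_jacobiE//; last first.
    by move=> i j; rewrite P1; case: (dP i j q).
  rewrite !P1 !P2 /= !mul1r !mul0r.
  transitivity (- cat_op f a (q 0 0) (w (q 0 0)) (w1 (q 0 0)) (w2 (q 0 0))).
    by rewrite /cat_op; ring.
  by rewrite Jw oppr0.
Qed.

(** The infimum of an empty set is +oo, so a lower bound on eigenvalues suffices and the existence
    of a first eigenvalue never enters. *)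
Lemma lambda1_ge (R : realType) (f : R -> R -> R) (a : R) (D : set 'rV[R]_3) (l : R) :
  (forall l', dirichlet_eigenvalue nil_metric (catenoid_map f a) D l' -> l <= l') ->
  (l%:E <= lambda1 nil_metric (catenoid_map f a) D)%E.
Proof.
move=> H; apply: le_ereal_inf_tmp => _ [l' Hl' <-].
by rewrite lee_fin H.
Qed.

Lemma band_stable_unstable (R : realType) (f : R -> R -> R) (a : R) (tau : R -> R) (c t1 t2 : R) :
  0 < a -> catenary_solution a (f a) ->
  (forall t : R, is_derive t 1 tau (cat_tau1 f a t)) ->
  0 < t1 -> 0 < t2 -> cat_w f a tau c (- t1) = 0 -> cat_w f a tau c t2 = 0 ->
  stable_unstable nil_metric (catenoid_map f a) (catenoid_band f a (- t1) t2).
Proof.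
move=> a0 sol dtau t1_gt0 t2_gt0 w1 w2.
have nt1 : - t1 < 0 by rewrite oppr_lt0.
have reg : regular_domain (catenoid_map f a) (catenoid_band f a (- t1) t2).
  by apply: catenoid_band_regular => //; exact: lt_trans t2_gt0.
have ev0 : dirichlet_eigenvalue nil_metric (catenoid_map f a) (catenoid_band f a (- t1) t2) 0.
  have dw (u : R) := cat_w_derive c a0 sol (dtau u).
  have dw1 (u : R) := cat_w1_derive c a0 sol (dtau u).
  have cw2 := @cat_w2_continuous R f a tau c a0 sol dtau.
  have Jw (u : R) := cat_family_jacobi u c (tau u) a0 sol.
  have st : - t1 < 0 < t2 by rewrite nt1.
  have w0 : cat_w f a tau c 0 != 0 by rewrite /cat_w cat_v0// mulr0 addr0 oner_eq0.
  exact: (dirichlet_eigenvalue0 a0 sol st dw dw1 cw2 Jw w1 w2 w0).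
split=> //; apply/eqP; rewrite eq_le; apply/andP; split.
  by apply: ereal_inf_lbound; exists 0.
apply: lambda1_ge => l Hl; rewrite leNgt; apply/negP => l0.
have w_gt0 u : - t1 < u < t2 -> 0 < cat_w f a tau c u.
  move=> /andP[u1 u2]; have [u0|u0] := leP 0 u.
    by rewrite (cat_w_gt0 a0 sol dtau t2_gt0 w2 u0).
  by apply: (cat_w_gt0_neg a0 sol dtau nt1 w1); rewrite u1 ltW.
(* With d = - l / 2 the comparison gives l / 2 <= l, impossible for l < 0. *)
have d0 : 0 < - l / 2 by rewrite divr_gt0// oppr_gt0.
have [W [W1 [W2 [[dW dW1] cW2 HW]]]] := cat_near_supersolution a0 sol dtau t1_gt0 t2_gt0 d0 w_gt0 w1 w2.
suff : - (- l / 2) <= l by lra.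
have bE p : closure (catenoid_band f a (- t1) t2) p -> - t1 <= p 0 2 <= t2.
  by rewrite catenoid_band_closure// catenoid_bandE => -[].
apply: (@dirichlet_eigenvalue_ge R f a _ l _ W W1 W2 a0 sol _ _ dW dW1 cW2 _ _ Hl).
- by rewrite catenoid_band_closure//; exact: catenoid_band_compact.
- by rewrite catenoid_band_closure// catenoid_bandE => p [].
- by move=> p /bE/HW[].
- by move=> p /bE/HW[_ +]; rewrite cat_op_superE.
Qed.

Lemma height_nbhs (R : realType) (I : set R) (p : 'rV[R]_3) :
  open I -> I (p 0 2) -> nbhs p [set p' : 'rV[R]_3 | I (p' 0 2)].
Proof.
move=> oI Ip; apply: open_nbhs_nbhs; split=> //.
apply: (@open_comp _ _ (fun p : 'rV[R]_3 => p 0 2) I) => // p' _.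
exact: coord_continuous.
Qed.

Lemma regular_height_bounded (R : realType) (X : 'rV[R]_2 -> 'rV[R]_3) (D : set 'rV[R]_3) :
  regular_domain X D -> exists2 T : R, 0 < T & forall p, closure D p -> `|p 0 2| <= T.
Proof.
move=> [[_ _ [p0 p0D] _] _ cD _ _].
have cz : {within closure D, continuous (fun p : 'rV[R]_3 => `|p 0 2|)}.
  apply: continuous_subspaceT => p.
  apply: (@continuous_comp _ _ _ (fun p : 'rV[R]_3 => p 0 2) (fun x : R => `|x|)).
    exact: coord_continuous.
  exact: norm_continuous.
have D0 : closure D !=set0 by exists p0; apply: subset_closure; case: p0D.
have [c _ H] := compact_EVT_max D0 cD cz.
exists (`|c 0 2| + 1); first by rewrite ltr_wpDl.
by move=> p Dp; rewrite ler_wpDr// H// inE.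
Qed.

Lemma stable_of_positive (R : realType) (f : R -> R -> R) (a : R) (tau : R -> R)
    (c s t : R) (D : set 'rV[R]_3) :
  0 < a -> catenary_solution a (f a) ->
  (forall t : R, is_derive t 1 tau (cat_tau1 f a t)) ->
  regular_domain (catenoid_map f a) D -> s <= t ->
  (forall p, closure D p -> s <= p 0 2 <= t) ->
  (forall u, s <= u <= t -> 0 < cat_w f a tau c u) ->
  stable nil_metric (catenoid_map f a) D.
Proof.
move=> a0 sol dtau [_ _ cD DX _] st Dst w_gt0.
have dw (u : R) := cat_w_derive c a0 sol (dtau u).
have dw1 (u : R) := cat_w1_derive c a0 sol (dtau u).
have cw2 := @cat_w2_continuous R f a tau c a0 sol dtau.
have Jw (u : R) := cat_family_jacobi u c (tau u) a0 sol.
have [d [W [W1 [W2 [d0 [dW dW1] cW2 HW]]]]] :=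
  cat_strict_supersolution a0 sol st dw dw1 cw2 w_gt0 Jw.
apply: (@lt_le_trans _ _ d%:E); first by rewrite lte_fin.
apply: lambda1_ge => l Hl.
apply: (@dirichlet_eigenvalue_ge R f a D l d W W1 W2 a0 sol cD DX dW dW1 cW2 _ _ Hl).
- by move=> p /Dst/HW[].
- by move=> p /Dst/HW[_ +]; rewrite cat_op_superE.
Qed.

(** The function v is positive on the open half but vanishes at height 0, which the closure of a
    subdomain may reach. Instead c is chosen so that e + c v, equal to 1 at height 0, has its
    positive zero at T + 1, beyond the subdomain. *)
Lemma upper_half_r_stable (R : realType) (f : R -> R -> R) (a : R) (tau : R -> R) :
  0 < a -> catenary_solution a (f a) ->
  (forall t : R, is_derive t 1 tau (cat_tau1 f a t)) ->
  r_stable nil_metric (catenoid_map f a) (upper_half f a).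
Proof.
move=> a0 sol dtau D regD DU.
have [T T0 HT] := regular_height_bounded regD.
have T1 : 0 < T + 1 by rewrite addr_gt0.
pose c := cat_kappa f a tau (T + 1).
have wT : cat_w f a tau c (T + 1) = 0 by rewrite cat_wE ?gt_eqF// subrr mulr0.
apply: (@stable_of_positive R f a tau c 0 T D a0 sol dtau regD (ltW T0)).
- move=> p Dp; apply/andP; split; last by rewrite (le_trans (ler_norm _))// HT.
  rewrite leNgt; apply/negP => pz.
  have [p' [/DU[_ /= p'0] /= ]] := Dp _ (height_nbhs (@open_lt R 0) pz).
  by rewrite ltNge ltW.
- move=> u /andP[u0 uT]; rewrite (cat_w_gt0 a0 sol dtau T1 wT u0).
  by rewrite (le_lt_trans uT)// ltrDl.
Qed.

Lemma lower_half_r_stable (R : realType) (f : R -> R -> R) (a : R) (tau : R -> R) :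
  0 < a -> catenary_solution a (f a) ->
  (forall t : R, is_derive t 1 tau (cat_tau1 f a t)) ->
  r_stable nil_metric (catenoid_map f a) (lower_half f a).
Proof.
move=> a0 sol dtau D regD DU.
have [T T0 HT] := regular_height_bounded regD.
have T1 : - (T + 1) < 0 by rewrite oppr_lt0 addr_gt0.
pose c := cat_kappa f a tau (- (T + 1)).
have wT : cat_w f a tau c (- (T + 1)) = 0 by rewrite cat_wE ?lt_eqF// subrr mulr0.
have nT : - T <= 0 by rewrite oppr_le0 ltW.
apply: (@stable_of_positive R f a tau c (- T) 0 D a0 sol dtau regD nT).
- move=> p Dp; apply/andP; split.
    by have := HT p Dp; rewrite ler_norml => /andP[].
  rewrite leNgt; apply/negP => pz.
  have [p' [/DU[_ /= p'0] /= ]] := Dp _ (height_nbhs (@open_gt R 0) pz).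
  by rewrite ltNge ltW.
- move=> u /andP[uT u0]; apply: (cat_w_gt0_neg a0 sol dtau T1 wT).
  by rewrite u0 andbT; lra.
Qed.

Lemma cat_v_odd (R : realType) (f : R -> R -> R) (a t : R) :
  0 < a -> catenary_solution a (f a) -> cat_v f a (- t) = - cat_v f a t.
Proof.
move=> a0 sol; rewrite /cat_v (catenary_even t a0 sol).
suff -> : derive1 (f a) (- t) = - derive1 (f a) t by rewrite mulrN mulNr.
have E : (fun u : R => f a (- u)) = f a by apply/funext => u; exact: (catenary_even u a0 sol).
have D1 : is_derive t 1 (fun u : R => f a (- u)) (derive1 (f a) (- t) * -1).
  exact: (is_derive_compr _ (catenary_derive (- t) sol)).
rewrite E in D1; have D2 := catenary_derive t sol.
have : derive1 (f a) (- t) * -1 = derive1 (f a) t.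
  by rewrite -(@derive_val _ _ _ _ _ _ _ D1) -(@derive_val _ _ _ _ _ _ _ D2).
by move=> <-; rewrite mulrN1 opprK.
Qed.

Lemma cat_tau_odd (R : realType) (f : R -> R -> R) (a : R) (tau : R -> R) (t : R) :
  0 < a -> catenary_solution a (f a) -> tau 0 = 0 ->
  (forall t : R, is_derive t 1 tau (cat_tau1 f a t)) -> tau (- t) = - tau t.
Proof.
move=> a0 sol tau0 dtau.
have D (s : R) : is_derive s 1 (fun u : R => tau (- u) + tau u) 0.
  have D1 : is_derive s 1 (fun u : R => tau (- u)) (cat_tau1 f a (- s) * -1).
    by apply: is_derive_compr.
  have D2 := dtau s; apply: is_derive_eq.
  by rewrite /cat_tau1 (catenary_even s a0 sol); ring.
have := is_derive_0_is_cst t 0 D; rewrite oppr0 tau0 addr0 => /eqP.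
by rewrite addr_eq0 => /eqP.
Qed.

Lemma cat_w_opp (R : realType) (f : R -> R -> R) (a : R) (tau : R -> R) (c t : R) :
  0 < a -> catenary_solution a (f a) -> tau 0 = 0 ->
  (forall t : R, is_derive t 1 tau (cat_tau1 f a t)) ->
  cat_w f a tau c (- t) = cat_w f a tau (- c) t.
Proof.
move=> a0 sol tau0 dtau.
by rewrite /cat_w (cat_tau_odd t a0 sol tau0 dtau) (cat_v_odd t a0 sol); ring.
Qed.

Lemma stable_unstable_right (R : realType) (f : R -> R -> R) (a : R) (tau : R -> R) (t1 : R) :
  0 < a -> catenary_solution a (f a) ->
  (forall t : R, is_derive t 1 tau (cat_tau1 f a t)) -> 0 < t1 ->
  exists2 t2, 0 < t2 & stable_unstable nil_metric (catenoid_map f a) (catenoid_band f a (- t1) t2).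
Proof.
move=> a0 sol dtau t1_gt0.
pose c := cat_kappa f a tau (- t1).
have w1 : cat_w f a tau c (- t1) = 0.
  by rewrite cat_wE ?lt_eqF ?oppr_lt0// subrr mulr0.
have [t2 t2_gt0 w2] := cat_w_zero c a0 sol dtau.
by exists t2 => //; exact: band_stable_unstable w1 w2.
Qed.

(** [cat_w_zero] yields positive zeros only; since tau and v are odd, reflection in t changes c into
    - c and moves such a zero to the negative side. *)
Lemma stable_unstable_left (R : realType) (f : R -> R -> R) (a : R) (tau : R -> R) (t2 : R) :
  0 < a -> catenary_solution a (f a) -> tau 0 = 0 ->
  (forall t : R, is_derive t 1 tau (cat_tau1 f a t)) -> 0 < t2 ->
  exists2 t1, 0 < t1 & stable_unstable nil_metric (catenoid_map f a) (catenoid_band f a (- t1) t2).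
Proof.
move=> a0 sol tau0 dtau t2_gt0.
pose c := cat_kappa f a tau t2.
have w2 : cat_w f a tau c t2 = 0 by rewrite cat_wE ?gt_eqF// subrr mulr0.
have [t1 t1_gt0 w1] := cat_w_zero (- c) a0 sol dtau.
rewrite -(cat_w_opp c t1 a0 sol tau0 dtau) in w1.
by exists t1 => //; exact: band_stable_unstable w1 w2.
Qed.

(** * Rotationally invariant domains and maximality *)

Lemma rotation_catenoid (R : realType) (f : R -> R -> R) (a phi : R) (q : 'rV[R]_2) :
  rotation phi (catenoid_map f a q) = catenoid_map f a (vec2 (q 0 0) (q 0 1 + phi)).
Proof.
rewrite /catenoid_map /rotation; apply/rowP => k.
case: k => [[|[|[|//]]] hk]; rewrite !mxE/= ?mxE/= ?cosD ?sinD //; ring.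
Qed.

Lemma rotationally_invariant_slice (R : realType) (f : R -> R -> R) (a : R) (I : set R) :
  rotationally_invariant (catenoid_slice f a I).
Proof.
move=> phi p [[q _ <-] Ip]; rewrite rotation_catenoid; apply/catenoid_sliceE.
by move: Ip; rewrite /= catenoid_map_z mxE.
Qed.

(** By connectedness the heights attained in E form an interval, and a rotation carries a point of E
    to any other point of the catenoid at the same height. *)
Lemma invariant_domain_slice (R : realType) (f : R -> R -> R) (a s t : R) (E : set 'rV[R]_3) :
  is_domain (catenoid_map f a) E -> rotationally_invariant E ->
  (exists2 p, E p & p 0 2 = s) -> (exists2 p, E p & p 0 2 = t) ->
  catenoid_band f a s t `<=` E.
Proof.
move=> [EX _ _ cE] rE [p Ep ps] [p' Ep' pt].
have iE : is_interval ((fun p : 'rV[R]_3 => p 0 2) @` E).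
  apply/connected_intervalP/connected_continuous_connected => //.
  by apply: continuous_subspaceT => ?; exact: coord_continuous.
rewrite catenoid_bandE => _ [[q _ <-]]; rewrite /= catenoid_map_z => qst.
have [p'' Ep'' zp] : ((fun p : 'rV[R]_3 => p 0 2) @` E) (q 0 0).
  by apply: (iE s t) => //; [exists p|exists p'].
have [q' _ q'E] := EX _ Ep''.
have := rE (q 0 1 - q' 0 1) _ Ep''; rewrite -q'E rotation_catenoid.
rewrite -q'E catenoid_map_z in zp.
by rewrite /catenoid_map !mxE/= zp addrC subrK.
Qed.

(** A domain strictly larger than a half catenoid might be known to contain only a point at height
    0. Relative openness moves it strictly to the other side, as the bands require. *)
Lemma domain_push (R : realType) (f : R -> R -> R) (a e : R) (E : set 'rV[R]_3) (p : 'rV[R]_3) :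
  catenary_solution a (f a) -> is_domain (catenoid_map f a) E -> E p ->
  exists x : R, 0 < x /\ exists2 p', E p' & p' 0 2 = p 0 2 + x * e.
Proof.
move=> sol [EX intE _ _] Ep; have [q _ qE] := EX _ Ep.
have : rel_interior (catenoid_map f a) E p by rewrite intE.
rewrite -qE => -[_ [V Vo VE]].
have [x /andP[x0 _] Vx] := catenoid_near (e *: delta_mx 0 0) sol (open_nbhs_nbhs Vo) ltr01.
exists x; split=> //; exists (catenoid_map f a (x *: (e *: delta_mx 0 0) + q)).
  by apply: VE; split=> //; eexists.
by rewrite !catenoid_map_z !mxE/= mulr1 addrC.
Qed.

Lemma stable_unstable_not_stable (R : realType) (X : 'rV[R]_2 -> 'rV[R]_3)
    (g : 'rV[R]_3 -> 'M[R]_3) (D E : set 'rV[R]_3) :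
  stable_unstable g X D -> D `<=` E -> ~ r_stable g X E.
Proof.
by move=> [regD _ l0] DE /(_ D regD DE); rewrite /stable l0 ltxx.
Qed.

Lemma upper_half_maximal (R : realType) (f : R -> R -> R) (a : R) (tau : R -> R) :
  0 < a -> catenary_solution a (f a) ->
  (forall t : R, is_derive t 1 tau (cat_tau1 f a t)) ->
  maximal_r_stable_rot_domain f a (upper_half f a).
Proof.
move=> a0 sol dtau; split.
  split; last exact: upper_half_r_stable dtau.
  - apply: (@catenoid_slice_domain R f a [set u : R | 0 < u] sol (@open_gt R 0)).
      by move=> x y x0 _ z /andP[xz _]; exact: lt_le_trans xz.
    by exists 1; rewrite /= ltr01.
  - exact: (@rotationally_invariant_slice R f a [set u : R | 0 < u]).
move=> E [dE rE sE] UE; apply/seteqP; split=> // p Ep.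
have [EX _ _ _] := dE.
split; first exact: EX.
rewrite /= ltNge; apply/negP => pz.
have [x [x0 [p' Ep' p'z]]] := domain_push (- 1) sol dE Ep.
have t1_gt0 : 0 < - (p' 0 2) by rewrite p'z; lra.
have [t2 t2_gt0 su] := stable_unstable_right a0 sol dtau t1_gt0.
apply: (stable_unstable_not_stable su _ sE).
rewrite opprK; apply: invariant_domain_slice => //; first by exists p'.
exists (catenoid_map f a (vec2 t2 0)); last by rewrite catenoid_map_z mxE.
by apply: UE; apply/(catenoid_sliceE f a [set u : R | 0 < u]); rewrite /= mxE.
Qed.

Lemma lower_half_maximal (R : realType) (f : R -> R -> R) (a : R) (tau : R -> R) :
  0 < a -> catenary_solution a (f a) -> tau 0 = 0 ->
  (forall t : R, is_derive t 1 tau (cat_tau1 f a t)) ->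
  maximal_r_stable_rot_domain f a (lower_half f a).
Proof.
move=> a0 sol tau0 dtau; split.
  split; last exact: lower_half_r_stable dtau.
  - apply: (@catenoid_slice_domain R f a [set u : R | u < 0] sol (@open_lt R 0)).
      by move=> x y _ y0 z /andP[_ zy]; exact: le_lt_trans y0.
    by exists (-1); rewrite /= oppr_lt0 ltr01.
  - exact: (@rotationally_invariant_slice R f a [set u : R | u < 0]).
move=> E [dE rE sE] UE; apply/seteqP; split=> // p Ep.
have [EX _ _ _] := dE.
split; first exact: EX.
rewrite /= ltNge; apply/negP => pz.
have [x [x0 [p' Ep' p'z]]] := domain_push 1 sol dE Ep.
have t2_gt0 : 0 < p' 0 2 by rewrite p'z; lra.
have [t1 t1_gt0 su] := stable_unstable_left a0 sol tau0 dtau t2_gt0.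
apply: (stable_unstable_not_stable su _ sE).
apply: invariant_domain_slice => //; last by exists p'.
exists (catenoid_map f a (vec2 (- t1) 0)); last by rewrite catenoid_map_z mxE.
by apply: UE; apply/(catenoid_sliceE f a [set u : R | u < 0]); rewrite /= mxE oppr_lt0.
Qed.

Lemma cat_eE (R : realType) (f : R -> R -> R) (a : R) (tau : R -> R) (t : R) :
  0 < a -> catenary_solution a (f a) ->
  (forall t : R, is_derive a 1 (fun b => f b t) (f a t / a - derive1 (f a) t * tau t)) ->
  cat_e f a t = cat_w f a tau 0 t.
Proof.
move=> a0 sol H; have f0 := catenary_gt0 a0 sol t.
rewrite /cat_e catWE// derive1E (@derive_val _ _ _ _ _ _ _ (H t)) /cat_w /cat_v.
by field; rewrite !gt_eqF.
Qed.

Theorem theorem3p1 (R : realType) (f : R -> R -> R)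
  (hf : forall b : R, 0 < b -> catenary_solution b (f b))
  (a : R) (ha : 0 < a) :
  let X := catenoid_map f a in
  let e := cat_e f a in
  [/\
    (* (i) *)
    r_stable nil_metric X (upper_half f a) /\
    r_stable nil_metric X (lower_half f a),
    (* (ii) *)
    (forall t : R, e (- t) = e t) /\
    (exists z : R,
      [/\ 0 < z, e z = 0, forall t : R, 0 < t -> e t = 0 -> t = z
        & stable_unstable nil_metric X (catenoid_band f a (- z) z)]),
    (* (iii) *)
    forall t1 : R, 0 < t1 -> exists2 t2 : R, 0 < t2 &
      stable_unstable nil_metric X (catenoid_band f a (- t1) t2)
  & maximal_r_stable_rot_domain f a (upper_half f a) /\
    maximal_r_stable_rot_domain f a (lower_half f a)].
Proof.
move=> X e; have sol := hf a ha.
have [tau [tau0 dtau dfa]] := catenary_variation hf ha.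
have eE t : e t = cat_w f a tau 0 t by exact: cat_eE.
have eN t : e (- t) = e t by rewrite !eE cat_w_opp// oppr0.
split.
- by split; [exact: upper_half_r_stable dtau|exact: lower_half_r_stable dtau].
- split=> //; have [z z0 wz] := cat_w_zero 0 ha sol dtau.
  exists z; split=> //; first by rewrite eE.
    move=> t t0; rewrite eE => wt; apply/eqP; rewrite eq_le !leNgt.
    (* Each of the two zeros determines the sign of e on [0, oo): z < t would make e z positive, and
       t < z would make e t positive. *)
    rewrite -(cat_w_gt0 ha sol dtau t0 wt (ltW z0)).
    by rewrite -(cat_w_gt0 ha sol dtau z0 wz (ltW t0)) wt wz ltxx.
  (* The symmetric band is the case c = 0: by evenness - z is also a zero of e. *)
  by apply: (band_stable_unstable ha sol dtau z0 z0 _ wz); rewrite -eE eN eE.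
- by move=> t1 t1_gt0; exact: stable_unstable_right dtau t1_gt0.
- by split; [exact: upper_half_maximal dtau|exact: lower_half_maximal tau0 dtau].
Qed.
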